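(* Fix $k\in\mathbb N$ and nonzero real numbers $a_1,\dots,a_k$. Set $a:=\max_i a_i$, $m:=\#\{i:a_i=a\}$, $a_\ast:=\max_i|a_i|$, $m_+:=\#\{i:a_i=a_\ast\}$, $m_-:=\#\{i:a_i=-a_\ast\}$, and $$c_m(a_1,\dots,a_k):=\log\Big(\Gamma\big(\tfrac m2\big)\sqrt{\textstyle\prod_{j:\,a_j\ne a}\big(1-\tfrac{a_j}{a}\big)}\Big),$$ $$c^\ast_{m_+,m_-}(a_1,\dots,a_k):=\begin{cases}\log\Big(\Gamma(\frac{m_+}{2})\sqrt{\prod_{j:\,a_j\neq a_\ast}(1-\frac{a_j}{a_\ast})}\Big)&m_+>m_-,\\ \log\Big(\Gamma(\frac{m_-}{2})\sqrt{\prod_{j:\,a_j\neq -a_\ast}(1+\frac{a_j}{a_\ast})}\Big)&m_+<m_-,\\ \log\Big(\Gamma(\frac{m_+}{2})\Big[\Big(\sqrt{\prod_{j:\,a_j\ne a_\ast}(1-\frac{a_j}{a_\ast})}\Big)^{-1}+\Big(\sqrt{\prod_{j:\,a_j\ne -a_\ast}(1+\frac{a_j}{a_\ast})}\Big)^{-1}\Big]^{-1}\Big)&m_+=m_-,\end{cases}$$ with empty products equal to $1$. For each $N\ge k$ let $A_N$ be a deterministic real symmetric $N\times N$ matrix whose spectrum (with multiplicity) is $\{a_1,\dots,a_k,0,\dots,0\}$, and let $\mathbf{u}_1,\dots,\mathbf{u}_N$ be the $\ell^2$-normalized eigenvectors of an $N\times N$ GOE matrix. Let $\Lambda$ be Gumbel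 distributed, $\mathbb P(\Lambda\le x)=\exp(-e^{-x})$, and $\Psi_{k/2}$ be $\frac k2$-Weibull distributed, $\mathbb P(\Psi_{k/2}\le x)=\min(\exp(-(-x)^{k/2}),1)$ (i.e. $\exp(-(-x)^{k/2})$ for $x<0$ and $1$ for $x\ge0$). \begin{enumerate} \item If $a>0$, then as $N\to\infty$, in distribution, $$\frac{N}{2a}\max_{i}\langle\mathbf{u}_i,A_N\mathbf{u}_i\rangle-\log N+\Big(1-\frac m2\Big)\log\log N+c_m(a_1,\dots,a_k)\to\Lambda,$$ $$\frac{N}{2a_\ast}\max_{i}|\langle\mathbf{u}_i,A_N\mathbf{u}_i\rangle|-\log N+\Big(1-\frac{\max(m_+,m_-)}{2}\Big)\log\log N+c^\ast_{m_+,m_-}(a_1,\dots,a_k)\to\Lambda.$$ \item If $a<0$, then with $\gamma_k=\frac12\big(\frac{2}{k\Gamma(k/2)}\big)^{2/k}$, $$\frac{\gamma_kN^{1+\frac2k}}{\big(\prod_{j=1}^k|a_j|\big)^{1/k}}\max_{i}\langle\mathbf{u}_i,A_N\mathbf{u}_i\rangle\to\Psi_{k/2}\quad\text{in distribution.}$$ \end{enumerate}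
   Context: The $N\times N$ GOE consists of real symmetric random matrices whose entries are centered Gaussians, independent up to symmetry, with $\mathbb{E}[H_{ij}^2]=\frac1N(1+\delta_{ij})$. All maxima are over $i=1,\dots,N$. *)

(* Defs.v *)
From HB Require Import structures.
From mathcomp Require Import all_boot all_order all_algebra.
From mathcomp Require Import all_classical all_reals all_analysis.
Set Implicit Arguments. Unset Strict Implicit. Unset Printing Implicit Defensive.
Import Order.TTheory GRing.Theory Num.Theory.
Import numFieldNormedType.Exports.
Local Open Scope classical_set_scope.
Local Open Scope ring_scope.

(* maximum of finitely many reals (value 0 for an empty family, never used) *)
Definition maxI {R : realType} (n : nat) (f : 'I_n -> R) : R :=
  fine (\big[maxe/-oo%E]_(i < n) (f i)%:E).

Definition GammaR {R : realType} (x : R) : R :=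
  fine (\int[@lebesgue_measure R]_(t in `]0%R, +oo[) (t `^ (x - 1) * expR (- t))%:E)%E.

Definition mutually_independent {d} {T : measurableType d} {R : realType}
  (P : probability T R) (I : finType) (J : pred I) (X : I -> T -> R) : Prop :=
  forall B : I -> set R, (forall i, measurable (B i)) ->
    P (\bigcap_(i in [set i | J i]) (X i @^-1` B i)) =
    (\prod_(i in J) P (X i @^-1` B i))%E.

Definition is_GOE {d} {T : measurableType d} {R : realType}
  (P : probability T R) (N : nat) (H : T -> 'M[R]_N) : Prop :=
  [/\ forall t, (H t)^T = H t,
      forall i j, measurable_fun setT (fun t => H t i j),
      forall i j : 'I_N, (i <= j)%N -> forall B : set R, measurable B ->
        P ((fun t => H t i j) @^-1` B) =
        normal_prob 0 (Num.sqrt ((1 + (i == j)%:R) / N%:R)) B &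
      mutually_independent P [pred ij : 'I_N * 'I_N | (ij.1 <= ij.2)%N]
        (fun ij t => H t ij.1 ij.2)].

Definition is_eigvec_matrix {d} {T : measurableType d} {R : realType}
  (N : nat) (H U : T -> 'M[R]_N) : Prop :=
  [/\ forall i j, measurable_fun setT (fun t => U t i j),
      forall t, (U t)^T *m U t = 1%:M &
      forall t (i : 'I_N), exists l : R, H t *m col i (U t) = l *: col i (U t)].

Definition quadf {R : realType} (N : nat) (A : 'M[R]_N) (u : 'cV[R]_N) : R :=
  ((u^T *m A *m u) ord0 ord0).

Section params.
Context {R : realType} (k : nat) (a : 'I_k -> R).
Definition amax : R := maxI a.
Definition mult_m : nat := #|[set i | a i == amax]|.
Definition astar : R := maxI (fun i => `|a i|).
Definition mult_p : nat := #|[set i | a i == astar]|.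
Definition mult_n : nat := #|[set i | a i == - astar]|.
Definition prod_p : R := \prod_(j < k | a j != astar) (1 - a j / astar).
Definition prod_n : R := \prod_(j < k | a j != - astar) (1 + a j / astar).
Definition c_m : R :=
  ln (GammaR ((mult_m)%:R / 2) *
      Num.sqrt (\prod_(j < k | a j != amax) (1 - a j / amax))).
Definition c_star : R :=
  if (mult_n < mult_p)%N then ln (GammaR ((mult_p)%:R / 2) * Num.sqrt prod_p)
  else if (mult_p < mult_n)%N then ln (GammaR ((mult_n)%:R / 2) * Num.sqrt prod_n)
  else ln (GammaR ((mult_p)%:R / 2) *
           ((Num.sqrt prod_p)^-1 + (Num.sqrt prod_n)^-1)^-1).
Definition gamma_k : R :=
  2^-1 * ((2 / (k%:R * GammaR (k%:R / 2))) `^ (2 / k%:R)).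
End params.

Definition gumbel_cdf {R : realType} (x : R) : R := expR (- expR (- x)).
Definition weibull_cdf {R : realType} (al x : R) : R :=
  if x < 0 then expR (- ((- x) `^ al)) else 1.

(* convergence in distribution of a sequence of real random variables
   towards a law with (continuous) cdf F *)
Definition cvg_dist {d} {T : measurableType d} {R : realType}
  (P : probability T R) (X : nat -> T -> R) (F : R -> R) : Prop :=
  forall x : R, (fun N => P [set t | X N t <= x]) @ \oo --> (F x)%:E.

(* Main.v *)
(** The spectrum of a GOE matrix is almost surely simple, so the quadratic forms
of its eigenvectors have a law that is invariant under conjugating [A_N] by an
orthogonal matrix.  Hence [A_N] may be replaced by [W diag(a) W^T], where [W]
orthonormalises the columns of an [N x k] Gaussian matrix [G] independent of the
eigenvectors.  Conditionally on the eigenvectors [u_i], the vectors [y_i = G^T u_i]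
are independent standard Gaussians of [R^k], and the Gram matrix [G^T G / N] is
within [N^(-1/4)] of the identity up to a negligible probability; thus
[N <u_i, A_N u_i>] is [sum_j a_j y_ij^2] up to a relative error [N^(-1/4)], and the
maximum is essentially that of [N] independent variables.

An exponential change of measure turns [y] into a scaled Gaussian vector, which
yields both the tail [P(sum_j b_j y_j^2 / 2 > s) ~ const s^(m/2 - 1) e^(-s)], where
[max b = 1] has multiplicity [m] (Gumbel case), and the small ball probability
[P(sum_j b_j y_j^2 / 2 <= r) ~ const r^(k/2)] for positive [b] (Weibull case). *)

Require Import Defs.
From HB Require Import structures.
From mathcomp Require Import all_boot all_order all_algebra.
From mathcomp Require Import all_classical all_reals all_analysis.
From mathcomp Require Import measurable_realfun.
From mathcomp Require Import ring lra.
Import Order.TTheory GRing.Theory Num.Theory.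
Import numFieldNormedType.Exports.
Local Open Scope classical_set_scope.
Local Open Scope ring_scope.
Set Implicit Arguments. Unset Strict Implicit. Unset Printing Implicit Defensive.

(** * Independent identically distributed families *)

(** [U] is an arbitrary measurable choice of eigenvectors, so its law is not determined by that of
    [H]: signs, order and bases of eigenspaces are free. The event on the maximum is therefore
    replaced, off a null set, by an event about [H] alone (no unit eigenvector gives a value above
    the threshold). This needs simplicity of the spectrum and the measurability of a quantifier over
    vectors. Independence of [G] and the eigenvectors is obtained by placing them on the two factors
    of [P \x P].

    Rotation invariance and all Gaussian density formulas rest on one device: weighting the law by
    exp(|x|^2/2) gives a multiple of Lebesgue measure, which can be transformed one coordinate at a
    time.

    The Gram error e = N^(-1/4) meets two demands: N e^2 tends to infinity, so that the Gram matrix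
    concentrates, and e log N tends to 0, because in the Gumbel case the relevant rows have squared
    length of order log N. The map [th] is the identity or the absolute value, so both maxima go
    through one argument. *)

Section density.
Context d (T : measurableType d) (R : realType).
Local Open Scope ereal_scope.
Import HBNNSimple.

Lemma ge0_integral_density (mu nu : {measure set T -> \bar R}) (h : T -> R)
  (f : T -> \bar R) :
  measurable_fun setT h -> (forall x, 0 <= h x)%R ->
  (forall A, measurable A -> nu A = \int[mu]_(x in A) (h x)%:E) ->
  measurable_fun setT f -> (forall x, 0 <= f x) ->
  \int[nu]_x f x = \int[mu]_x (f x * (h x)%:E).
Proof.
move=> mh h0 nuE mf f0.
pose g := nnsfun_approx measurableT mf.
have gf x : (fun n => (g n x)%:E) @ \oo --> f x.
  by apply: cvg_nnsfun_approx.
have mhE : measurable_fun setT (fun x => (h x)%:E) by exact/measurable_EFinP.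
have mgn n : measurable_fun setT (fun x => (g n x)%:E).
  exact/measurable_EFinP/measurable_funP.
transitivity (limn (fun n => \int[nu]_x (g n x)%:E)).
  rewrite -monotone_convergence//.
  - by apply: eq_integral => x _; apply/esym/cvg_lim => //; exact: gf.
  - by move=> n x _; rewrite lee_fin.
  - by move=> x _ m n mn; rewrite lee_fin; exact/lefP/nd_nnsfun_approx.
transitivity (limn (fun n => \int[mu]_x ((g n x)%:E * (h x)%:E))); last first.
  rewrite -monotone_convergence//.
  - apply: eq_integral => x _; apply/cvg_lim => //.
    exact: cvgeZr.
  - by move=> n; exact: emeasurable_funM.
  - by move=> n x _; rewrite mule_ge0// lee_fin.
  - move=> x _ m n mn; rewrite lee_wpmul2r// lee_fin//.
    exact/lefP/nd_nnsfun_approx.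
congr (limn _); apply/funext => n.
transitivity (\sum_(r \in range (g n)) \int[nu]_x (r * \1_(g n @^-1` [set r]) x)%:E).
  rewrite -ge0_integral_fsum//.
  - by apply: eq_integral => x _; rewrite fsumEFin// -fimfunE.
  - by move=> r; exact/measurable_EFinP/measurable_funM.
  - by move=> r x _; rewrite nnfun_muleindic_ge0.
transitivity (\sum_(r \in range (g n))
    \int[mu]_x ((r * \1_(g n @^-1` [set r]) x)%:E * (h x)%:E)); last first.
  rewrite -ge0_integral_fsum//.
  - apply: eq_integral => x _.
    under eq_fsbigr do rewrite -EFinM.
    rewrite fsumEFin// (fimfunE (g n)) -EFinM; congr EFin.
    by rewrite mulr_fsuml.
  - move=> r; apply: emeasurable_funM => //.
    by exact/measurable_EFinP/measurable_funM.
  - by move=> r x _; rewrite mule_ge0 ?lee_fin//; have := nnfun_muleindic_ge0 (g n) r x; rewrite lee_fin.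
apply: eq_fsbigr => r _.
rewrite integralZl_indic_nnsfun// integral_indic// setIT nuE//.
have [r0|r0] := ltP r 0%R.
  rewrite preimage_nnfun0// integral_set0 mule0 integral0_eq// => x _.
  by rewrite indic0 mulr0 mul0e.
rewrite integral_mkcond -ge0_integralZl//=.
- apply: eq_integral => x _; rewrite patchE indicE.
  by case: ifP => _; rewrite ?mulr1 ?mulr0 ?mule0 ?mul0e.
- have mD : measurable (g n @^-1` [set r]) by exact: measurable_funPTI.
  apply: (proj1 (measurable_restrictT _ mD)).
  exact: (measurable_funS measurableT (@subsetT _ _) mhE).
- by move=> x _; rewrite patchE; case: ifP => // _; rewrite lee_fin.
Qed.

End density.

(** Families are indexed by an arbitrary finite type, so that matrices, single rows and
    upper-triangular index sets share one theory. These rectangles form a pi-system, and [coordT]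
    carries the product sigma-algebra that they generate. *)
Definition coord_rects (R : realType) (I : finType) : set (set (I -> R)) :=
  [set A | exists B : I -> set R, (forall i, measurable (B i)) /\
     A = [set x | forall i, B i (x i)]].

Arguments coord_rects : clear implicits.
Notation coordT R I := (g_sigma_algebraType (coord_rects R I)).

Section coordinates.
Context (R : realType) (I : finType).

Lemma measurable_coord (i : I) : measurable_fun setT (fun x : coordT R I => x i).
Proof.
move=> _ B mB; rewrite setTI; apply: sub_sigma_algebra.
exists (fun j => if j == i then B else setT); split.
  by move=> j; case: ifP.
apply/seteqP; split => x /= Bx; last by have := Bx i; rewrite eqxx.
by move=> j; case: eqP => [->|].
Qed.

Lemma measurable_coordP d (T : measurableType d) (f : T -> coordT R I) :
  (forall i, measurable_fun setT (fun t => f t i)) -> measurable_fun setT f.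
Proof.
move=> mf; have h : (preimage_set_system [set: T] f (coord_rects R I) `<=` measurable).
  move=> _ [_ [B [mB ->]] <-].
  rewrite setTI (_ : _ @^-1` _ = \bigcap_(i in [set: I]) ((fun t => f t i) @^-1` B i)).
    apply: fin_bigcap_measurable => // i _; rewrite -[X in measurable X]setTI.
    exact: mf.
  by apply/seteqP; split => t /= h i; [move=> _|]; exact: h.
have := @measurability _ _ T (coordT R I) setT f (coord_rects R I) erefl h.
exact.
Qed.

Lemma coord_rects_setI : setI_closed (coord_rects R I).
Proof.
move=> _ _ [B [mB ->]] [C [mC ->]].
exists (fun i => B i `&` C i); split; first by move=> i; exact: measurableI.
by apply/seteqP; split => [x [h1 h2] i //|x h]; split=> i; have [] := h i.
Qed.

Lemma coord_rectsT : coord_rects R I setT.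
Proof. by exists (fun=> setT); split => //; apply/seteqP; split. Qed.

End coordinates.

Section iid_families.
Context (R : realType) (mu : probability (measurableTypeR R) R).
Local Open Scope ereal_scope.

Definition iid d (T : measurableType d) (P : probability T R) (I : finType)
    (X : T -> I -> R) :=
  (forall i, measurable_fun setT (fun t => X t i)) /\
  forall B : I -> set R, (forall i, measurable (B i)) ->
    P [set t | forall i, B i (X t i)] = \prod_i mu (B i).

Lemma iid_measurable d (T : measurableType d) (P : probability T R) (I : finType)
    (X : T -> I -> R) : iid P X -> measurable_fun setT (X : T -> coordT R I).
Proof. by move=> [mX _]; exact: measurable_coordP. Qed.

Section law.
Context d (T : measurableType d) (P : probability T R)
        d' (T' : measurableType d') (P' : probability T' R) (I : finType).
Variables (X : T -> I -> R) (Y : T' -> I -> R).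
Hypotheses (iX : iid P X) (iY : iid P' Y).

(** Both push-forwards agree on rectangles, a generating pi-system. Hence any realisation, possibly
    on another space, may replace a given one; the resampling arguments below are instances of
    this. *)
Lemma iid_law (A : set (coordT R I)) : measurable A -> P (X @^-1` A) = P' (Y @^-1` A).
Proof.
move=> mA.
pose X' : T -> coordT R I := X; pose Y' : T' -> coordT R I := Y.
have mX : measurable_fun setT X' := iid_measurable iX.
have mY : measurable_fun setT Y' := iid_measurable iY.
pose m1 : {measure set (coordT R I) -> \bar R} := pushforward P X'.
pose m2 : {measure set (coordT R I) -> \bar R} := pushforward P' Y'.
suff : m1 mX A = m2 mY A by [].
apply: (@measure_unique _ R (coordT R I) (coord_rects R I) (fun=> setT) _ _ _ _ (m1 mX) (m2 mY)) => //.
- exact: coord_rects_setI.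
- by move=> _; exact: coord_rectsT.
- by rewrite bigcup_const.
- by move=> _ [B [mB ->]]; rewrite /pushforward/=; rewrite [LHS]iX.2// [RHS]iY.2.
- by move=> _; rewrite (_ : m1 mX setT = P setT)// probability_setT ltry.
Qed.

Lemma iid_integral (f : coordT R I -> \bar R) : measurable_fun setT f ->
  (forall x, 0 <= f x) -> \int[P]_t f (X t) = \int[P']_t f (Y t).
Proof.
move=> mf f0.
pose X' : T -> coordT R I := X; pose Y' : T' -> coordT R I := Y.
have mX : measurable_fun setT X' := iid_measurable iX.
have mY : measurable_fun setT Y' := iid_measurable iY.
transitivity (\int[pushforward P X']_x f x).
  by rewrite ge0_integral_pushforward.
transitivity (\int[pushforward P' Y']_x f x); last first.
  by rewrite ge0_integral_pushforward.
by apply: eq_measure_integral => A mA _; exact: iid_law.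
Qed.

End law.

Lemma iid_sub d (T : measurableType d) (P : probability T R) (I J : finType)
    (X : T -> I -> R) (h : J -> I) : injective h -> iid P X ->
  iid P (fun t j => X t (h j)).
Proof.
move=> injh [mX iX]; split => [j|B mB]; first exact: mX.
(* Indices outside the image of [h] are left unconstrained, so their factors in the product are
   1. *)
pose C i := if [pick j | h j == i] is Some j then B j else setT.
have Ch j : C (h j) = B j.
  rewrite /C; case: pickP => [j' /eqP/injh -> //|/(_ j)]; by rewrite eqxx.
have mC i : measurable (C i) by rewrite /C; case: pickP.
rewrite (_ : [set t | _] = [set t | forall i, C i (X t i)]).
  rewrite iX// (bigID [in codom h])/= [X in _ * X]big1 ?mule1; last first.
    move=> i /negP ih; rewrite /C; case: pickP => [j /eqP hj|_].
      by case: ih; rewrite -hj codom_f.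
    exact: probability_setT.
  rewrite -big_uniq/= ?map_inj_uniq ?enum_uniq -?enumT ?enum_uniq//.
  rewrite big_map big_enum/=; apply: eq_bigr => j _; by rewrite Ch.
apply/seteqP; split => t /= Bt i; last by rewrite -Ch.
rewrite /C; case: pickP => [j /eqP <-//|//].
Qed.

Lemma prode_fin (I : finType) (F : I -> R) :
  \prod_i (F i)%:E = (\prod_i F i)%:E :> \bar R.
Proof. by rewrite -[RHS]/(_%:E) (big_morph EFin EFinM erefl). Qed.

(** Conditioning on part of a family goes through this: fixing the first component of the product
    freezes the coordinates selected by [Q], while the others remain random. *)
Lemma iid_mix d (T : measurableType d) (P : probability T R)
    d' (T' : measurableType d') (P' : probability T' R) (I : finType)
    (X : T -> I -> R) (Y : T' -> I -> R) (Q : pred I) : iid P X -> iid P' Y ->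
  iid (P \x P')%E (fun z i => if Q i then X z.1 i else Y z.2 i).
Proof.
move=> [mX iX] [mY iY]; split => [i|B mB].
  case: (Q i).
    exact: (measurableT_comp (mX i) measurable_fst).
  exact: (measurableT_comp (mY i) measurable_snd).
pose C i := if Q i then B i else setT; pose D i := if Q i then setT else B i.
have mC i : measurable (C i) by rewrite /C; case: ifP.
have mD i : measurable (D i) by rewrite /D; case: ifP.
have mXC : measurable [set t | forall i, C i (X t i)].
  have := measurable_coordP (f := X) mX measurableT; rewrite /=.
  move=> /(_ [set x | forall i, C i (x i)]); rewrite setTI; apply.
  by apply: sub_sigma_algebra; exists C.
have mYD : measurable [set t | forall i, D i (Y t i)].
  have := measurable_coordP (f := Y) mY measurableT; rewrite /=.
  move=> /(_ [set x | forall i, D i (x i)]); rewrite setTI; apply.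
  by apply: sub_sigma_algebra; exists D.
rewrite (_ : [set t | _] = [set t | forall i, C i (X t i)] `*` [set t | forall i, D i (Y t i)]).
  transitivity (P [set t | forall i, C i (X t i)] * P' [set t | forall i, D i (Y t i)]).
    exact: product_measure1E.
  rewrite iX// iY//.
  have muE E : measurable E -> mu E = (fine (mu E))%:E.
    by move=> mE; rewrite fineK// fin_num_measure.
  rewrite (eq_bigr _ (fun i _ => muE _ (mC i))) (eq_bigr _ (fun i _ => muE _ (mD i))).
  rewrite (eq_bigr _ (fun i _ => muE _ (mB i))).
  rewrite !prode_fin -EFinM -big_split/=; congr EFin; apply: eq_bigr => i _.
  by rewrite /C /D; case: ifP => _; rewrite probability_setT/= ?mulr1 ?mul1r.
apply/seteqP; split => [[t s]/= h|[t s]/= [h1 h2] i].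
  by split => i; have := h i; rewrite /C /D; case: ifP.
by have := h1 i; have := h2 i; rewrite /C /D; case: ifP.
Qed.

End iid_families.

(** * Isometries and exponential tilts of Gaussian families *)

Section lebesgue_affine.
Context (R : realType).
Local Notation leb := (@lebesgue_measure R).

Lemma lebesgue_measure_affine (c b : R) (A : set R) : c != 0 -> measurable A ->
  leb A = (`|c|%:E * leb ((fun x => (c * x + b)%R) @^-1` A))%E.
Proof.
move=> c0 mA.
pose g : measurableTypeR R -> measurableTypeR R := fun x => c * x + b.
have mg : measurable_fun setT g.
  by apply: measurable_funD => //; exact: measurable_funM.
have pc : 0 < `|c| by rewrite normr_gt0.
pose nu0 : {measure set (measurableTypeR R) -> \bar R} :=
  mscale (NngNum (ltW pc)) (pushforward leb g).
suff : forall A : set R, measurable A -> leb A = nu0 mg A by move=> /(_ A mA).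
apply: lebesgue_measure_unique => //= _ [[u v]] _ <-.
rewrite /mscale/= /pushforward.
have [c_gt0|c_lt0|/eqP] := ltgtP 0 c; last by rewrite eq_sym (negbTE c0).
  rewrite (_ : g @^-1` _ = `](u - b) / c, (v - b) / c]%classic).
    rewrite !lebesgue_measure_itv/= !lte_fin ltr_pM2r ?invr_gt0// ltrD2r.
    case: ifP => _; last by rewrite mule0.
    by rewrite -!EFinB -EFinM gtr0_norm//; congr EFin; field; exact: lt0r_neq0.
  apply/seteqP; split => x /=; rewrite !in_itv/= ltr_pdivrMr// ler_pdivlMr// /g;
    rewrite ltrBlDr lerBrDr mulrC//.
(* A negative slope swaps the end points, so the half-open side changes while the length does
   not. *)
rewrite (_ : g @^-1` _ = `[(v - b) / c, (u - b) / c[%classic).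
  rewrite !lebesgue_measure_itv/= !lte_fin ltr_nM2r ?invr_lt0// ltrD2r.
  case: ifP => _; last by rewrite mule0.
  by rewrite -!EFinB -EFinM ltr0_norm//; congr EFin; field; exact: ltr0_neq0.
apply/seteqP; split => x /=; rewrite !in_itv/= ltr_ndivlMr// ler_ndivrMr// /g;
  by rewrite ltrBlDr lerBrDr mulrC andbC.
Qed.

Lemma ge0_integral_affine (c b : R) (f : R -> \bar R) : c != 0 ->
  measurable_fun setT f -> (forall x, 0 <= f x)%E ->
  (\int[leb]_x f (c * x + b)%R = (`|c|^-1)%:E * \int[leb]_x f x)%E.
Proof.
move=> c0 mf f0.
pose g : measurableTypeR R -> measurableTypeR R := fun x => c * x + b.
have mg : measurable_fun setT g.
  by apply: measurable_funD => //; exact: measurable_funM.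
have pc : 0 < `|c| by rewrite normr_gt0.
have H : (`|c|%:E * \int[leb]_x f (g x) = \int[leb]_x f x)%E.
  transitivity (`|c|%:E * \int[pushforward leb g]_x f x)%E.
    by rewrite ge0_integral_pushforward.
  pose nu0 : {measure set (measurableTypeR R) -> \bar R} :=
    pushforward leb g.
  transitivity (\int[mscale (NngNum (ltW pc)) (nu0 mg)]_x f x)%E.
    by rewrite ge0_integral_mscale.
  apply: eq_measure_integral => A mA _.
  by apply/esym; exact: lebesgue_measure_affine.
by rewrite -H muleA -EFinM mulVf ?mul1e// gt_eqF.
Qed.

End lebesgue_affine.

(** * Replacing one coordinate by a fresh copy *)

Section resampling.
Context (R : realType).
Local Open Scope ereal_scope.

Definition upd (I : finType) (x : I -> R) (i : I) (y : R) : I -> R :=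
  fun j => if j == i then y else x j.

Context (mu : probability (measurableTypeR R) R).

Lemma iid_law1 d (T : measurableType d) (P : probability T R) (I : finType)
    (X : T -> I -> R) (i : I) (f : R -> \bar R) : iid mu P X ->
  measurable_fun setT f -> (forall x, 0 <= f x) ->
  \int[P]_t f (X t i) = \int[mu]_x f x.
Proof.
move=> [mX iX] mf f0.
pose g t : measurableTypeR R := X t i.
have mg : measurable_fun setT g := mX i.
transitivity (\int[pushforward P g]_x f x).
  by rewrite ge0_integral_pushforward.
apply: eq_measure_integral => A mA _; rewrite /pushforward/=.
pose B j := if j == i then A else setT.
have mB j : measurable (B j) by rewrite /B; case: ifP.
transitivity (P [set t | forall j, B j (X t j)]).
  congr (P _); apply/seteqP; split => t /= h.
    by move=> j; rewrite /B; case: eqP => [->|].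
  by have := h i; rewrite /B eqxx.
rewrite iX// (bigD1 i)//= big1 ?mule1 /B ?eqxx//.
by move=> j /negbTE ->; exact: probability_setT.
Qed.

(** Mixing two copies so that only coordinate [i] comes from the second keeps the law; Fubini then
    isolates a one-dimensional integral over that coordinate. *)
Lemma iid_resample d (T : measurableType d) (P : probability T R) (I : finType)
    (X : T -> I -> R) (i : I) (f : coordT R I -> \bar R) : iid mu P X ->
  measurable_fun setT f -> (forall x, 0 <= f x) ->
  \int[P]_t f (X t) = \int[P]_t \int[mu]_y f (upd (X t) i y).
Proof.
move=> iX mf f0.
have iM := iid_mix (predC1 i) iX iX.
rewrite (iid_integral iX iM)//.
rewrite fubini_tonelli1//; last first.
  by apply: (measurableT_comp mf); exact: (iid_measurable iM).
apply: eq_integral => t _; rewrite /fubini_F/=.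
transitivity (\int[P]_s f (upd (X t) i (X s i))).
  apply: eq_integral => s _; congr f; apply/funext => j; rewrite /upd/=.
  by case: eqP => [->|].
have mm : measurable_fun setT (fun y : R => f (upd (X t) i y)).
  apply: (measurableT_comp mf); apply: measurable_coordP => j; rewrite /upd.
  by case: (j == i).
exact: (iid_law1 i (f := fun y => f (upd (X t) i y)) iX mm).
Qed.

End resampling.

Notation gaussfam := (iid (normal_prob 0%R 1%R)).

Section gaussian.
Context (R : realType).

Lemma ge0_integral_gauss (f : R -> \bar R) :
  measurable_fun setT f -> (forall x, 0 <= f x)%E ->
  (\int[normal_prob 0%R 1%R]_x f x =
   \int[lebesgue_measure]_x (f x * (normal_peak 1 * expR (- (x ^+ 2 / 2)))%:E))%E.
Proof.
move=> mf f0.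
have E x : normal_pdf 0 1 x = normal_peak 1 * expR (- (x ^+ 2 / 2)) :> R.
  by rewrite normal_pdfE ?oner_eq0// /normal_fun subr0 expr1n mulNr.
rewrite (@ge0_integral_density _ _ _ lebesgue_measure _ (normal_pdf 0 1))//.
- by apply: eq_integral => x _; rewrite E.
- exact: measurable_normal_pdf.
- by move=> x; exact: normal_pdf_ge0.
Qed.

Definition sq (I : finType) (x : I -> R) : R := \sum_i x i ^+ 2.

Lemma sq_ge0 (I : finType) (x : I -> R) : 0 <= sq x.
Proof. by apply: sumr_ge0 => i _; exact: sqr_ge0. Qed.

Lemma measurable_sq (I : finType) : measurable_fun setT (@sq I : coordT R I -> R).
Proof.
apply: measurable_sum => i; apply: measurable_funX; exact: measurable_coord.
Qed.

Lemma sq_upd (I : finType) (x : I -> R) i y :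
  sq (upd x i y) = y ^+ 2 + \sum_(j | j != i) x j ^+ 2.
Proof.
rewrite /sq (bigD1 i)//= /upd eqxx; congr (_ + _).
by apply: eq_bigr => j /negbTE ->.
Qed.

Context d (T : measurableType d) (P : probability T R) (I : finType).
Variable X : T -> I -> R.
Hypothesis gX : gaussfam P X.

(* Integral against the reference measure whose density with respect to the
   law of X is exp(|x|^2/2): up to a constant this is Lebesgue measure. *)
Definition flat_int (F : coordT R I -> \bar R) : \bar R :=
  (\int[P]_t (F (X t) * (expR (sq (X t) / 2))%:E))%E.

Definition rowop (i : I) (c : I -> R) (x : I -> R) : I -> R :=
  upd x i (\sum_j c j * x j).

Lemma measurable_rowop i c : measurable_fun setT (rowop i c : coordT R I -> coordT R I).
Proof.
apply: measurable_coordP => j; rewrite /rowop /upd; case: (j == i).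
  apply: measurable_sum => l; apply: measurable_funM => //; exact: measurable_coord.
exact: measurable_coord.
Qed.

Lemma flat_int_rowop (i : I) (c : I -> R) (F : coordT R I -> \bar R) : c i != 0 ->
  measurable_fun setT F -> (forall x, 0 <= F x)%E ->
  flat_int (F \o rowop i c) = (`|c i|^-1%:E * flat_int F)%E.
Proof.
move=> ci mF F0; rewrite /flat_int.
pose G (F : coordT R I -> \bar R) x := (F x * (expR (sq x / 2))%:E)%E.
have mG F' : measurable_fun setT F' -> measurable_fun setT (G F').
  move=> mF'; apply: emeasurable_funM => //; apply/measurable_EFinP.
  apply: measurableT_comp => //; apply: measurable_funM => //; exact: measurable_sq.
have G0 F' : (forall x, 0 <= F' x)%E -> (forall x, 0 <= G F' x)%E.
  by move=> h x; rewrite mule_ge0// lee_fin expR_ge0.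
have mFr : measurable_fun setT (fun x : coordT R I => F (rowop i c x)).
  exact: (measurableT_comp mF (measurable_rowop i c)).
have key F' : measurable_fun setT F' -> (forall x, 0 <= F' x)%E -> forall t,
    (\int[normal_prob 0 1]_y G F' (upd (X t) i y) =
     \int[lebesgue_measure]_y (F' (upd (X t) i y) *
       (normal_peak 1 * expR ((\sum_(j | j != i) X t j ^+ 2) / 2))%:E))%E.
  move=> mF' F'0 t; rewrite ge0_integral_gauss//; last 2 first.
  - apply: (measurableT_comp (mG _ mF')); apply: measurable_coordP => j.
    by rewrite /upd; case: (j == i).
  - by move=> y; exact: G0.
  apply: eq_integral => y _; rewrite /G -muleA -EFinM; congr (_ * _%:E)%E.
  by rewrite sq_upd mulrCA -expRD; congr (_ * expR _); field.
rewrite (iid_resample i gX (mG _ mFr) (G0 _ _))//.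
rewrite (iid_resample i gX (mG _ mF) (G0 _ _))//.
rewrite -ge0_integralZl//; last 2 first.
- have := measurable_fun_fubini_tonelli_F (m2 := normal_prob 0 1)
    (fun z : T * measurableTypeR R => G F (upd (X z.1) i z.2)).
  apply.
  + apply: (measurableT_comp (mG _ mF)); apply: measurable_coordP => j.
    rewrite /upd; case: (j == i); first exact: measurable_snd.
    exact: (measurableT_comp (gX.1 j) measurable_fst).
  + by move=> z; exact: G0.
- by move=> t _; apply: integral_ge0 => y _; exact: G0.
apply: eq_integral => t _; rewrite !key//.
pose b := \sum_(j | j != i) c j * X t j.
pose H y := (F (upd (X t) i y) *
       (normal_peak 1 * expR ((\sum_(j | j != i) X t j ^+ 2) / 2))%:E)%E.
have E y : rowop i c (upd (X t) i y) = upd (X t) i (c i * y + b).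
  have S : \sum_l c l * upd (X t) i y l = c i * y + b.
    rewrite (bigD1 i)//= /b; congr (_ + _); first by rewrite /upd eqxx.
    by apply: eq_bigr => l li; rewrite /upd (negbTE li).
  by apply/funext => j; rewrite /rowop S /upd; case: eqP.
transitivity (\int[lebesgue_measure]_y H (c i * y + b)%R)%E.
  by apply: eq_integral => y _; rewrite /H /= E.
rewrite ge0_integral_affine//.
- apply: emeasurable_funM => //; apply: (measurableT_comp mF).
  by apply: measurable_coordP => j; rewrite /upd; case: (j == i).
- move=> y; rewrite mule_ge0// lee_fin mulr_ge0 ?expR_ge0//.
  exact: normal_peak_ge0.
Qed.

End gaussian.

(** * Column elimination and isometries of Gaussian families *)

Section elimination.
Context (R : realType) (I : finType).
Implicit Types (x : I -> R) (M : I -> I -> R).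

Definition lmap M x : I -> R := fun i => \sum_j M i j * x j.

Definition mmul M M' : I -> I -> R := fun i j => \sum_l M i l * M' l j.

Lemma lmap_comp M M' x : lmap M (lmap M' x) = lmap (mmul M M') x.
Proof.
apply/funext => i; rewrite /lmap /mmul.
under eq_bigr do rewrite mulr_sumr.
rewrite exchange_big/=; apply: eq_bigr => j _; rewrite mulr_suml.
by apply: eq_bigr => l _; rewrite mulrA.
Qed.

Definition unitv (i : I) : I -> R := fun j => (j == i)%:R.

Lemma sum_unitvl (F : I -> R) i : \sum_j (j == i)%:R * F j = F i.
Proof.
rewrite (bigD1 i)//= eqxx mul1r big1 ?addr0// => j /negbTE ->.
by rewrite mul0r.
Qed.

Lemma sum_unitvr (F : I -> R) i : \sum_j F j * (j == i)%:R = F i.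
Proof. by rewrite -[RHS]sum_unitvl; apply: eq_bigr => j _; rewrite mulrC. Qed.

Definition rowmx (i : I) (c : I -> R) : I -> I -> R :=
  fun r s => if r == i then c s else (s == r)%:R.

Lemma rowopE i c x : rowop i c x = lmap (rowmx i c) x.
Proof.
apply/funext => r; rewrite /rowop /upd /lmap /rowmx; case: ifP => // _.
by rewrite sum_unitvl.
Qed.

(** Invertibility in a form that elimination can use directly: a right inverse, not assumed linear,
    is enough to exhibit a pivot in each row. *)
Definition surj M := exists g : (I -> R) -> (I -> R), forall x, lmap M (g x) = x.

(** Coefficients obtained by solving y = c_i x_i + sum over s != i of c_s x_s for x_i. *)
Definition rowinv (i : I) (c : I -> R) : I -> R :=
  fun s => if s == i then (c i)^-1 else - c s / c i.

Lemma rowinvK i c x : c i != 0 -> rowop i c (rowop i (rowinv i c) x) = x.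
Proof.
move=> ci; apply/funext => r; rewrite /rowop {1}/upd; case: eqP => [->|/eqP ri]; last first.
  by rewrite /upd (negbTE ri).
rewrite (bigD1 i)//= {1}/upd eqxx (bigD1 i)//= {1}/rowinv eqxx.
rewrite mulrDr mulrA divff// mul1r -addrA mulr_sumr -big_split/= big1 ?addr0//.
move=> j ji; rewrite /upd /rowinv (negbTE ji) !mulrA.
by rewrite [c i * _]mulrC mulfK// mulNr addNr.
Qed.

Lemma surj_row M i c : c i != 0 -> surj M -> surj (mmul M (rowmx i c)).
Proof.
move=> ci [g gK]; exists (fun x => rowop i (rowinv i c) (g x)) => x.
by rewrite -lmap_comp -rowopE rowinvK.
Qed.

Context d (T : measurableType d) (P : probability T R) (X : T -> I -> R).
Hypothesis gX : gaussfam P X.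

(** For invertible [M] the factor [k] is 1/|det M|, but it is left implicit: elimination shows that
    some factor exists, and for an isometry the total mass determines it. *)
Definition scales M := exists2 k : R, 0 <= k & forall F : coordT R I -> \bar R,
  measurable_fun setT F -> (forall x, 0 <= F x)%E ->
  flat_int P X (fun x => F (lmap M x)) = (k%:E * flat_int P X F)%E.

Lemma measurable_lmap M : measurable_fun setT (lmap M : coordT R I -> coordT R I).
Proof.
apply: measurable_coordP => i; apply: measurable_sum => j.
by apply: measurable_funM => //; exact: measurable_coord.
Qed.

Lemma scales_row M i c : c i != 0 -> scales (mmul M (rowmx i c)) -> scales M.
Proof.
move=> ci [k k0 kP]; exists (`|c i| * k); first by rewrite mulr_ge0.
move=> F mF F0.
have mFM : measurable_fun setT (fun x : coordT R I => F (lmap M x)).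
  exact: (measurableT_comp mF (measurable_lmap M)).
have h := flat_int_rowop gX ci mFM (fun x => F0 (lmap M x)).
have /esym {}h : flat_int P X (fun x => F (lmap (mmul M (rowmx i c)) x)) =
    (`|c i|^-1%:E * flat_int P X (fun x => F (lmap M x)))%E.
  rewrite -h; congr flat_int; apply/funext => x /=.
  by rewrite rowopE lmap_comp.
rewrite EFinM -muleA -kP// -h muleA -EFinM mulfV ?mul1e//.
by rewrite normr_eq0.
Qed.

(* Column operations turn M into the identity one row at a time: S is the set
   of rows that already agree with the identity. *)
Lemma surj_scales M : surj M -> scales M.
Proof.
suff main : forall n (S : {set I}) M, (#|~: S| <= n)%N -> (forall i, i \in S -> M i = unitv i) ->
    surj M -> scales M.
  apply: (main #|I| finset.set0) => [|i]; last by rewrite finset.in_set0.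
  exact: max_card.
elim=> [|n IH] S M0.
  rewrite leqn0 cards_eq0 => /eqP S0 MS _; exists 1 => // F mF F0.
  rewrite mul1e; congr flat_int; apply/funext => x; congr F.
  apply/funext => i; rewrite /lmap MS; last first.
    by rewrite -[S]finset.setCK S0 finset.in_setC finset.in_set0.
  by rewrite /unitv sum_unitvl.
have [S0|[p pS]] := set_0Vmem (~: S).
  by move=> _; apply: IH; rewrite S0 cards0.
move=> cS MS sM.
have [j jS Mpj] : exists2 j, j \notin S & M0 p j != 0.
  (* Let x = g(e_p). Rows in [S] are unit rows, so x vanishes on [S]; if row [p] vanished off [S],
     its value at x would be 0, whereas it must be 1. *)
  apply: contrapT => nex; case: sM => g gK.
  have M0p j : j \notin S -> M0 p j = 0.
    move=> jS; apply/eqP; apply: contrapT => /negP Mpj; apply: nex; by exists j.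
  have := congr1 (fun x => x p) (gK (unitv p)); rewrite {2}/unitv eqxx.
  rewrite /lmap (bigID [in S])/= [X in _ + X]big1 ?addr0; last first.
    by move=> j jS; rewrite M0p// mul0r.
  rewrite big1 => [/esym/eqP|j jS]; first by rewrite oner_eq0.
  have := congr1 (fun x => x j) (gK (unitv p)); rewrite /lmap MS//.
  rewrite /unitv sum_unitvl => ->.
  suff /negbTE -> : j != p by rewrite mulr0.
  by apply: contraTneq pS => <-; rewrite finset.inE negbK.
(* A pivot off the diagonal is moved onto it by adding column [j] to column [p]. Since [j] is
   outside [S], the unit rows in [S] have a 0 in column [j] and do not change. *)
wlog Mpp : M0 MS sM Mpj / M0 p p != 0.
  move=> wl; have [Mpp|] := eqVneq (M0 p p) 0; last exact: wl.
  have jp : j != p by apply: contraNneq Mpj => ->; rewrite Mpp.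
  pose c s := (s == j)%:R + (s == p)%:R : R.
  have cj : c j != 0 by rewrite /c eqxx (negbTE jp) addr0 oner_eq0.
  have E r s : mmul M0 (rowmx j c) r s = M0 r s + (s == p)%:R * M0 r j.
    rewrite /mmul /rowmx (bigD1 j)//= eqxx /c mulrDr.
    have -> : \sum_(l | l != j) M0 r l * (if l == j then (s == j)%:R + (s == p)%:R else (s == l)%:R) =
       (s != j)%:R * M0 r s.
      have [->|sj] := eqVneq s j.
        rewrite mul0r big1// => l /negbTE lj; rewrite lj eq_sym lj mulr0//.
      rewrite (bigD1 s)//= (negbTE sj) eqxx mulr1 mul1r big1 ?addr0//.
      by move=> l /andP[/negbTE -> /negbTE]; rewrite eq_sym => ->; rewrite mulr0.
    have [->|sj] := eqVneq s j; rewrite ?mulr1 ?mulr0 ?add0r ?mul1r ?mul0r ?addr0.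
      by rewrite mulrC.
    by rewrite addrC mulrC.
  apply: (scales_row cj); apply: wl.
  - move=> i iS; apply/funext => s; rewrite E MS//.
    suff -> : unitv i j = 0 by rewrite mulr0 addr0.
    by rewrite /unitv; case: eqP => // ji; rewrite ji iS in jS.
  - exact: surj_row.
  - by rewrite E (negbTE jp) mul0r addr0.
  - by rewrite E eqxx mul1r Mpp add0r.
(* With a diagonal pivot, multiplication by the inverse row operation makes row [p] a unit row, and
   [p] joins [S]. *)
have cp : rowinv p (M0 p) p != 0 by rewrite /rowinv eqxx invr_eq0.
apply: (scales_row cp); apply: (IH (p |: S)%SET).
- rewrite -ltnS (leq_trans _ cS)//; apply: proper_card.
  rewrite properE; apply/andP; split.
    by apply/fintype.subsetP => i; rewrite !finset.inE => /norP[].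
  by apply/fintype.subsetPn; exists p => //; rewrite !finset.inE eqxx.
- move=> i; rewrite finset.in_setU1 => iS; apply/funext => s.
  rewrite /mmul /rowmx.
  have [->|ip] := eqVneq i p.
    have := congr1 (fun x => x p) (rowinvK (unitv s) Mpp).
    rewrite !rowopE lmap_comp /lmap /= => h.
    have := h; rewrite sum_unitvr => h'.
    have <- : mmul (rowmx p (M0 p)) (rowmx p (rowinv p (M0 p))) p s = unitv p s.
      by rewrite h' /unitv eq_sym.
    by rewrite /mmul; apply: eq_bigr => l _; congr (_ * _); rewrite /rowmx eqxx.
  move: iS; rewrite (negbTE ip)/= => iS; rewrite MS//.
  by rewrite /unitv sum_unitvl (negbTE ip).
- exact: surj_row.
Qed.

(** Relative to the flat measure the Gaussian law has density exp(-|x|^2/2), which an isometry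
    preserves. The law of [g \o X] is thus a multiple of that of [X], and both have mass 1. *)
Lemma gaussfam_isometry (g g' : (I -> R) -> (I -> R)) :
  (forall x i, g x i = \sum_j g (unitv j) i * x j) ->
  (forall x, g (g' x) = x) -> (forall x, sq (g x) = sq x) ->
  gaussfam P (g \o X).
Proof.
move=> glin gK gsq.
pose M i j := g (unitv j) i.
have gE : g = lmap M by apply/funext => x; apply/funext => i; rewrite glin.
have mg : measurable_fun setT (g : coordT R I -> coordT R I).
  by rewrite gE; exact: measurable_lmap.
have [k k0 kP] : scales M by apply: surj_scales; exists g' => x; rewrite -gE.
have main (f : coordT R I -> \bar R) : measurable_fun setT f -> (forall x, 0 <= f x)%E ->
    (\int[P]_t f (g (X t)) = k%:E * \int[P]_t f (X t))%E.
  move=> mf f0.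
  pose F x := (f x * (expR (- (sq x / 2)))%:E)%E.
  have Fe x : (F x * (expR (sq x / 2))%:E = f x)%E.
    by rewrite /F -muleA -EFinM -expRD addNr expR0 mule1.
  transitivity (flat_int P X (fun x => F (lmap M x))).
    apply: eq_integral => t _; rewrite -gE.
    by rewrite -[X in (expR (X / 2))](gsq (X t)) Fe.
  rewrite kP//.
  - by congr (_ * _)%E; apply: eq_integral => t _; rewrite Fe.
  - apply: emeasurable_funM => //; apply/measurable_EFinP.
    apply: measurableT_comp => //; apply: measurableT_comp => //.
    by apply: measurable_funM => //; exact: measurable_sq.
  - by move=> x; rewrite mule_ge0// lee_fin expR_ge0.
have k1 : k = 1.
  have h := main (cst 1%E) (measurable_cst _) (fun=> lee01).
  have I1 : (\int[P]_t (cst 1 t) = 1)%E by rewrite integral_cst// mul1e; exact: probability_setT.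
  have {h} : (1 = k%:E * 1)%E := etrans (esym I1) (etrans h (congr1 _ I1)).
  by rewrite mule1 => -[].
split => [i|B mB].
  have := measurableT_comp mg (iid_measurable gX) => mgX.
  exact: (measurableT_comp (measurable_coord i) mgX).
pose A : set (coordT R I) := [set x | forall i, B i (x i)].
have mA : measurable A by apply: sub_sigma_algebra; exists B.
have := main (fun x => (\1_A x)%:E).
rewrite k1 mul1e => h.
have mXA (Y : T -> coordT R I) : measurable_fun setT Y ->
    (\int[P]_t (\1_A (Y t))%:E = P (Y @^-1` A))%E.
  move=> mY.
  have mYA : measurable (Y @^-1` A) by rewrite -[X in measurable X]setTI; exact: mY.
  transitivity (\int[P]_t (\1_(Y @^-1` A) t)%:E)%E; first by [].
  by rewrite integral_indic// setIT.
rewrite -(gX.2 _ mB).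
rewrite -(mXA _ (iid_measurable gX)) -h.
- rewrite [RHS](mXA (g \o X))//.
  exact: (measurableT_comp mg (iid_measurable gX)).
- by apply/measurable_EFinP; exact: measurable_indic.
- by move=> x; rewrite lee_fin.
Qed.

End elimination.

(** * Exponential change of measure *)

Section tilt.
Context (R : realType) (I : finType) d (T : measurableType d) (P : probability T R)
  (X : T -> I -> R).
Hypothesis gX : gaussfam P X.

Lemma flat_int_scale (c : I -> R) (F : coordT R I -> \bar R) : (forall i, 0 < c i) ->
  measurable_fun setT F -> (forall x, 0 <= F x)%E ->
  flat_int P X (fun x => F (fun i => c i * x i)) = ((\prod_i c i)^-1%:E * flat_int P X F)%E.
Proof.
move=> c0 mF F0.
have main (s : seq I) : uniq s ->
    flat_int P X (fun x => F (fun i => if i \in s then c i * x i else x i)) =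
    ((\prod_(i <- s) c i)^-1%:E * flat_int P X F)%E.
  elim: s => [_|p s IH /= /andP[ps us]].
    by rewrite big_nil invr1 mul1e; congr flat_int; apply/funext => x; congr F.
  rewrite big_cons invfM EFinM -muleA -(IH us).
  pose e j := if j == p then c p else 0.
  have ep : e p != 0 by rewrite /e eqxx gt_eqF.
  pose F' (x : coordT R I) := F (fun i => if i \in s then c i * x i else x i).
  have mF' : measurable_fun setT F'.
    apply: (measurableT_comp mF); apply: measurable_coordP => i; case: (i \in s).
      by apply: measurable_funM => //; exact: measurable_coord.
    exact: measurable_coord.
  have -> : (c p)^-1 = `|e p|^-1 by rewrite /e eqxx gtr0_norm.
  rewrite -(flat_int_rowop gX ep mF' (fun x => F0 _)).
  congr flat_int; apply/funext => x; congr F; apply/funext => i.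
  rewrite in_cons /rowop /upd.
  have -> : \sum_j e j * x j = c p * x p.
    rewrite (bigD1 p)//= /e eqxx big1 ?addr0// => j /negbTE ->; by rewrite mul0r.
  by have [->|ip] := eqVneq i p; rewrite ?(negbTE ps).
have := main (enum I) (enum_uniq _).
rewrite big_enum/= => <-; congr flat_int; apply/funext => x; congr F.
by apply/funext => i; rewrite mem_enum.
Qed.

(** The right-hand side carries the ratio of the densities of the scaled and the standard Gaussian.
    A constant [f] yields exponential moments and hence Chernoff bounds; indicator-like [f] yield
    small balls and the homogeneity behind the chi-square law. *)
Lemma gauss_tilt (c : I -> R) (f : coordT R I -> \bar R) : (forall i, 0 < c i) ->
  measurable_fun setT f -> (forall x, 0 <= f x)%E ->
  (\int[P]_t f (fun i => (c i * X t i)%R) =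
   (\prod_i c i)^-1%:E *
   \int[P]_t (f (X t) * (expR (\sum_i X t i ^+ 2 / 2 * (1 - (c i)^-2))%R)%:E))%E.
Proof.
move=> c0 mf f0.
(* Chosen so that F(cx) exp(|x|^2/2) = f(cx): the flat weight cancels exactly after scaling. *)
pose F x := (f x * (expR (- (\sum_i x i ^+ 2 / 2 * (c i)^-2)))%:E)%E.
have mF : measurable_fun setT F.
  apply: emeasurable_funM => //; apply/measurable_EFinP.
  apply: measurableT_comp => //; apply: measurableT_comp => //.
  apply: measurable_sum => i; apply: measurable_funM => //.
  by apply: measurable_funM => //; apply: measurable_funX; exact: measurable_coord.
have F0 x : (0 <= F x)%E by rewrite mule_ge0// lee_fin expR_ge0.
have := flat_int_scale c0 mF F0; rewrite {1 2}/flat_int => h.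
transitivity (\int[P]_t
   (F (fun i => (c i * X t i)%R) * (expR (sq (X t) / 2))%:E))%E.
  apply: eq_integral => t _; rewrite /F -muleA -EFinM -expRD.
  rewrite (_ : _ + _ = 0) ?expR0 ?mule1// /sq mulr_suml -sumrN -big_split/=.
  apply: big1 => i _; field; exact: lt0r_neq0.
rewrite h; congr (_ * _)%E; apply: eq_integral => t _.
rewrite /F -muleA -EFinM -expRD; congr (_ * (expR _)%:E)%E.
rewrite /sq mulr_suml -sumrN -big_split/=; apply: eq_bigr => i _.
by rewrite mulrBr mulr1 addrC.
Qed.

End tilt.

(** * Spectral decomposition and nearly orthonormal frames *)

Section frames.
Context (R : realType).

Definition dot n (u v : 'cV[R]_n) : R := (u^T *m v) 0 0.

Lemma dotE n (u v : 'cV[R]_n) : dot u v = \sum_i u i 0 * v i 0.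
Proof. by rewrite /dot mxE; apply: eq_bigr => i _; rewrite mxE. Qed.

Lemma dotC n (u v : 'cV[R]_n) : dot u v = dot v u.
Proof. by rewrite !dotE; apply: eq_bigr => i _; rewrite mulrC. Qed.

Lemma mx11_dot n (u v : 'cV[R]_n) : u^T *m v = (dot u v)%:M.
Proof. by rewrite [LHS]mx11_scalar. Qed.

Lemma dotBl n (u v w : 'cV[R]_n) : dot (u - v) w = dot u w - dot v w.
Proof. by rewrite /dot linearB mulmxBl !mxE. Qed.

Lemma dotBr n (u v w : 'cV[R]_n) : dot w (u - v) = dot w u - dot w v.
Proof. by rewrite !(dotC w) dotBl. Qed.

Lemma dotZr n a (u w : 'cV[R]_n) : dot w (a *: u) = a * dot w u.
Proof. by rewrite /dot -scalemxAr mxE. Qed.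

Lemma dotZl n a (u w : 'cV[R]_n) : dot (a *: u) w = a * dot u w.
Proof. by rewrite !(dotC _ w) dotZr. Qed.

Lemma dot_ge0 n (u : 'cV[R]_n) : 0 <= dot u u.
Proof. by rewrite dotE sumr_ge0// => i _; rewrite -expr2 sqr_ge0. Qed.

Lemma dot_eq0 n (u : 'cV[R]_n) : dot u u = 0 -> u = 0.
Proof.
rewrite dotE => /eqP; rewrite psumr_eq0 => [/allP h|i _]; last by rewrite -expr2 sqr_ge0.
apply/colP => i; rewrite mxE; apply/eqP.
by have := h i (mem_index_enum _); rewrite -expr2 sqrf_eq0.
Qed.

Lemma dot_mulmx n m (O : 'M[R]_(m, n)) (u : 'cV_n) (v : 'cV_m) : dot (O *m u) v = dot u (O^T *m v).
Proof. by rewrite /dot trmx_mul mulmxA. Qed.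

Lemma dot_orth n m (O : 'M[R]_(m, n)) (u v : 'cV_n) : O^T *m O = 1%:M ->
  dot (O *m u) (O *m v) = dot u v.
Proof. by move=> OO; rewrite dot_mulmx mulmxA OO mul1mx. Qed.

(** Householder reflection along z = u - v. The last clause says that vectors orthogonal to z are
    fixed; it allows columns to be placed one after another without moving those already in
    place. *)
Lemma reflection n (u v : 'cV[R]_n) : dot u u = dot v v ->
  exists O : 'M[R]_n, [/\ O^T *m O = 1%:M, O *m u = v &
    forall w, dot w u = dot w v -> O *m w = w].
Proof.
move=> uv; have [->|neq] := eqVneq u v.
  by exists 1%:M; split => [||w _]; rewrite ?trmx1 ?mul1mx.
pose z := u - v; have zz : dot z z != 0.
  by apply: contra neq => /eqP/dot_eq0/eqP; rewrite subr_eq0.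
pose a := 2 / dot z z.
have OE w : (1%:M - a *: (z *m z^T)) *m w = w - (a * dot z w) *: z.
  by rewrite mulmxBl mul1mx -scalemxAl -mulmxA mx11_dot mul_mx_scalar scalerA.
have tO : (1%:M - a *: (z *m z^T))^T = 1%:M - a *: (z *m z^T).
  by rewrite linearB/= trmx1 linearZ/= trmx_mul trmxK.
exists (1%:M - a *: (z *m z^T)); split.
- rewrite tO; set Z := z *m z^T.
  have ZZ : Z *m Z = dot z z *: Z.
    by rewrite /Z -mulmxA (mulmxA z^T) mx11_dot mul_scalar_mx -scalemxAr.
  rewrite mulmxBl mul1mx mulmxBr mulmx1 -scalemxAl -scalemxAr ZZ !scalerA.
  rewrite (_ : a * a * dot z z = 2 * a); last by rewrite /a; field.
  by apply/matrixP => i j; rewrite !mxE; ring.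
- rewrite OE (_ : a * dot z u = 1) ?scale1r ?subKr//.
  have -> : dot z u = dot z z / 2.
    by rewrite /z !dotBl !dotBr (dotC v u) uv; field.
  by rewrite /a mulrA divfK// divff ?pnatr_eq0.
- move=> w wuv; rewrite OE dotC /z dotBr wuv subrr mulr0 scale0r subr0//.
Qed.

Lemma orth_mul n (O O' : 'M[R]_n) : O^T *m O = 1%:M -> O'^T *m O' = 1%:M ->
  (O *m O')^T *m (O *m O') = 1%:M.
Proof.
by move=> h h'; rewrite trmx_mul -mulmxA (mulmxA _ O) h mul1mx.
Qed.

(** Columns are carried over one at a time by reflections. A column already placed has the same
    inner product with the current column and with its target, because the Gram matrices agree, so
    the next reflection fixes it. *)
Lemma frame_transport n k (W W' : 'M[R]_(n, k)) : W^T *m W = W'^T *m W' ->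
  exists O : 'M[R]_n, O^T *m O = 1%:M /\ O *m W = W'.
Proof.
move=> WW.
have WWd i j : dot (col i W) (col j W) = dot (col i W') (col j W').
  have dE (V : 'M[R]_(n, k)) : dot (col i V) (col j V) = (V^T *m V) i j.
    by rewrite dotE mxE; apply: eq_bigr => l _; rewrite !mxE.
  by rewrite !dE WW.
have main p : (p <= k)%N -> exists O : 'M[R]_n, O^T *m O = 1%:M /\
    forall j : 'I_k, (j < p)%N -> O *m col j W = col j W'.
  elim: p => [|p IH] pk; first by exists 1%:M; rewrite trmx1 mul1mx.
  have [ O [ OO OW]] := IH (ltnW pk).
  pose q := Ordinal pk.
  have [| O' [ OO' uv fx]] := @reflection n (O *m col q W) (col q W').
    by rewrite dot_orth.
  exists (O' *m O); split; first exact: orth_mul.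
  move=> j; rewrite ltnS leq_eqVlt => /orP[/eqP jp|jp].
    by have -> : j = q by [apply: val_inj]; rewrite -mulmxA.
  rewrite -mulmxA OW//; apply: fx.
  by rewrite -{1}OW// dot_orth// WWd.
have [ O [ OO OW]] := main k (leqnn k).
exists O; split => //; apply/matrixP => i j.
have := congr1 (fun v : 'cV_n => v i 0) (OW j (ltn_ord j)).
by rewrite (colE j W) mulmxA -colE [LHS]mxE [RHS]mxE.
Qed.

Lemma diag_mx_row1 n (l0 : R) (l : 'I_n -> R) :
  diag_mx (\row_i (if fintype.split i is inr j then l j else l0) : 'rV_(1 + n)) =
  block_mx (l0%:M : 'M[R]_1) 0 0 (diag_mx (\row_j l j)).
Proof.
have sl i' : fintype.split (lshift n i' : 'I_(1 + n)) = inl i' := unsplitK (inl i').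
have sr i' : fintype.split (rshift 1 i' : 'I_(1 + n)) = inr i' := unsplitK (inr i').
apply/matrixP => i j.
case: (split_ordP i) => i' ->; case: (split_ordP j) => j' ->;
  rewrite ?(block_mxEul, block_mxEur, block_mxEdl, block_mxEdr) !mxE ?sl ?sr.
- by rewrite eq_lshift !ord1 eqxx.
- by rewrite eq_lrshift mulr0n.
- by rewrite eq_rlshift mulr0n.
- by rewrite eq_rshift.
Qed.

(** Deflation by one eigenvector, rotated onto the first basis vector by a reflection. The splitting
    of the characteristic polynomial supplies a real eigenvalue at each stage, and symmetry clears
    the first row once the first column is clear. The eigenvalues come out in the prescribed order
    [l]. *)
Lemma sym_spectral n (A : 'M[R]_n) (l : 'I_n -> R) : A^T = A ->
  char_poly A = \prod_(i < n) ('X - (l i)%:P) ->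
  exists Q : 'M[R]_n, Q^T *m Q = 1%:M /\ A = Q *m diag_mx (\row_i l i) *m Q^T.
Proof.
elim: n => [|n IH] in A l *.
  by move=> _ _; exists 1%:M; split; rewrite ?trmx1 ?mul1mx//; apply/matrixP => -[].
move=> tA chA.
have ev : eigenvalue A (l ord0).
  rewrite eigenvalue_root_char chA (bigD1 ord0)//= rootM.
  by rewrite root_XsubC eqxx.
have [v vA v0] := eigenvalueP ev.
pose u := v^T; have Au : A *m u = l ord0 *: u.
  by rewrite /u -{1}tA -trmx_mul vA linearZ.
have u0 : dot u u != 0.
  by apply: contra v0 => /eqP/dot_eq0 uE; rewrite -[v]trmxK -/u uE trmx0.
pose e : 'cV[R]_(1 + n) := delta_mx 0 0.
have ee : dot e e = 1.
  rewrite dotE (bigD1 0)//= big1 ?addr0 ?mxE ?eqxx ?mulr1//.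
  by move=> i i0; rewrite !mxE (negbTE i0) mul0r.
pose s := Num.sqrt (dot u u).
have s0 : s != 0 by rewrite gt_eqF// sqrtr_gt0 lt_neqAle eq_sym u0 dot_ge0.
have [| O [ OO Ou _]] := @reflection _ u (s *: e).
  by rewrite dotZl dotZr ee mulr1 -expr2 sqr_sqrtr// dot_ge0.
have OO' : O *m O^T = 1%:M by exact: mulmx1C.
have [B BD] : {B : 'M[R]_(1 + n) | B = O *m A *m O^T} by exists (O *m A *m O^T).
have tB : B^T = B by rewrite BD !trmx_mul trmxK tA mulmxA.
have Be : B *m e = l ord0 *: e.
  have -> : e = s^-1 *: (O *m u) by rewrite Ou scalerA mulVf// scale1r.
  rewrite -!scalemxAr BD -!mulmxA (mulmxA O^T) OO mul1mx Au -scalemxAr.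
  by rewrite !scalerA mulrC.
have Bi0 i : B i 0 = l ord0 * (i == 0)%:R.
  have := congr1 (fun w : 'cV_(1 + n) => w i 0) Be.
  rewrite -colE !mxE => ->; by rewrite eqxx andbT.
have BE : B = block_mx (l ord0)%:M 0 0 (drsubmx B).
  rewrite -[LHS]submxK; congr block_mx.
  - by apply/matrixP => i j; rewrite !ord1 !mxE !lshift0 Bi0 eqxx mulr1.
  - apply/matrixP => i j; rewrite -[in LHS]tB !mxE ord1 lshift0 Bi0.
    by rewrite -val_eqE/= mulr0.
  - apply/matrixP => i j; rewrite !mxE ord1 lshift0 Bi0.
    by rewrite -val_eqE/= mulr0.
have [B' B'D] : {B' : 'M[R]_n | B' = drsubmx B} by exists (drsubmx B).
have tB' : B'^T = B'.
  by rewrite B'D -[in RHS]tB -trmx_drsub.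
have chB : char_poly B = char_poly A.
  rewrite /char_poly /char_poly_mx BD.
  have -> : 'X%:M - map_mx polyC (O *m A *m O^T) =
     map_mx polyC O *m ('X%:M - map_mx polyC A) *m map_mx polyC O^T.
    rewrite mulmxBr mulmxBl !map_mxM/=; congr (_ - _).
    by rewrite mul_mx_scalar -scalemxAl -map_mxM OO' map_mx1 scalemx1.
  rewrite !det_mulmx mulrC mulrA -det_mulmx -map_mxM OO map_mx1 det1 mul1r//.
have chB' : char_poly B' = \prod_(i < n) ('X - (l (lift ord0 i))%:P).
  have XN0 : 'X - (l ord0)%:P != 0 by rewrite polyXsubC_eq0.
  have E : ('X - (l ord0)%:P) * \prod_(i < n) ('X - (l (lift ord0 i))%:P) = char_poly A.
    by rewrite chA big_ord_recl.
  apply: (mulfI XN0); rewrite E -chB BE -B'D.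
  rewrite /char_poly /char_poly_mx map_block_mx/= scalar_mx_block opp_block_mx add_block_mx.
  rewrite !map_mx0 !subr0 det_ublock; congr (_ * _).
  by rewrite map_scalar_mx/= -raddfB/= det_scalar1.
have [Q' [QQ' B'E]] := IH B' _ tB' chB'.
pose Q1 : 'M[R]_(1 + n) := block_mx 1%:M 0 0 Q'.
have Q1Q1 : Q1^T *m Q1 = 1%:M.
  rewrite /Q1 tr_block_mx !trmx0 trmx1 mulmx_block !mulmx0 !mul0mx !addr0 mulmx1 add0r QQ'.
  by rewrite -scalar_mx_block.
exists (O^T *m Q1); split.
  by apply: orth_mul => //; rewrite trmxK.
have -> : diag_mx (\row_i l i) = block_mx (l ord0)%:M 0 0 (diag_mx (\row_i l (lift ord0 i))) :> 'M[R]_(1 + n).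
  rewrite -diag_mx_row1; congr diag_mx; apply/rowP => i; rewrite !mxE.
  case: fintype.splitP => j ij; congr l; apply: val_inj; rewrite /= ij ?ord1//.
have -> : A = O^T *m B *m O.
  by rewrite BD -!mulmxA OO mulmx1 mulmxA OO mul1mx.
rewrite trmx_mul trmxK -!mulmxA; congr (_ *m _); rewrite !mulmxA; congr (_ *m _).
have tQ1 : Q1^T = block_mx 1%:M 0 0 Q'^T by rewrite /Q1 tr_block_mx !trmx0 trmx1.
have E : B = Q1 *m block_mx (l ord0)%:M 0 0 (diag_mx (\row_i l (lift ord0 i))) *m Q1^T.
  rewrite tQ1 BE -B'D {1}B'E /Q1 !mulmx_block.
  by rewrite !mulmx0 !mul0mx !addr0 !add0r !mulmx1 !mul1mx !mul0mx.
exact: E.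
Qed.

(** Inverse Cholesky factorisation, one Schur complement at a time, with every entry tracked: the
    complement is again near the identity, with error 2e, so the linear bound survives the induction
    with a larger constant. *)
Lemma near_identity_normalizer k : exists C e0 : R, [/\ 0 < C, 0 < e0 &
  forall (M : 'M[R]_k) e, M^T = M -> 0 <= e <= e0 ->
    (forall i j, `|M i j - (i == j)%:R| <= e) ->
    exists S : 'M[R]_k, S^T *m M *m S = 1%:M /\
      forall i j, `|S i j - (i == j)%:R| <= C * e].
Proof.
elim: k => [|k [C [e0 [C0 e00 IH]]]].
  exists 1, 1; split=> // M e _ _ _; exists 1%:M; split.
    by apply/matrixP => -[].
  by case.
have [t [tD t0]] : exists t : R, t = 2 * k%:R * (1 + C) /\ 0 <= t.
  by exists (2 * k%:R * (1 + C)); rewrite !mulr_ge0// addr_ge0// ltW.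
(* The three terms bound the three nonzero blocks of [S] minus the identity: the pivot entry, the
   lower block with its doubled error, and (by [t]) the row beside the pivot. The cap on e keeps the
   pivot above 1/2 and 2e within the range [e0] of the induction hypothesis. *)
pose C' := 2 + 2 * C + t.
exists C', (Num.min (2^-1) (e0 / 2)); split.
- by rewrite /C'; lra.
- by rewrite lt_min invr_gt0 ltr0n divr_gt0.
move=> M0 e tM0 /andP[e_ge0]; rewrite le_min => /andP[e_le ee0] Me.
have [M MD] : {M : 'M[R]_(1 + k) | M = M0} by exists M0.
have tM : M^T = M by rewrite MD.
have {}Me i j : `|M i j - (i == j)%:R| <= e by rewrite MD; exact: Me.
pose m := M 0 0; pose b := ursubmx M; pose M' := drsubmx M.
have me : `|m - 1| <= e by have := Me 0 0; rewrite eqxx.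
have m_ge : 2^-1 <= m by move: me; rewrite ler_norml => /andP[]; lra.
have m0 : 0 < m by lra.
have be j : `|b 0 j| <= e.
  have := Me (lshift k 0) (rshift 1 j).
  by rewrite eq_lrshift subr0 /b !mxE.
pose M'' := M' - m^-1 *: (b^T *m b).
have tM'' : M''^T = M''.
  rewrite /M'' linearB/= linearZ/= trmx_mul trmxK; congr (_ - _).
  by rewrite /M' -[in RHS]tM -trmx_drsub.
have im : m^-1 <= 2 by rewrite -[leRHS]invrK lef_pV2 ?posrE// invr_gt0.
have M''e i j : `|M'' i j - (i == j)%:R| <= 2 * e.
  have -> : M'' i j - (i == j)%:R = (M' i j - (i == j)%:R) - m^-1 * (b 0 i * b 0 j).
    by rewrite !mxE big_ord1 !mxE; ring.
  apply: (le_trans (ler_normB _ _)).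
  have h1 : `|M' i j - (i == j)%:R| <= e.
    have := Me (rshift 1 i) (rshift 1 j).
    by rewrite eq_rshift /M' !mxE.
  have h2 : `|m^-1 * (b 0 i * b 0 j)| <= 2 * (e * e).
    rewrite !normrM gtr0_norm ?invr_gt0//.
    apply: ler_pM => //; first by rewrite invr_ge0 ltW.
    by apply: ler_pM.
  have h3 : e * e <= e * 2^-1 by rewrite ler_wpM2l.
  lra.
have [|S' [S'M S'e]] := IH M'' (2 * e) tM'' _ M''e.
  by rewrite mulr_ge0//=; lra.
pose q := (Num.sqrt m)^-1.
have sq0 : 0 < Num.sqrt m by rewrite sqrtr_gt0.
have qmq : q * m * q = 1.
  by rewrite /q -{2}[m](sqr_sqrtr (ltW m0)); field; exact: lt0r_neq0.
pose S : 'M[R]_(1 + k) := block_mx q%:M (- (m^-1 *: (b *m S'))) 0 S'.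
have ME : M = block_mx m%:M b b^T M'.
  rewrite -[LHS]submxK; congr block_mx.
    by apply/matrixP => i j; rewrite !ord1 !mxE !lshift0 eqxx mulr1n.
  by apply/matrixP => i j; rewrite -[in LHS]tM /b !mxE.
have SMS : S^T *m M *m S = 1%:M.
  have MS : M *m S = block_mx (m * q)%:M 0 (q *: b^T) (M'' *m S').
    rewrite ME /S mulmx_block; congr block_mx.
    - by rewrite mulmx0 addr0 -scalar_mxM.
    - by rewrite mulmxN mul_scalar_mx scalerA divff ?gt_eqF// scale1r addNr.
    - by rewrite mulmx0 addr0 mul_mx_scalar.
    - by rewrite /M'' mulmxBl mulmxN -scalemxAr -scalemxAl mulmxA addrC.
  have tS : S^T = block_mx q%:M 0 (- (m^-1 *: (S'^T *m b^T))) S'^T.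
    rewrite /S tr_block_mx trmx0 tr_scalar_mx; congr block_mx.
    by rewrite linearN/= linearZ/= trmx_mul.
  rewrite -mulmxA MS tS mulmx_block !mul0mx !mulmx0 !addr0 add0r.
  rewrite mulmxA S'M -scalar_mxM mulrA qmq.
  rewrite mul_mx_scalar -scalemxAr scalerN scalerA.
  rewrite (_ : m * q * m^-1 = q); last by rewrite mulrAC divff ?mul1r// gt_eqF.
  by rewrite addNr -scalar_mx_block.
have C'1 : 2 <= C' by rewrite /C'; lra.
have C'2 : 2 * C <= C' by rewrite /C'; lra.
have C'3 : 2 * k%:R * (1 + C) <= C' by rewrite -tD /C'; lra.
suff main (i j : 'I_(1 + k)) : `|S i j - (i == j)%:R| <= C' * e.
  by exists S; split; [rewrite -[M0]MD|exact: main].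
rewrite /S.
case: (split_ordP i) => i' ->; case: (split_ordP j) => j' ->;
  rewrite ?(block_mxEul, block_mxEur, block_mxEdl, block_mxEdr)
    ?(eq_lshift, eq_rshift, eq_lrshift, eq_rlshift).
- rewrite !ord1 !mxE eqxx mulr1n.
  have -> : q - 1 = (1 - m) * (q / (1 + Num.sqrt m)).
    have mr : m = Num.sqrt m ^+ 2 by rewrite sqr_sqrtr ?ltW.
    rewrite /q; move: sq0 mr; set r := Num.sqrt m => r0 ->; field.
    by rewrite !gt_eqF// addr_gt0.
  rewrite normrM distrC mulrC; apply: ler_pM => //.
  apply: le_trans C'1.
  have s1 : 2^-1 <= Num.sqrt m.
    rewrite -[2^-1]gtr0_norm ?invr_gt0// -sqrtr_sqr ler_sqrt ?(ltW m0)//.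
    by rewrite expr2; lra.
  rewrite ger0_norm; last by rewrite divr_ge0 ?addr_ge0 ?invr_ge0 ?sqrtr_ge0.
  rewrite /q -invfM -[leRHS]invrK lef_pV2 ?posrE ?invr_gt0 ?mulr_gt0 ?addr_gt0//.
  by rewrite -[leLHS]mulr1 ler_pM// lerDl ltW.
- rewrite !mxE ord1 subr0 normrN normrM gtr0_norm ?invr_gt0//.
  apply: (@le_trans _ _ (2 * \sum_(l < k) (e * (1 + C)))).
    apply: ler_pM => //; first by rewrite invr_ge0 ltW.
    apply: (le_trans (ler_norm_sum _ _ _)); apply: ler_sum => l _.
    rewrite normrM; apply: ler_pM => //.
    rewrite -[S' l j'](subrK (l == j')%:R); apply: (le_trans (ler_normD _ _)).
    rewrite addrC; apply: lerD; first by case: eqP; rewrite ?normr1 ?normr0.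
    apply: (le_trans (S'e _ _)).
    have : C * (2 * e) <= C * 1 by apply: ler_wpM2l; [exact: ltW|lra].
    lra.
  rewrite sumr_const card_ord -mulr_natr.
  apply: (@le_trans _ _ (2 * k%:R * (1 + C) * e)); last by rewrite ler_wpM2r.
  by rewrite le_eqVlt; apply/orP; left; apply/eqP; ring.
- by rewrite mxE subrr normr0 mulr_ge0// ltW// (lt_le_trans _ C'1).
- apply: (le_trans (S'e _ _)); rewrite mulrA [C * 2]mulrC; exact: ler_wpM2r.
Qed.

End frames.

(** * Low-rank symmetric matrices and Gaussian frames *)

Section low_rank.
Context (R : realType).

Lemma frame_decomposition N k (a : 'I_k -> R) (A : 'M[R]_N) : (k <= N)%N -> A^T = A ->
  char_poly A = (\prod_(i < k) ('X - (a i)%:P)) * 'X^(N - k) ->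
  exists W : 'M[R]_(N, k), W^T *m W = 1%:M /\ A = W *m diag_mx (\row_i a i) *m W^T.
Proof.
move=> /subnKC kN; move: (N - k)%N kN A => m; case: N / => A tA chA.
pose l (i : 'I_(k + m)) := if fintype.split i is inl j then a j else 0.
have ll j : l (lshift m j) = a j by rewrite /l (unsplitK (inl j)).
have lr j : l (rshift k j) = 0 by rewrite /l (unsplitK (inr j)).
have [|Q [QQ AE]] := @sym_spectral R _ A l tA.
  rewrite chA big_split_ord/=; congr (_ * _).
    by apply: eq_bigr => i _; rewrite ll.
  under eq_bigr do rewrite lr subr0.
  by rewrite prodr_const card_ord.
have QE : Q = row_mx (lsubmx Q) (rsubmx Q) by rewrite hsubmxK.
have WW : (lsubmx Q)^T *m lsubmx Q = 1%:M.
  move: QQ; rewrite {1 2}QE tr_row_mx mul_col_row scalar_mx_block.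
  by move=> /eq_block_mx[].
exists (lsubmx Q); split => //.
have DE : diag_mx (\row_i l i) = block_mx (diag_mx (\row_i a i)) 0 0 0.
  apply/matrixP => i j.
  case: (split_ordP i) => i' ->; case: (split_ordP j) => j' ->;
    rewrite ?(block_mxEul, block_mxEur, block_mxEdl, block_mxEdr) !mxE ?ll ?lr
    ?(eq_lshift, eq_rshift, eq_lrshift, eq_rlshift) ?mulr0n ?mul0rn//.
rewrite {1}AE DE {1 2}QE tr_row_mx mul_row_block !mulmx0 !addr0 mul_row_col.
by rewrite mul0mx addr0.
Qed.

Lemma quadf_conj N k (W : 'M[R]_(N, k)) (D : 'M[R]_k) (u : 'cV_N) :
  quadf (W *m D *m W^T) u = quadf D (W^T *m u).
Proof. by rewrite /quadf trmx_mul trmxK !mulmxA. Qed.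

Lemma quadfE k (Z : 'M[R]_k) (y : 'cV_k) :
  quadf Z y = \sum_i \sum_j y i 0 * Z i j * y j 0.
Proof.
rewrite /quadf mxE; under eq_bigr do rewrite mxE mulr_suml.
rewrite exchange_big/=; apply: eq_bigr => i _; apply: eq_bigr => j _.
by rewrite mxE.
Qed.

Lemma quadf_diag k (a : 'I_k -> R) (y : 'cV_k) :
  quadf (diag_mx (\row_i a i)) y = \sum_j a j * y j 0 ^+ 2.
Proof.
rewrite quadfE; apply: eq_bigr => i _; rewrite (bigD1 i)//= big1 ?addr0.
  by rewrite !mxE eqxx mulr1n expr2 mulrAC mulrC.
by move=> j ji; rewrite !mxE eq_sym (negbTE ji) mulr0n mulr0 mul0r.
Qed.

(** From |y_i y_j| <= (y_i^2 + y_j^2)/2; summing over both indices produces the factor [k]. *)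
Lemma quadf_bound k (Z : 'M[R]_k) (y : 'cV_k) c : (forall i j, `|Z i j| <= c) ->
  `|quadf Z y| <= k%:R * c * \sum_j y j 0 ^+ 2.
Proof.
move=> Zc; rewrite quadfE.
have h i j : `|y i 0 * Z i j * y j 0| <= c * ((y i 0 ^+ 2 + y j 0 ^+ 2) / 2).
  rewrite !normrM mulrAC mulrC; apply: ler_pM => //.
  rewrite -normrM -[leLHS]mulr1 -subr_ge0.
  have := sqr_ge0 (`|y i 0| - `|y j 0|).
  rewrite sqrrB !real_normK ?num_real// normrM mulr1 -mulr_natr.
  by lra.
apply: (@le_trans _ _ (\sum_i \sum_j c * ((y i 0 ^+ 2 + y j 0 ^+ 2) / 2))).
  apply: (le_trans (ler_norm_sum _ _ _)); apply: ler_sum => i _.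
  by apply: (le_trans (ler_norm_sum _ _ _)); apply: ler_sum => j _.
rewrite le_eqVlt; apply/orP; left; apply/eqP.
set S := \sum_j y j 0 ^+ 2.
have -> : \sum_i \sum_j c * ((y i 0 ^+ 2 + y j 0 ^+ 2) / 2) =
    \sum_i (c / 2 * (k%:R * y i 0 ^+ 2) + c / 2 * S).
  apply: eq_bigr => i _; rewrite -mulr_sumr -mulr_suml big_split/= sumr_const card_ord.
  by rewrite -mulr_natl -/S; ring.
rewrite big_split/= -mulr_sumr -mulr_sumr -/S sumr_const card_ord -mulr_natl.
by field.
Qed.

(* If the columns of G are nearly orthogonal of squared norm n, then W spans the
   same space and the rows of sqrt n W are close to those of G. *)
Lemma frame_comparison k (a : 'I_k -> R) : exists C e0 : R, [/\ 0 < C, 0 < e0 &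
  forall N (n e : R) (G : 'M[R]_(N, k)), 0 < n -> 0 <= e <= e0 ->
  (forall i j, `|(G^T *m G) i j / n - (i == j)%:R| <= e) ->
  exists W : 'M[R]_(N, k), W^T *m W = 1%:M /\ forall u : 'cV_N,
    `|n * quadf (W *m diag_mx (\row_i a i) *m W^T) u -
      \sum_j a j * (G^T *m u) j 0 ^+ 2| <= C * e * \sum_j (G^T *m u) j 0 ^+ 2].
Proof.
have [C [e0 [C0 e00 H]]] := near_identity_normalizer R k.
pose s := \sum_l `|a l|.
have s0 : 0 <= s by rewrite sumr_ge0.
(* Writing S = I + E with entries |E_ij| <= C e, each entry of S D S^T - D is at most s (2 C e + C^2
   e^2), and e <= 1 turns this into s C (2 + C) e. The factor [k] comes from [quadf_bound], and the
   1 makes the constant positive. *)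
exists (k%:R * (s * (C * (2 + C))) + 1), (Num.min 1 e0); split.
- by rewrite ltr_wpDl// !mulr_ge0// ?addr_ge0// ltW.
- by rewrite lt_min ltr01.
move=> N n e G n0 /andP[e_ge0]; rewrite le_min => /andP[e1 ee0] GG.
have [||i j|S [SMS Se]] := H (n^-1 *: (G^T *m G)) e.
- by rewrite linearZ/= trmx_mul trmxK.
- by rewrite e_ge0.
- by rewrite mxE mulrC.
pose r := (Num.sqrt n)^-1.
have rr : r * r = n^-1 by rewrite /r -invfM -expr2 sqr_sqrtr// ltW.
have tr : (r *: (G *m S))^T = r *: (S^T *m G^T) by rewrite linearZ/= trmx_mul.
exists (r *: (G *m S)); split.
  rewrite tr -scalemxAl -scalemxAr scalerA rr.
  by rewrite -SMS -scalemxAr -scalemxAl !mulmxA.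
move=> u; rewrite quadf_conj.
set y := G^T *m u; set D := diag_mx _.
have -> : (r *: (G *m S))^T *m u = r *: (S^T *m y).
  by rewrite tr -scalemxAl mulmxA.
have -> : n * quadf D (r *: (S^T *m y)) = quadf (S *m D *m S^T) y.
  have tr' : (r *: (S^T *m y))^T = r *: (S^T *m y)^T by rewrite linearZ.
  rewrite quadf_conj /quadf tr' -!scalemxAl -scalemxAr scalerA rr mxE.
  by rewrite mulrA divff ?mul1r// gt_eqF.
rewrite -quadf_diag -/D.
have -> : quadf (S *m D *m S^T) y - quadf D y = quadf (S *m D *m S^T - D) y.
  by rewrite /quadf mulmxBr mulmxBl !mxE.
apply: (@le_trans _ _ (k%:R * (s * (C * (2 + C)) * e) * \sum_j y j 0 ^+ 2)); last first.
  apply: ler_wpM2r; first by rewrite sumr_ge0// => j _; exact: sqr_ge0.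
  by rewrite mulrDl mul1r mulrA lerDl.
apply: quadf_bound => i j.
have -> : (S *m D *m S^T - D) i j = \sum_l a l * (S i l * S j l - (i == l)%:R * (j == l)%:R).
  rewrite !mxE.
  under eq_bigr do rewrite mul_mx_diag !mxE.
  have -> : a i *+ (i == j) = \sum_l a l * ((i == l)%:R * (j == l)%:R).
    rewrite (bigD1 i)//= eqxx big1 ?addr0 ?mul1r.
      by rewrite mulr_natr eq_sym.
    by move=> l li; rewrite eq_sym (negbTE li) mul0r mulr0.
  by rewrite -sumrB; apply: eq_bigr => l _; ring.
apply: (le_trans (ler_norm_sum _ _ _)).
rewrite -mulrA /s mulr_suml; apply: ler_sum => l _; rewrite normrM.
apply: ler_wpM2l => //.
have -> : S i l * S j l - (i == l)%:R * (j == l)%:R =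
  (S i l - (i == l)%:R) * (S j l - (j == l)%:R) +
   ((S i l - (i == l)%:R) * (j == l)%:R + (i == l)%:R * (S j l - (j == l)%:R)) by ring.
have Ce : 0 <= C * e by rewrite mulr_ge0// ltW.
have b1 (b : bool) : `|b%:R : R| <= 1 by case: b; rewrite ?normr1 ?normr0.
apply: (@le_trans _ _ ((C * e) * (C * e) + (C * e * 1 + 1 * (C * e)))).
  apply: (le_trans (ler_normD _ _)); apply: lerD; first by rewrite normrM ler_pM.
  by apply: (le_trans (ler_normD _ _)); rewrite !normrM; apply: lerD; apply: ler_pM.
have : C * e * (C * e) <= C * e * (C * 1).
  by apply: ler_wpM2l => //; apply: ler_wpM2l => //; exact: ltW.
lra.
Qed.

End low_rank.

(** * Almost sure simplicity of the spectrum *)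

Section exists_zero.
Context (R : realType).

Lemma rat_dense_rV n (v : 'rV[R]_n) (e : R) : 0 < e ->
  exists q : 'rV[rat]_n, ball v e (map_mx ratr q).
Proof.
move=> e0.
have h i : exists q : rat, v 0 i - e < ratr q < v 0 i + e.
  have [|q qv] := @rat_in_itvoo R (v 0 i - e) (v 0 i + e).
    by rewrite ltrD2l; lra.
  by exists q; move: qv; rewrite in_itv.
have [f fP] := choice h.
exists (\row_i f i); rewrite /ball/= /mx_ball; split => // i j.
rewrite /ball/= !mxE ord1; have := fP j.
by rewrite -ltr_distlC.
Qed.

(* The set is the intersection over m of the countable unions over rational v
   of {t | F t v < 1/m}; compactness gives an exact zero from approximate ones. *)
Lemma measurable_exists_zero d (T : measurableType d) n (F : T -> 'rV[R]_n -> R) :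
  (forall t v, 0 <= F t v) ->
  (forall v, measurable_fun setT (F ^~ v)) ->
  (forall t, continuous (F t)) ->
  (forall t v, F t v < 1 -> forall j, `|v 0 j| <= 2) ->
  measurable [set t | exists v, F t v = 0].
Proof.
move=> F0 mF cF bF.
pose B m k : set T := if unpickle k is Some q
  then [set t | F t (map_mx ratr (q : 'rV[rat]_n)) < m.+1%:R^-1] else set0.
have mB m k : measurable (B m k).
  rewrite /B; case: unpickle => [q|//].
  set w := map_mx _ _; set e := m.+1%:R^-1.
  have -> : [set t | F t w < e] = setT `&` (F ^~ w) @^-1` `]-oo, e[%classic.
    by rewrite setTI; apply/seteqP; split => t /=; rewrite in_itv.
  exact: mF.
suff -> : [set t | exists v, F t v = 0] = \bigcap_m \bigcup_k B m k.
  by apply: bigcapT_measurable => m; exact: bigcupT_measurable.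
apply/seteqP; split => t /=.
  move=> [v Fv] m _.
  have : \forall w \near v, F t w < m.+1%:R^-1.
    by apply: (cvgr_lt _ (cF t v)); rewrite Fv invr_gt0 ltr0n.
  move=> /nbhs_ballP[e /= e0 he].
  have [q qe] := rat_dense_rV v e0.
  by exists (pickle q) => //; rewrite /B pickleK; exact: he.
move=> H.
have ex m : exists w, F t w < m.+1%:R^-1.
  have [k _] := H m I; rewrite /B; case: unpickle => // q.
  by exists (map_mx ratr q).
pose K : set 'rV[R]_n := [set v | forall i, `[(-2)%R, 2%R]%classic (v ord0 i)].
have cK : compact K.
  by apply: (@rV_compact R n (fun=> `[-2, 2]%classic)) => i; exact: segment_compact.
have small w : F t w < 1 -> K w.
  move=> /bF h i; rewrite /= in_itv/=; have := h i; rewrite ord1.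
  by rewrite ler_norml.
have [w0 w01] := ex 0%N.
have K0 : K !=set0 by exists w0; apply: small; rewrite invr1 in w01.
have cFK : {within K, continuous (F t)} by exact: continuous_subspaceT.
have [c Kc minc] := EVT_min_rV K0 cK cFK.
exists c; apply/eqP; rewrite eq_le F0 andbT leNgt; apply/negP => Fc0.
have [m hm] : exists m : nat, m.+1%:R^-1 < F t c.
  have [m hm] := ltr_add_invr Fc0.
  by exists m; rewrite add0r in hm.
have [w Fw] := ex m.
have Fw1 : F t w < 1.
  apply: (lt_le_trans Fw); rewrite invf_le1 ?ltr0n// ler1n//.
have := minc w; rewrite inE => /(_ (small _ Fw1)).
by rewrite leNgt (lt_trans Fw hm).
Qed.

Lemma continuous_sumR (U : topologicalType) (I : finType) (f : I -> U -> R) :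
  (forall i, continuous (f i)) -> continuous (fun x => \sum_i f i x).
Proof.
move=> cf; apply: continuous_big => // x; exact: add_continuous.
Qed.

(** The condition becomes the zero set of a nonnegative function of the vector: eigenvalue equation,
    unit length and value constraint each contribute a term. The strict inequality is exhausted by
    the closed conditions with margin 1/(m+1). *)
Lemma measurable_exists_eigvec d (T : measurableType d) n (h : T -> 'M[R]_n)
    (th : R -> R) (A : 'M[R]_n) (c : R) : continuous th ->
  (forall i j, measurable_fun setT (fun t => h t i j)) ->
  measurable [set t | exists v : 'cV[R]_n, [/\ dot v v = 1,
     exists l, h t *m v = l *: v & c < th (quadf A v)]].
Proof.
move=> cth mh.
(* For a unit eigenvector the eigenvalue equals the Rayleigh quotient [rho], which removes the
   quantifier over [l]. *)
pose rho t (v : 'rV[R]_n) := \sum_i \sum_j v 0 i * h t i j * v 0 j.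
pose qA (v : 'rV[R]_n) := \sum_i \sum_j v 0 i * A i j * v 0 j.
pose F m t (v : 'rV[R]_n) := \sum_i (\sum_j h t i j * v 0 j - rho t v * v 0 i) ^+ 2 +
  (\sum_i v 0 i ^+ 2 - 1) ^+ 2 + Num.max 0 (c + m.+1%:R^-1 - th (qA v)).
have S0 t (v : 'rV[R]_n) : 0 <= \sum_i (\sum_j h t i j * v 0 j - rho t v * v 0 i) ^+ 2.
  by apply: sumr_ge0 => i _; exact: sqr_ge0.
have M0 (x : R) : 0 <= Num.max 0 x by rewrite le_max lexx.
suff -> : [set t | exists v : 'cV[R]_n, [/\ dot v v = 1,
     exists l, h t *m v = l *: v & c < th (quadf A v)]] =
     \bigcup_m [set t | exists v, F m t v = 0].
  apply: bigcupT_measurable => m; apply: measurable_exists_zero.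
  - by move=> t v; rewrite /F !addr_ge0// sqr_ge0.
  - move=> v; rewrite /F; apply: measurable_funD => //; apply: measurable_funD => //.
    apply: measurable_sum => i; apply: measurable_funX; apply: measurable_funB.
      by apply: measurable_sum => j; apply: measurable_funM.
    apply: measurable_funM => //; apply: measurable_sum => p.
    by apply: measurable_sum => q; apply: measurable_funM => //; apply: measurable_funM.
  - move=> t.
    have cc i : continuous (fun v : 'rV[R]_n => v 0 i) by exact: coord_continuous.
    have cM (f g : 'rV[R]_n -> R) : continuous f -> continuous g ->
      continuous (fun v => f v * g v) by move=> cf cg v; exact: (cvgM (cf v) (cg v)).
    have cD (f g : 'rV[R]_n -> R) : continuous f -> continuous g ->
      continuous (fun v => f v + g v) by move=> cf cg v; exact: (cvgD (cf v) (cg v)).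
    have cN (f : 'rV[R]_n -> R) : continuous f ->
      continuous (fun v => - f v) by move=> cf v; exact: (cvgN (cf v)).
    have ccst (x : R) : continuous (fun v : 'rV[R]_n => x) by exact: cst_continuous.
    have cX (f : 'rV[R]_n -> R) : continuous f -> continuous (fun v => f v ^+ 2).
      by move=> cf; exact: (cM f f).
    have cquad (B : 'M[R]_n) : continuous (fun v : 'rV[R]_n => \sum_i \sum_j v 0 i * B i j * v 0 j).
      apply: continuous_sumR => i; apply: continuous_sumR => j.
      apply: (cM (fun v => v 0 i * B i j) (fun v => v 0 j)) => //.
      exact: (cM (fun v => v 0 i) (fun=> B i j)).
    apply: (cD (fun v => \sum_i (\sum_j h t i j * v 0 j - rho t v * v 0 i) ^+ 2 +
       (\sum_i v 0 i ^+ 2 - 1) ^+ 2) (fun v => Num.max 0 (c + m.+1%:R^-1 - th (qA v)))).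
      apply: (cD (fun v => \sum_i (\sum_j h t i j * v 0 j - rho t v * v 0 i) ^+ 2)
         (fun v => (\sum_i v 0 i ^+ 2 - 1) ^+ 2)).
      + apply: continuous_sumR => i.
        apply: (cX (fun v => \sum_j h t i j * v 0 j - rho t v * v 0 i)).
        apply: (cD (fun v => \sum_j h t i j * v 0 j) (fun v => - (rho t v * v 0 i))).
          by apply: continuous_sumR => j; exact: (cM (fun=> h t i j) (fun v => v 0 j)).
        by apply: cN; apply: (cM (rho t) (fun v => v 0 i)) => //; exact: cquad.
      + apply: (cX (fun v => \sum_i v 0 i ^+ 2 - 1)).
        apply: (cD (fun v => \sum_i v 0 i ^+ 2) (fun=> - 1)); last exact: ccst.
        by apply: continuous_sumR => i; exact: (cX (fun v => v 0 i)).
    + move=> v.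
      have cg : continuous (fun v => c + m.+1%:R^-1 - th (qA v)).
        apply: (cD (fun=> c + m.+1%:R^-1) (fun v => - th (qA v))); first exact: ccst.
        apply: cN => w; apply: (continuous_comp (cquad A w)); exact: cth.
      have := @continuous_max _ _ (fun=> 0) (fun v => c + m.+1%:R^-1 - th (qA v)) v (ccst 0 v) (cg v).
      exact.
  (* The unit-length term being below 1 forces |v|^2 <= 2, which confines approximate zeros to a
     cube. *)
  - move=> t v Ft j; have : (\sum_i v 0 i ^+ 2 - 1) ^+ 2 < 1.
      apply: le_lt_trans Ft; rewrite /F addrAC lerDr addr_ge0//.
    move=> s1; have : \sum_i v 0 i ^+ 2 <= 2.
      rewrite leNgt; apply/negP => s2; move: s1; rewrite ltNge => /negP; apply.
      by rewrite exprn_ege1//; lra.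
    rewrite (bigD1 j)//= => s2.
    have vj : v 0 j ^+ 2 <= 2.
      by apply: le_trans s2; rewrite lerDl sumr_ge0// => i _; exact: sqr_ge0.
    rewrite -(@ler_pXn2r _ 2)// ?nnegrE// real_normK ?num_real//.
    by apply: (le_trans vj); rewrite -natrX ler_nat.
have rhoE t (v : 'cV[R]_n) : rho t v^T = dot v (h t *m v).
  rewrite dotE /rho; apply: eq_bigr => i _; rewrite !mxE mulr_sumr.
  by apply: eq_bigr => j _; rewrite !mxE mulrA.
have qAE (v : 'cV[R]_n) : qA v^T = quadf A v.
  by rewrite quadfE; apply: eq_bigr => i _; apply: eq_bigr => j _; rewrite !mxE.
apply/seteqP; split => t /=.
  move=> [v [vv [l hv] cv]].
  have [m hm] := ltr_add_invr cv.
  exists m => //; exists v^T.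
  rewrite /F rhoE qAE hv dotZr vv mulr1.
  rewrite [X in X + _ + _]big1 ?add0r; last first.
    move=> i _; have := congr1 (fun w : 'cV_n => w i 0) hv; rewrite !mxE => hvi.
    by under eq_bigr do rewrite mxE; rewrite hvi subrr expr0n.
  have -> : \sum_i v^T 0 i ^+ 2 = 1.
    by rewrite -vv dotE; apply: eq_bigr => i _; rewrite mxE expr2.
  rewrite subrr expr0n add0r; apply/max_idPl; rewrite subr_le0; exact: ltW.
move=> [m _ [v]]; rewrite /F => /eqP.
rewrite paddr_eq0// ?addr_ge0 ?sqr_ge0// paddr_eq0 ?sqr_ge0//.
move=> /andP[/andP[/eqP h1 /eqP h2] /eqP h3].
exists v^T; split.
- rewrite dotE; move/eqP: h2; rewrite sqrf_eq0 subr_eq0 => /eqP <-.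
  by apply: eq_bigr => i _; rewrite mxE expr2.
- exists (rho t v); apply/colP => i; rewrite !mxE.
  have /eqP := psumr_eq0P (fun i _ => sqr_ge0 _) h1 (i := i) isT.
  rewrite sqrf_eq0 subr_eq0 => /eqP <-.
  by apply: eq_bigr => j _; rewrite mxE.
- rewrite -qAE trmxK.
  have : c + m.+1%:R^-1 - th (qA v) <= 0 by rewrite -h3 le_max lexx orbT.
  by rewrite subr_le0; apply: lt_le_trans; rewrite ltrDl invr_gt0 ltr0n.
Qed.

End exists_zero.

(** * Krylov determinants as a test for simple spectrum *)

Section krylov.

(** Columns e, M e, M^2 e, ...: a nonzero determinant means that e is a cyclic vector, an algebraic
    condition that excludes repeated eigenvalues of symmetric matrices. The ring is general so that
    polynomial matrices are allowed. *)
Definition krylov (K : comNzRingType) n (M : 'M[K]_n) (e : 'cV[K]_n) : 'M[K]_n :=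
  \matrix_(i, j) (iter j (mulmx M) e) i 0.

Lemma map_krylov (K L : comNzRingType) (f : {rmorphism K -> L}) n (M : 'M[K]_n)
    (e : 'cV[K]_n) :
  map_mx f (krylov M e) = krylov (map_mx f M) (map_mx f e).
Proof.
apply/matrixP => i j; rewrite !mxE.
suff -> : iter j (mulmx (map_mx f M)) (map_mx f e) = map_mx f (iter j (mulmx M) e).
  by rewrite mxE.
by elim: (nat_of_ord j) => //= m ->; rewrite map_mxM.
Qed.

Lemma det_krylov_scale (K : comNzRingType) n (c : K) (M : 'M[K]_n) (e : 'cV[K]_n) :
  \det (krylov (c *: M) e) = \det (krylov M e) * \prod_(j < n) c ^+ j.
Proof.
have -> : krylov (c *: M) e = krylov M e *m diag_mx (\row_(j < n) c ^+ j).
  apply/matrixP => i j; rewrite mul_mx_diag !mxE.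
  suff -> : iter j (mulmx (c *: M)) e = c ^+ j *: iter j (mulmx M) e.
    by rewrite mxE mulrC.
  elim: (nat_of_ord j) => /= [|m ->]; first by rewrite scale1r.
  by rewrite -scalemxAr -scalemxAl scalerA exprSr.
rewrite det_mulmx det_diag; congr (_ * _).
by apply: eq_bigr => j _; rewrite mxE.
Qed.

Context (R : realType).

(** A two-dimensional eigenspace contains a nonzero w orthogonal to e; by symmetry w is orthogonal
    to every H^j e, hence to all columns of the Krylov matrix. *)
Lemma det_krylov_degenerate n (H : 'M[R]_n) (e u v : 'cV[R]_n) (l : R) : H^T = H ->
  H *m u = l *: u -> H *m v = l *: v -> u != 0 -> v != 0 -> dot u v = 0 ->
  \det (krylov H e) = 0.
Proof.
move=> tH Hu Hv u0 v0 uv.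
have [w [w0 we Hw]] : exists w : 'cV[R]_n, [/\ w != 0, dot w e = 0 & H *m w = l *: w].
  have [ue|ue] := eqVneq (dot u e) 0; first by exists u.
  exists (dot v e *: u - dot u e *: v); split.
  - apply/eqP => w0; have : dot (dot v e *: u - dot u e *: v) v = 0.
      by rewrite w0 /dot trmx0 mul0mx mxE.
    rewrite dotBl !dotZl uv mulr0 sub0r => /eqP; rewrite oppr_eq0 mulf_eq0 (negbTE ue)/=.
    by move=> /eqP/dot_eq0 v0'; rewrite v0' eqxx in v0.
  - by rewrite dotBl !dotZl mulrC subrr.
  - by rewrite mulmxBr -!scalemxAr Hu Hv scalerBr !scalerA !(mulrC l).
apply/eqP/det0P; exists w^T; first by rewrite trmx_eq0.
apply/rowP => j; rewrite [RHS]mxE mxE.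
transitivity (dot w (iter j (mulmx H) e)).
  by rewrite dotE; apply: eq_bigr => i _; rewrite !mxE.
elim: (nat_of_ord j) => //= m IH.
by rewrite -{1}tH -dot_mulmx Hw dotZl IH mulr0.
Qed.

Lemma poly_roots_seq (p : {poly R}) : p != 0 -> exists rs : seq R, forall x, root p x -> x \in rs.
Proof.
elim: (size p) {-2}p (leqnn (size p)) => {p} [p|n IH p sp p0].
  by rewrite size_poly_leq0 => ->.
have [[x rx]|nr] := pselect (exists x, root p x); last first.
  by exists [::] => x rx; case: nr; exists x.
have /factor_theorem[q pq] := rx.
have q0 : q != 0 by apply: contraNneq p0 => q0; rewrite pq q0 mul0r.
have [|rs Hrs] := IH q _ q0.
  by move: sp; rewrite pq size_Mmonic ?monicXsubC// size_XsubC addn2 ltnS.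
exists (x :: rs) => y; rewrite pq rootM root_XsubC inE orbC => /orP[->//|/Hrs ->].
by rewrite orbT.
Qed.

(* det krylov (H + y D) is y^k times a polynomial in 1/y whose value at 0 is
   the Vandermonde determinant det krylov D. *)
Lemma krylov_pencil n (H : 'M[R]_n) : exists rs : seq R, forall y,
  \det (krylov (H + y *: diag_mx (\row_i (i.+1)%:R)) (const_mx 1)) = 0 -> y \in rs.
Proof.
pose D : 'M[R]_n := diag_mx (\row_i (i.+1)%:R); pose e : 'cV[R]_n := const_mx 1.
pose Hp := map_mx polyC H; pose Dp := map_mx polyC D.
pose q := \det (krylov ('X *: Hp + Dp) (map_mx polyC e)).
have qE s : q.[s] = \det (krylov (s *: H + D) e).
  have pK m1 m2 (B : 'M[R]_(m1, m2)) : map_mx (horner_eval s) (map_mx polyC B) = B.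
    by apply/matrixP => i j; rewrite !mxE horner_evalE hornerC.
  rewrite /q -[LHS]/(horner_eval s _) -det_map_mx map_krylov pK; congr (\det (krylov _ _)).
  apply/matrixP => i j; rewrite !mxE /= /horner_eval !hornerE.
  by rewrite ?mxE.
have q0 : q != 0.
  have : q.[0] != 0.
    rewrite qE scale0r add0r -det_tr.
    have -> : (krylov D e)^T = Vandermonde n (\row_i (i.+1)%:R).
      apply/matrixP => i j; rewrite !mxE.
      suff -> : iter i (mulmx D) e = \col_l ((l.+1)%:R ^+ i) by rewrite mxE.
      elim: (nat_of_ord i) => [|m IH]; first by apply/colP => l; rewrite !mxE.
      by rewrite iterS IH /D mul_diag_mx; apply/colP => l; rewrite !mxE exprS.
    rewrite det_Vandermonde; apply/prodf_neq0 => i _; apply/prodf_neq0 => j ij.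
    by rewrite !mxE subr_eq0 eqr_nat eqSS neq_ltn ij orbT.
  by apply: contraNneq => ->; rewrite horner0.
have [rs Hrs] := poly_roots_seq q0.
(* The reduction divides by y, so 0 is listed separately; the other candidates are the inverses of
   the roots of [q]. *)
exists (0 :: [seq x^-1 | x <- rs]) => y hy; rewrite inE.
have [//|y0 /=] := eqVneq y 0.
apply/mapP; exists y^-1; last by rewrite invrK.
apply: Hrs; rewrite rootE qE.
have E : H + y *: D = y *: (y^-1 *: H + D) by rewrite scalerDr scalerA divff// scale1r.
move: hy; rewrite -/D -/e E det_krylov_scale => /eqP.
rewrite mulf_eq0 => /orP[//|]; have : \prod_(j < n) y ^+ j != 0.
  by apply/prodf_neq0 => j _; rewrite expf_neq0.
by move=> /negbTE ->.
Qed.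

End krylov.

(** * Orthogonal invariance of the eigenvectors of the GOE *)

Section goe_coordinates.
Context (R : realType) (N : nat).

Definition symidx := {p : 'I_N * 'I_N | (p.1 <= p.2)%N}.

Definition goe_sd (i j : 'I_N) : R := Num.sqrt ((1 + (i == j)%:R) / N%:R).

(** Coordinates are scaled by the entrywise standard deviation, so that a GOE matrix corresponds to
    a standard Gaussian family. The sum picks the unique upper-triangular index matching (i, j) or
    (j, i). *)
Definition symmx (x : symidx -> R) : 'M[R]_N :=
  \matrix_(i, j) \sum_p ((val p == (i, j)) || (val p == (j, i)))%:R * goe_sd i j * x p.

Definition symco (M : 'M[R]_N) : symidx -> R :=
  fun p => M (val p).1 (val p).2 / goe_sd (val p).1 (val p).2.

Lemma goe_sd_gt0 i j : 0 < goe_sd i j.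
Proof.
rewrite /goe_sd sqrtr_gt0; apply: divr_gt0; first by apply: ltr_wpDr.
by rewrite ltr0n; apply: leq_trans (ltn_ord i).
Qed.

Lemma goe_sdC i j : goe_sd i j = goe_sd j i.
Proof. by rewrite /goe_sd eq_sym. Qed.

Lemma symmx_val x (p : symidx) : symmx x (val p).1 (val p).2 = goe_sd (val p).1 (val p).2 * x p.
Proof.
rewrite mxE (bigD1 p)//= -surjective_pairing eqxx/= mul1r big1 ?addr0// => q qp.
have /negbTE -> : val q != val p by [].
have [e|_] := eqVneq (val q) ((val p).2, (val p).1); last by rewrite mul0r mul0r.
have := valP q; rewrite e/= => h1; have h2 := valP p.
have h : (val p).1 = (val p).2 by apply/val_inj/eqP; rewrite eqn_leq h1 h2.
by case/eqP: qp; apply: val_inj; rewrite e; move: h; case: (val p) => a b /= ->.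
Qed.

Lemma symmx_sym x : (symmx x)^T = symmx x.
Proof.
apply/matrixP => i j; rewrite !mxE; apply: eq_bigr => p _.
by rewrite orbC goe_sdC.
Qed.

Lemma sym_eq (M M' : 'M[R]_N) : M^T = M -> M'^T = M' ->
  (forall p : symidx, M (val p).1 (val p).2 = M' (val p).1 (val p).2) -> M = M'.
Proof.
move=> tM tM' h; apply/matrixP => i j.
have [ij|ji] := leqP i j; first exact: (h (Sub (i, j) ij)).
by rewrite -tM -tM' !mxE; exact: (h (Sub (j, i) (ltnW ji))).
Qed.

Lemma symcoK (M : 'M[R]_N) : M^T = M -> symmx (symco M) = M.
Proof.
move=> tM; apply: sym_eq => //; first exact: symmx_sym.
by move=> p; rewrite symmx_val /symco mulrC divfK// gt_eqF// goe_sd_gt0.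
Qed.

Lemma symmxK x : symco (symmx x) = x.
Proof.
by apply/funext => p; rewrite /symco symmx_val mulrC mulKf// gt_eqF// goe_sd_gt0.
Qed.

Lemma sum_symidx (F : 'I_N -> 'I_N -> R) : (forall i j, F i j = F j i) ->
  \sum_i \sum_j F i j =
  \sum_(p : symidx) F (val p).1 (val p).2 * (1 + ((val p).1 != (val p).2)%:R).
Proof.
move=> Fs; rewrite pair_big/= (bigID (fun p : 'I_N * 'I_N => (p.1 <= p.2)%N))/=.
have -> : \sum_(p : 'I_N * 'I_N | ~~ (p.1 <= p.2)%N) F p.1 p.2 =
    \sum_(p : 'I_N * 'I_N | (p.1 <= p.2)%N) F p.1 p.2 * (p.1 != p.2)%:R.
  rewrite (reindex_inj (h := fun p : 'I_N * 'I_N => (p.2, p.1)))/=; last first.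
    by move=> [a b] [c d'] /= [-> ->].
  rewrite [RHS](bigID (fun p : 'I_N * 'I_N => p.1 == p.2))/= [X in _ = X + _]big1 ?add0r.
    apply: eq_big => [[i j]|[i j]] /=; last first.
      by rewrite -ltnNge => ij; rewrite Fs -val_eqE/= (ltn_eqF ij) mulr1.
    by rewrite -ltnNge ltn_neqAle andbC -val_eqE.
  by move=> p /andP[_ /eqP ->]; rewrite eqxx mulr0.
rewrite -big_split/=.
rewrite [LHS](eq_bigr (fun p : 'I_N * 'I_N => F p.1 p.2 * (1 + (p.1 != p.2)%:R))); last first.
  by move=> p _; rewrite mulrDr mulr1.
by rewrite big_sub.
Qed.

(** The factor 1 + delta_ij in the variances makes this exact: a diagonal entry is counted once with
    variance 2/N, an off-diagonal one twice with variance 1/N. Conjugation by an orthogonal matrix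
    preserves the Frobenius norm and is therefore an isometry of the coordinates. *)
Lemma sq_symmx x : (0 < N)%N -> sq x = N%:R / 2 * \sum_i \sum_j symmx x i j ^+ 2.
Proof.
move=> N0; rewrite (sum_symidx (F := fun i j => symmx x i j ^+ 2)); last first.
  by move=> i j; rewrite -{1}(symmx_sym x) mxE.
rewrite /sq mulr_sumr; apply: eq_bigr => p _.
rewrite symmx_val exprMn /goe_sd sqr_sqrtr; last first.
  by rewrite divr_ge0// addr_ge0.
have N0' : N%:R != 0 :> R by rewrite pnatr_eq0 -lt0n.
by case: eqP => _ /=; rewrite ?mulr0n ?mulr1n; field.
Qed.

Lemma frobenius_trace (M : 'M[R]_N) : \sum_i \sum_j M i j ^+ 2 = \tr (M *m M^T).
Proof.
apply: eq_bigr => i _; rewrite mxE; apply: eq_bigr => j _.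
by rewrite mxE expr2.
Qed.

Definition symconj (O : 'M[R]_N) (x : symidx -> R) : symidx -> R :=
  symco (O *m symmx x *m O^T).

Lemma symmx_conj O x : symmx (symconj O x) = O *m symmx x *m O^T.
Proof. by rewrite symcoK// !trmx_mul trmxK symmx_sym mulmxA. Qed.

Lemma symmx_linear x : symmx x = \sum_p x p *: symmx (unitv R p).
Proof.
apply/matrixP => i j; rewrite summxE mxE; apply: eq_bigr => p _.
rewrite !mxE (bigD1 p)//= /unitv eqxx mulr1 big1 ?addr0; first by rewrite mulrC.
by move=> q /negbTE ->; rewrite mulr0.
Qed.

Lemma symconj_linear O x p : symconj O x p = \sum_q symconj O (unitv R q) p * x q.
Proof.
rewrite /symconj /symco {1}symmx_linear mulmx_sumr mulmx_suml summxE mulr_suml.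
apply: eq_bigr => q _; rewrite -scalemxAr -scalemxAl mxE; ring.
Qed.

Lemma symconj_sq O x : (0 < N)%N -> O^T *m O = 1%:M -> sq (symconj O x) = sq x.
Proof.
move=> N0 OO; rewrite !sq_symmx// symmx_conj !frobenius_trace; congr (_ * _).
rewrite !trmx_mul trmxK symmx_sym -!mulmxA (mulmxA O^T O) OO mul1mx.
by rewrite mxtrace_mulC -!mulmxA OO mulmx1.
Qed.

Lemma gaussfam_symconj d (T : measurableType d) (P : probability T R)
    (X : T -> symidx -> R) O : (0 < N)%N -> O^T *m O = 1%:M ->
  gaussfam P X -> gaussfam P (symconj O \o X).
Proof.
move=> N0 OO gX; apply: (gaussfam_isometry gX (g' := symconj O^T)).
- exact: symconj_linear.
- move=> x; rewrite /symconj symcoK; last first.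
    by rewrite !trmx_mul !trmxK symmx_sym mulmxA.
  have OO' := mulmx1C OO.
  by rewrite trmxK !mulmxA OO' mul1mx -mulmxA OO' mulmx1 symmxK.
- by move=> x; exact: symconj_sq.
Qed.

End goe_coordinates.

Section goe_law.
Context (R : realType).

Lemma normal_prob_scale (s : R) (B : set R) : 0 < s -> measurable B ->
  normal_prob 0 s ((fun x => x / s) @^-1` B) = normal_prob 0 1 B.
Proof.
move=> s0 mB.
have sn0 : s != 0 by rewrite gt_eqF.
have pE x : normal_pdf 0 s (s * x) = s^-1 * normal_pdf 0 1 x.
  rewrite !normal_pdfE ?oner_eq0// /normal_peak /normal_fun !subr0 expr1n mul1r mulrA.
  congr (_ * expR _).
    rewrite -mulrnAr sqrtrM ?sqr_ge0// sqrtr_sqr gtr0_norm// invfM//.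
  by rewrite exprMn; field.
have mpre : measurable ((fun x => x / s) @^-1` B).
  rewrite -[X in measurable X]setTI; apply: (measurable_funM (f := id) (g := cst s^-1)) => //.
pose G (x : R) := ((\1_((fun x => x / s) @^-1` B) x)%:E * (normal_pdf 0 s x)%:E)%E.
have I1 (D : set R) (f : R -> \bar R) : (\int[lebesgue_measure]_(x in D) f x =
   \int[lebesgue_measure]_x ((\1_D x)%:E * f x))%E.
  rewrite integral_mkcond; apply: eq_integral => x _; rewrite patchE indicE.
  by case: ifP => _; rewrite ?mul1e ?mul0e.
rewrite /normal_prob I1 [RHS]I1.
have mG : measurable_fun setT G.
  apply: emeasurable_funM; apply/measurable_EFinP; first exact: measurable_indic.
  exact: measurable_normal_pdf.
have G0 x : (0 <= G x)%E by rewrite mule_ge0// lee_fin// normal_pdf_ge0.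
have := ge0_integral_affine 0 sn0 mG G0.
rewrite (gtr0_norm s0) => h.
transitivity (s%:E * \int[lebesgue_measure]_x G (s * x + 0)%R)%E.
  by rewrite h muleA -EFinM divff// mul1e.
have mGs : measurable_fun setT (fun x : measurableTypeR R => G (s * x + 0)%R).
  by apply: (measurableT_comp mG); apply: measurable_funD => //; exact: measurable_funM.
have s0E : (0 <= s%:E)%E by rewrite lee_fin ltW.
rewrite -(ge0_integralZl lebesgue_measure measurableT mGs (fun x _ => G0 _) s0E).
apply: eq_integral => x _; rewrite addr0 /G pE.
have -> : \1_((fun x => x / s) @^-1` B) (s * x) = \1_B x :> R.
  rewrite !indicE; congr (_%:R); apply: congr1.
  by apply/idP/idP; rewrite !inE /= mulrC mulKf.
by rewrite -!EFinM; congr EFin; field.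
Qed.

Lemma goe_gaussfam d (T : measurableType d) (P : probability T R) N
    (H : T -> 'M[R]_N) : is_GOE P H -> gaussfam P (fun t => symco (H t)).
Proof.
move=> [tH mH lawH indH]; split => [p|B mB].
  by apply: measurable_funM => //; exact: mH.
pose s (p : symidx N) : R := goe_sd R (val p).1 (val p).2.
(* The independence hypothesis takes a set for every pair of indices; pairs below the diagonal
   receive the full line. *)
pose C (ij : 'I_N * 'I_N) : set R :=
  if insub ij is Some p then (fun x => x / s p) @^-1` B p else setT.
have mpre (p : symidx N) : measurable ((fun x => x / s p) @^-1` B p).
  rewrite -[X in measurable X]setTI; apply: (measurable_funM (f := id) (g := cst (s p)^-1)) => //.
have mC ij : measurable (C ij) by rewrite /C; case: insub.
have Cv p : C (val p) = (fun x => x / s p) @^-1` B p by rewrite /C valK.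
transitivity (P (\bigcap_(i in [set i : 'I_N * 'I_N | (i.1 <= i.2)%N])
     ((fun t => H t i.1 i.2) @^-1` C i))).
  congr (P _); apply/seteqP; split => t /= h.
    by move=> ij ijle; have := h (Sub ij ijle); rewrite -[ij]/(val (Sub ij ijle : symidx N)) Cv.
  by move=> p; have := h (val p) (valP p); rewrite Cv.
rewrite (indH C mC) [LHS](big_sub _)/=.
apply: eq_bigr => p _; rewrite lawH//; last exact: (valP p).
by rewrite Cv; apply: normal_prob_scale => //; exact: goe_sd_gt0.
Qed.

End goe_law.

(** * Simplicity of the GOE spectrum and conjugation invariance *)

Section goe_simple_spectrum.
Context (R : realType).

(** Householder reflection for families over a finite type. When z = 0 the convention x/0 = 0 makes
    it the identity, so it is an isometric involution for every z. *)
Definition reflect (I : finType) (z x : I -> R) : I -> R :=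
  fun i => x i - 2 * (\sum_j z j * x j) / sq z * z i.

Lemma reflect_linear (I : finType) (z x : I -> R) i :
  reflect z x i = \sum_j reflect z (unitv R j) i * x j.
Proof.
rewrite {2}/reflect; under [RHS]eq_bigr do rewrite mulrBl sum_unitvr.
rewrite sumrB; congr (_ - _).
  by rewrite -[LHS]sum_unitvl; apply: eq_bigr => j _; rewrite /unitv eq_sym.
rewrite mulr_sumr !mulr_suml; apply: eq_bigr => j _; ring.
Qed.

Lemma sq_eq0 (I : finType) (z : I -> R) : sq z = 0 -> forall i, z i = 0.
Proof.
move=> h i; have /eqP := psumr_eq0P (fun i _ => sqr_ge0 (z i)) h (i := i) isT.
by rewrite sqrf_eq0 => /eqP.
Qed.

Lemma reflect_sq (I : finType) (z x : I -> R) : sq (reflect z x) = sq x.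
Proof.
have [z0|z0] := eqVneq (sq z) 0.
  by congr sq; apply/funext => i; rewrite /reflect z0 invr0 mulr0 mul0r subr0.
pose s := \sum_j z j * x j; pose c := 2 * s / sq z.
have -> : sq (reflect z x) = \sum_i (x i - c * z i) ^+ 2 by [].
have -> : \sum_i (x i - c * z i) ^+ 2 = sq x - 2 * c * s + c ^+ 2 * sq z.
  rewrite /sq /s !mulr_sumr -sumrB -big_split/=; apply: eq_bigr => i _; ring.
by rewrite /c; field.
Qed.

Lemma reflectK (I : finType) (z x : I -> R) : reflect z (reflect z x) = x.
Proof.
apply/funext => i; rewrite /reflect.
have [z0|z0] := eqVneq (sq z) 0.
  by rewrite z0 invr0 !mulr0 !mul0r !subr0.
set s := \sum_j z j * x j.
have -> : \sum_j z j * (x j - 2 * s / sq z * z j) = - s.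
  set c := 2 * s / sq z.
  transitivity (s - c * sq z); last by rewrite /c divfK//; ring.
  rewrite [X in _ - _ * X]/sq {1}/s mulr_sumr -sumrB; apply: eq_bigr => j _; ring.
by rewrite mulrN mulNr mulNr opprK subrK.
Qed.

Lemma reflect_swap (I : finType) (u v : I -> R) : sq u = sq v ->
  reflect (fun i => u i - v i) u = v.
Proof.
move=> uv; apply/funext => i; rewrite /reflect.
set z := fun i => u i - v i.
have [z0|z0] := eqVneq (sq z) 0.
  have := sq_eq0 z0 i; rewrite /z z0 invr0 => /eqP; rewrite subr_eq0 => /eqP ->.
  by rewrite mulr0 mul0r subr0.
have E : 2 * (\sum_j z j * u j) = sq z.
  apply/eqP; rewrite -subr_eq0; apply/eqP.
  transitivity (sq u - sq v); last by rewrite uv subrr.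
  rewrite /sq mulr_sumr -!sumrB; apply: eq_bigr => j _; rewrite /z; ring.
by rewrite E divff// mul1r /z subKr.
Qed.

Lemma measurable_det d (T : measurableType d) n (M : T -> 'M[R]_n) :
  (forall i j, measurable_fun setT (fun t => M t i j)) ->
  measurable_fun setT (fun t => \det (M t)).
Proof.
move=> mM; apply: measurable_sum => s; apply: measurable_funM => //.
exact: measurable_prod.
Qed.

Lemma measurable_krylov d (T : measurableType d) n (M : T -> 'M[R]_n) e i j :
  (forall i j, measurable_fun setT (fun t => M t i j)) ->
  measurable_fun setT (fun t => krylov (M t) e i j).
Proof.
move=> mM; apply: (eq_measurable_fun (fun t => iter j (mulmx (M t)) e i 0)).
  by move=> t _; rewrite mxE.
elim: (nat_of_ord j) i => [|m IH] i /=; first exact: measurable_cst.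
apply: (eq_measurable_fun (fun t => \sum_l M t i l * iter m (mulmx (M t)) e l 0)).
  by move=> t _; rewrite mxE.
by apply: measurable_sum => l; apply: measurable_funM.
Qed.

Lemma measurable_symmx N i j : measurable_fun setT (fun x : coordT R (symidx N) => symmx x i j).
Proof.
apply: (eq_measurable_fun (fun x : coordT R (symidx N) =>
  \sum_p ((val p == (i, j)) || (val p == (j, i)))%:R * goe_sd R i j * x p)).
  by move=> x _; rewrite mxE.
apply: measurable_sum => p; apply: measurable_funM => //; exact: measurable_coord.
Qed.

Lemma gauss_finite (rs : seq R) (A : set R) : measurable A ->
  (forall y, A y -> y \in rs) -> normal_prob 0 1 A = 0%E.
Proof.
move=> mA Ars; rewrite /normal_prob; apply: null_set_integral => //.
  by apply: measurable_funTS; apply/measurable_EFinP; exact: measurable_normal_pdf.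
apply: countable_lebesgue_measure0; apply: finite_set_countable.
by apply: (sub_finite_set (B := [set` rs])).
Qed.

Lemma symmxD N (x y : symidx N -> R) (c : R) :
  symmx (fun p => x p + c * y p) = symmx x + c *: symmx y.
Proof.
apply/matrixP => i j; rewrite !mxE mulr_sumr -big_split/=.
by apply: eq_bigr => p _; ring.
Qed.

(** Gaussian coordinates are rotated so that one of them runs along D = diag(1, ..., n). Resampling
    it with the others frozen gives a pencil H0 + y D, whose Krylov determinant vanishes only at
    finitely many y, a null set. *)
Lemma simple_ae d (T : measurableType d) (P : probability T R) N
    (X : T -> symidx N -> R) : (0 < N)%N -> gaussfam P X ->
  P [set t | \det (krylov (symmx (X t)) (const_mx 1)) = 0] = 0%E.
Proof.
case: N X => // n X _ gX.
pose Z : set (coordT R (symidx n.+1)) := [set x | \det (krylov (symmx x) (const_mx 1)) = 0].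
have mdet : measurable_fun setT (fun x : coordT R (symidx n.+1) => \det (krylov (symmx x) (const_mx 1))).
  by apply: measurable_det => i j; apply: measurable_krylov => *; exact: measurable_symmx.
have mZ : measurable Z.
  rewrite -[Z]setTI; exact: (mdet measurableT _ (measurable_set1 0)).
pose D : 'M[R]_n.+1 := diag_mx (\row_i (i.+1)%:R).
pose v : symidx n.+1 -> R := symco D.
have tD : D^T = D by rewrite tr_diag_mx.
have p0P : ((ord0 : 'I_n.+1) <= (ord0 : 'I_n.+1))%N by [].
pose p0 : symidx n.+1 := Sub (ord0, ord0) p0P.
have v0 : v p0 != 0.
  rewrite /v /symco /= mxE eqxx mxE mulr1n mulf_neq0// ?oner_eq0//.
  by rewrite invr_eq0 gt_eqF// goe_sd_gt0.
have sqv : 0 < sq v.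
  rewrite lt_neqAle sq_ge0 andbT eq_sym; apply/eqP => /sq_eq0 /(_ p0) /eqP.
  exact/negP.
(* [u] is the basis vector of [p0] stretched to the length of [v], so that a reflection carries the
   one to the other. *)
pose s := Num.sqrt (sq v).
have s0 : 0 < s by rewrite sqrtr_gt0.
pose u : symidx n.+1 -> R := fun p => s * unitv R p0 p.
have squ : sq u = sq v.
  rewrite /sq /u (bigD1 p0)//= big1 ?addr0; last first.
    by move=> p /negbTE pp; rewrite /unitv pp mulr0 expr0n.
  by rewrite /unitv eqxx mulr1 sqr_sqrtr// ltW.
pose g := reflect (fun p => u p - v p).
have gg : gaussfam P (g \o X).
  apply: (gaussfam_isometry gX (g' := g)).
  - exact: reflect_linear.
  - exact: reflectK.
  - exact: reflect_sq.
have gu : g u = v by exact: reflect_swap.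
have gupd x y : g (upd x p0 y) = fun p => g (upd x p0 0) p + (y / s) * v p.
  apply/funext => p; rewrite -gu /g !(reflect_linear _ (upd _ _ _)) (reflect_linear _ u).
  rewrite mulr_sumr -big_split/=; apply: eq_bigr => q _.
  rewrite /upd /u; set c := reflect _ _ p.
  have -> : unitv R p0 q = (q == p0)%:R by [].
  case: (q == p0); last by rewrite !mulr0 addr0.
  by rewrite mulr0 add0r mulr1; field; exact: lt0r_neq0.
have mgX : measurable_fun setT (g : coordT R (symidx n.+1) -> coordT R (symidx n.+1)).
  apply: measurable_coordP => p.
  apply: (eq_measurable_fun (fun x : coordT R _ => \sum_q g (unitv R q) p * x q)).
    by move=> x _; rewrite [RHS]reflect_linear.
  by apply: measurable_sum => q; apply: measurable_funM => //; exact: measurable_coord.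
pose f (x : coordT R (symidx n.+1)) := (\1_Z (g x) : R)%:E.
have mf : measurable_fun setT f.
  apply/measurable_EFinP; apply: (measurableT_comp (measurable_indic mZ)).
  exact: mgX.
have f0 x : (0 <= f x)%E by rewrite lee_fin.
apply: (etrans (iid_law gX gg mZ)).
transitivity (\int[P]_t f (X t))%E.
  rewrite /f; have := iid_measurable gg => mg.
  have mgZ : measurable ((g \o X) @^-1` Z).
    by rewrite -[X in measurable X]setTI; exact: mg.
  rewrite -[LHS]/(P ((g \o X) @^-1` Z)) -[X in P X = _]setIT -integral_indic//.
rewrite (iid_resample p0 gX mf f0) integral0_eq// => t _.
pose S : set R := [set y | Z (g (upd (X t) p0 y))].
have mS : measurable S.
  have mm : measurable_fun setT (fun y : R => g (upd (X t) p0 y) : coordT R _).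
    apply: (measurableT_comp mgX); apply: measurable_coordP => q; rewrite /upd.
    by case: (q == p0).
  by rewrite -[S]setTI; exact: (mm measurableT _ mZ).
apply: (etrans (y := (\int[normal_prob 0 1]_y (\1_S y)%:E)%E)); first exact: erefl.
rewrite integral_indic// setIT.
have [rs Hrs] := krylov_pencil (symmx (g (upd (X t) p0 0))).
apply: (@gauss_finite [seq s * r | r <- rs]) => // y; rewrite /S /Z /= gupd symmxD symcoK//.
move=> /Hrs h; apply/mapP; exists (y / s) => //.
by field; exact: lt0r_neq0.
Qed.

(** Off the null event where the Krylov determinant vanishes, the columns of [U t] are, up to sign,
    all the unit eigenvectors of [H t]. The event is then the complement of one that depends on [H]
    only, and replacing [H] by O^T H O, of the same law, moves the conjugation onto [A]. *)
Lemma goe_conj_invariant d (T : measurableType d) (P : probability T R) N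
    (H U : T -> 'M[R]_N) (A O : 'M[R]_N) (th : R -> R) (c : R) : (0 < N)%N ->
  is_GOE P H -> is_eigvec_matrix H U -> continuous th -> O^T *m O = 1%:M ->
  P [set t | forall i, th (quadf A (col i (U t))) <= c] =
  P [set t | forall i, th (quadf (O *m A *m O^T) (col i (U t))) <= c].
Proof.
move=> N0 GOE [mU UU HU] cth OO.
pose X t := symco (H t).
have gX : gaussfam P X by exact: goe_gaussfam GOE.
have tH t : (H t)^T = H t by case: GOE.
have HX t : symmx (X t) = H t by exact: symcoK.
pose E (B : 'M[R]_N) : set (coordT R (symidx N)) :=
  [set x | exists v : 'cV[R]_N, [/\ dot v v = 1,
     exists l, symmx x *m v = l *: v & c < th (quadf B v)]].
have mE B : measurable (E B).
  by apply: measurable_exists_eigvec => // i j; exact: measurable_symmx.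
have mX := iid_measurable gX.
have mXE B : measurable (X @^-1` E B) by rewrite -[X in measurable X]setTI; exact: mX.
pose Nn := [set t | \det (krylov (H t) (const_mx 1)) = 0].
have PN : P Nn = 0%E.
  by rewrite -(simple_ae N0 gX); congr (P _); apply/seteqP; split => t; rewrite /Nn /= HX.
have mN : measurable Nn.
  rewrite -[Nn]setTI; apply: (measurable_det _ measurableT (measurable_set1 0)) => i j.
  by apply: measurable_krylov; case: GOE.
have main B : P [set t | forall i, th (quadf B (col i (U t))) <= c] = P (~` (X @^-1` E B)).
  have mS : measurable [set t | forall i, th (quadf B (col i (U t))) <= c].
    rewrite (_ : [set t | _] = \bigcap_(i in [set: 'I_N])
        ((fun t => th (quadf B (col i (U t)))) @^-1` `]-oo, c])).
      apply: fin_bigcap_measurable => // i _; rewrite -[X in measurable X]setTI.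
      have mth : measurable_fun setT (fun t => th (quadf B (col i (U t)))).
        apply: (measurableT_comp (continuous_measurable_fun cth)).
        apply: (eq_measurable_fun (fun t => \sum_p \sum_q U t p i * B p q * U t q i)).
          move=> t _; rewrite quadfE; apply: eq_bigr => p _; apply: eq_bigr => q _.
          by rewrite !mxE.
        apply: measurable_sum => p; apply: measurable_sum => q.
        by apply: measurable_funM => //; apply: measurable_funM.
      exact: mth.
    apply/seteqP; split => t /= h i; last by have := h i I; rewrite /= in_itv.
    by move=> _; rewrite /= in_itv; exact: h.
  rewrite -(measureU0 mS mN PN) -[RHS](measureU0 _ mN PN); last exact: measurableC.
  congr (P _); rewrite -[LHS]setUC -[RHS]setUC; apply/seteqP.
  have dU t i j : dot (col i (U t)) (col j (U t)) = (i == j)%:R.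
    have := congr1 (fun M : 'M[R]_N => M i j) (UU t); rewrite !mxE => <-.
    by rewrite dotE; apply: eq_bigr => p _; rewrite !mxE.
  split => t /= [nt|St]; (try by left); have [nt|nt] := pselect (Nn t); (try by left); right.
    move=> [v [vv [l Hv] cv]]; rewrite HX in Hv.
    (* Expand v in the columns of [U t]. Those with nonzero coefficient share its eigenvalue [l], so
       two of them would be orthogonal eigenvectors for [l] and the Krylov determinant would vanish.
       Hence v is plus or minus one column. *)
    have vE : v = \sum_i dot (col i (U t)) v *: col i (U t).
      have UU' := mulmx1C (UU t).
      rewrite -[LHS]mul1mx -UU' -mulmxA; apply/colP => p; rewrite mxE summxE.
      apply: eq_bigr => i _; rewrite !mxE mulrC; congr (_ * _).
      by rewrite dotE; apply: eq_bigr => q _; rewrite !mxE.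
    have [i vi] : exists i, dot (col i (U t)) v != 0.
      apply: contrapT => nex; move: vv; rewrite vE big1.
        by rewrite /dot trmx0 mul0mx mxE => /esym/eqP; rewrite oner_eq0.
      move=> i _; have [->|h] := eqVneq (dot (col i (U t)) v) 0; first by rewrite scale0r.
      by case: nex; exists i.
    have li j : dot (col j (U t)) v != 0 -> H t *m col j (U t) = l *: col j (U t).
      move=> vj; have [lj Hj] := HU t j; rewrite Hj; congr (_ *: _).
      have : dot (H t *m col j (U t)) v = l * dot (col j (U t)) v.
        by rewrite dot_mulmx tH Hv dotZr.
      by rewrite Hj dotZl => /(mulIf vj).
    have vj j : j != i -> dot (col j (U t)) v = 0.
      move=> ji; apply/eqP; apply: contrapT => /negP vj; apply: nt.
      have u0 q : col q (U t) != 0.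
        apply/eqP => q0; have := dU t q q; rewrite q0 /dot trmx0 mul0mx mxE eqxx.
        by move=> /esym/eqP; rewrite oner_eq0.
      apply: (det_krylov_degenerate _ (tH t) (li _ vj) (li _ vi)) => //.
      by rewrite dU (negbTE ji).
    have {}vE : v = dot (col i (U t)) v *: col i (U t).
      rewrite {1}vE (bigD1 i)//= big1 ?addr0// => j /vj ->.
      by rewrite scale0r.
    have vi1 : dot (col i (U t)) v ^+ 2 = 1.
      move: vv; rewrite {1 2}vE dotZl dotZr dU eqxx mulr1 expr2 => <-.
      by [].
    have qv : quadf B v = quadf B (col i (U t)).
      rewrite vE quadfE [RHS]quadfE; apply: eq_bigr => p _; apply: eq_bigr => q _.
      set w := dot _ _ in vi1 *; rewrite !mxE -[RHS]mul1r -vi1 expr2; ring.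
    by move: cv; rewrite qv ltNge (St i).
  move=> i; rewrite leNgt; apply/negP => ci; apply: St.
  exists (col i (U t)); split => //; first by rewrite dU eqxx.
  by rewrite HX; exact: HU.
rewrite !main !probability_setC//; congr (_ - _)%E.
have OO' := mulmx1C OO.
have gY : gaussfam P (symconj O^T \o X).
  by apply: gaussfam_symconj => //; rewrite trmxK.
rewrite -(iid_law gY gX (mE A)); congr (P _); apply/seteqP; split => t /=.
  move=> [v [vv [l Hv] cv]]; exists (O *m v); split.
  - by rewrite dot_orth.
  - exists l; move: Hv; rewrite symmx_conj trmxK => Hv.
    by rewrite scalemxAr -Hv !mulmxA OO' mul1mx.
  - by rewrite quadf_conj mulmxA OO mul1mx.
move=> [v [vv [l Hv] cv]]; exists (O^T *m v); split.
- by rewrite dot_orth// trmxK.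
- exists l; rewrite symmx_conj trmxK -!mulmxA (mulmxA O) OO' mul1mx Hv.
  by rewrite -scalemxAr.
- by rewrite -quadf_conj.
Qed.

End goe_simple_spectrum.

(** * Reduction to independent Gaussian rows *)

Section gaussian_rows.
Context (R : realType).
Local Open Scope ereal_scope.

(** The only randomness at hand is that of the given matrices: off-diagonal entries in the first row
    of a GOE matrix of size |I| + 1, rescaled, are independent standard normals. *)
Lemma gauss_exists d (T : measurableType d) (P : probability T R)
    (H : forall N : nat, T -> 'M[R]_N) (I : finType) : (forall N, is_GOE P (H N)) ->
  exists Y : T -> I -> R, gaussfam P Y.
Proof.
move=> GOE; pose n := #|I|.
pose h (i : I) : symidx n.+1 := Sub (ord0, lift ord0 (enum_rank i)) isT.
exists (fun t i => symco (H n.+1 t) (h i)).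
apply: (iid_sub (h := h) _ (goe_gaussfam (GOE n.+1))) => i j.
by move=> /(congr1 (fun p => (val p).2)) /= /lift_inj/enum_rank_inj.
Qed.

(** Rows are split off one at a time: with row [j] drawn from the first factor of [P \x P] and the
    rest from the second, the event is a product set. *)
Lemma iid_rows (mu : probability (measurableTypeR R) R) d (T : measurableType d)
    (P : probability T R) (J K : finType) (X : T -> J * K -> R)
    d' (T' : measurableType d') (P' : probability T' R) (Y : T' -> K -> R)
    (B : set (coordT R K)) (p : R) : iid mu P X -> iid mu P' Y -> measurable B ->
  P' (Y @^-1` B) = p%:E ->
  P [set t | forall j, B (fun k => X t (j, k))] = (p ^+ #|J|)%:E.
Proof.
move=> iX iY mB pB.
have mrow (s : seq J) d1 (T1 : measurableType d1) (X1 : T1 -> J * K -> R) :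
    (forall i, measurable_fun setT (fun t => X1 t i)) ->
    measurable [set t | forall j, j \in s -> B (fun k => X1 t (j, k))].
  move=> mX1; rewrite (_ : [set t | _] = \bigcap_(j in [set j | j \in s])
      ((fun t k => X1 t (j, k)) @^-1` B)) //.
  apply: fin_bigcap_measurable => [|j _]; first exact: finite_seq.
  rewrite -[X in measurable X]setTI.
  have mm : measurable_fun setT ((fun t k => X1 t (j, k)) : T1 -> coordT R K).
    by apply: measurable_coordP => k; exact: mX1.
  exact: mm.
have main (s : seq J) : uniq s ->
    P [set t | forall j, j \in s -> B (fun k => X t (j, k))] = (p ^+ size s)%:E.
  elim: s => [_|j s IH /= /andP[js us]].
    rewrite expr0 -[RHS](@probability_setT _ _ _ P); congr (P _).
    by apply/seteqP; split.
  have iM := iid_mix (fun i : J * K => i.1 == j) iX iX.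
  pose E : set (coordT R (J * K)%type) :=
    [set x | forall j', j' \in j :: s -> B (fun k => x (j', k))].
  have mE : measurable E.
    by apply: (mrow (j :: s) _ (coordT R (J * K)%type) id) => i; exact: measurable_coord.
  apply: (etrans (iid_law iX iM mE)).
  pose E1 := [set t | forall j', j' \in [:: j] -> B (fun k => X t (j', k))].
  pose E2 := [set t | forall j', j' \in s -> B (fun k => X t (j', k))].
  have mE1 : measurable E1 by exact: (mrow [:: j] _ T X iX.1).
  have mE2 : measurable E2 by exact: (mrow s _ T X iX.1).
  transitivity (P E1 * P E2).
    rewrite -(product_measure1E P P mE1 mE2); congr (_ _).
    apply/seteqP; split => [[t u]|[t u]] /=.
      move=> h; split=> j'.
        rewrite inE => /eqP ->; have := h j (mem_head _ _); congr (B _).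
        by apply/funext => k; rewrite /= eqxx.
      move=> j's; have := h j'; rewrite inE j's orbT => /(_ isT); congr (B _).
      apply/funext => k /=; case: eqP => // e; by rewrite -e j's in js.
    move=> [h1 h2] j'; rewrite inE => /predU1P[->|j's].
      have := h1 j (mem_head _ _); congr (B _).
      by apply/funext => k; rewrite /= eqxx.
    have := h2 j' j's; congr (B _).
    apply/funext => k /=; case: eqP => // e; by rewrite -e j's in js.
  rewrite exprS EFinM -IH//; congr (_ * _).
  rewrite -pB.
  have iR := iid_sub (h := fun k : K => (j, k)) (fun _ _ => fun e => congr1 snd e) iX.
  rewrite -(iid_law iR iY mB); congr (P _); apply/seteqP; split => t /=.
    by apply; rewrite mem_head.
  by move=> h j'; rewrite inE => /eqP ->.
have := main (enum J) (enum_uniq _); rewrite -cardE => <-; congr (P _).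
by apply/seteqP; split => t /= h j; [move=> _|]; apply: h; rewrite mem_enum.
Qed.

(** The transpose of [U] acts on each of the k columns of an N x k Gaussian matrix, which is an
    isometry. It is applied with the eigenvector matrix frozen, when averaging over [G] alone. *)
Lemma gaussfam_rotate N k d (T : measurableType d) (P : probability T R)
    (X : T -> 'I_N * 'I_k -> R) (U : 'M[R]_N) : U^T *m U = 1%:M -> gaussfam P X ->
  gaussfam P (fun t p => (\sum_l U l p.1 * X t (l, p.2))%R).
Proof.
move=> UU gX.
pose g (V : 'M[R]_N) (x : 'I_N * 'I_k -> R) (p : 'I_N * 'I_k) : R := (\sum_l V l p.1 * x (l, p.2))%R.
have gV V V' : V' *m V = 1%:M -> forall x, g V (g V' x) = x.
  move=> VV x; apply/funext => -[i j]; rewrite /g/=.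
  under eq_bigr do rewrite mulr_sumr.
  rewrite exchange_big/=.
  transitivity (\sum_l (l == i)%:R * x (l, j))%R; last by rewrite sum_unitvl.
  apply: eq_bigr => l _; under eq_bigr do rewrite mulrA.
  rewrite -mulr_suml; congr (_ * _)%R.
  have := congr1 (fun M : 'M[R]_N => M l i) VV; rewrite !mxE => <-.
  by apply: eq_bigr => q _; rewrite mulrC.
apply: (gaussfam_isometry gX (g := g U) (g' := g U^T)).
- move=> x [i j]; rewrite /g /=.
  rewrite (eq_bigr (fun q => \sum_l U l i * (((l, j) == q)%:R * x q))%R); last first.
    by move=> q _; rewrite mulr_suml; apply: eq_bigr => l _; rewrite /unitv mulrA.
  rewrite exchange_big/=; apply: eq_bigr => l _; rewrite -mulr_sumr; congr (_ * _)%R.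
  by rewrite -[LHS](sum_unitvl x); apply: eq_bigr => q _; rewrite eq_sym.
- exact: gV.
- move=> x.
  have sqp (z : 'I_N * 'I_k -> R) : sq z = (\sum_j \sum_i z (i, j) ^+ 2)%R.
    by rewrite exchange_big pair_big /sq /=; apply: eq_bigr => -[i j] _.
  rewrite !sqp; apply: eq_bigr => j _.
  pose y : 'cV[R]_N := \col_l x (l, j).
  transitivity (dot (U^T *m y) (U^T *m y)).
    rewrite dotE; apply: eq_bigr => i _; rewrite /g /= expr2.
    have -> : (U^T *m y) i 0%R = (\sum_l U l i * x (l, j))%R.
      by rewrite mxE; apply: eq_bigr => l _; rewrite !mxE.
    by [].
  rewrite dot_orth ?trmxK; last exact: mulmx1C.
  by rewrite dotE; apply: eq_bigr => i _; rewrite !mxE expr2.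
Qed.

End gaussian_rows.

Section sandwich.
Context (R : realType) (k : nat) (a : 'I_k -> R).

Definition qform (y : 'I_k -> R) : R := \sum_j a j * y j ^+ 2.

Definition bad_gram N (e : R) (x : 'I_N * 'I_k -> R) : Prop :=
  exists i j : 'I_k, e < `|(\sum_l x (l, i) * x (l, j)) / N%:R - (i == j)%:R|.

Lemma measurable_bad_gram N e :
  measurable ([set x | bad_gram e x] : set (coordT R ('I_N * 'I_k)%type)).
Proof.
rewrite (_ : [set x | _] = \bigcup_(ij in [set: 'I_k * 'I_k])
   [set x : coordT R ('I_N * 'I_k)%type |
     e < `|(\sum_l x (l, ij.1) * x (l, ij.2)) / N%:R - (ij.1 == ij.2)%:R|]); last first.
  apply/seteqP; split => x; first by move=> [i [j h]]; exists (i, j).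
  by move=> [[i j] _ h]; exists i, j.
apply: fin_bigcup_measurable => // -[i j] _ /=.
have mf : measurable_fun setT (fun x : coordT R ('I_N * 'I_k)%type =>
    `|(\sum_l x (l, i) * x (l, j)) / N%:R - (i == j)%:R|).
  apply: measurableT_comp => //; apply: measurable_funB => //.
  apply: measurable_funM => //; apply: measurable_sum => l.
  by apply: measurable_funM; exact: measurable_coord.
rewrite -[X in measurable X]setTI.
have := mf measurableT _ (@measurable_itv R `]e, +oo[).
by congr (measurable (_ `&` _)); apply/seteqP; split => x /=; rewrite in_itv/= andbT.
Qed.

Local Open Scope ereal_scope.

(* Comparing the fixed matrix A with the random frame spanned by an independent
   Gaussian N x k matrix G: conditionally on G the probability is that for A,
   while conditionally on U the rows of U^T G are iid Gaussian vectors. *)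
Lemma frame_sandwich : exists C e0 : R, [/\ (0 < C)%R, (0 < e0)%R &
  forall d (T : measurableType d) (P : probability T R) (N : nat)
    (A : 'M[R]_N) (H U : T -> 'M[R]_N) (th : R -> R) (c e : R)
    (Y : T -> 'I_k -> R) (G : T -> 'I_N * 'I_k -> R) (B1 B2 : set (coordT R 'I_k)) (p1 p2 : R),
  (0 < N)%N -> (k <= N)%N -> A^T = A ->
  char_poly A = ((\prod_(i < k) ('X - (a i)%:P)) * 'X^(N - k))%R ->
  is_GOE P H -> is_eigvec_matrix H U -> continuous th ->
  gaussfam P Y -> gaussfam P G -> (0 <= e <= e0)%R ->
  measurable B1 -> measurable B2 ->
  (forall y q, B1 y -> `|q - qform y| <= C * e * sq y -> th (q / N%:R) <= c)%R ->
  (forall y q, `|q - qform y| <= C * e * sq y -> th (q / N%:R) <= c -> B2 y)%R ->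
  P (Y @^-1` B1) = p1%:E -> P (Y @^-1` B2) = p2%:E ->
  (p1 ^+ N)%:E <= P [set t | (forall i, th (quadf A (col i (U t))) <= c)%R] +
                  P [set s | bad_gram e (G s)] /\
  P [set t | (forall i, th (quadf A (col i (U t))) <= c)%R] <=
    (p2 ^+ N)%:E + P [set s | bad_gram e (G s)] ].
Proof.
have [C [e0 [C0 e00 Hcmp]]] := frame_comparison a.
exists C, e0; split => // d T P N A H U th c e Y G B1 B2 p1 p2 N0 kN tA chA GOE EV cth gY gG.
move=> ee mB1 mB2 B1P B2P p1E p2E.
have [W0 [WW0 AE]] := frame_decomposition kN tA chA.
set pA := P [set t | _].
have mU i j : measurable_fun setT (fun t => U t i j) by case: EV.
have UU t : (U t)^T *m U t = 1%:M by case: EV.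
pose D := diag_mx (\row_i a i).
pose Gm s : 'M[R]_(N, k) := \matrix_(l, j) G s (l, j).
pose row (z : T * T) (i : 'I_N) : 'I_k -> R := fun j => (\sum_l U z.1 l i * G z.2 (l, j))%R.
have rowE t s i j : row (t, s) i j = ((Gm s)^T *m col i (U t)) j 0%R.
  by rewrite mxE; apply: eq_bigr => l _; rewrite !mxE mulrC.
have N0R : (0 < N%:R :> R)%R by rewrite ltr0n.
have good s : ~ bad_gram e (G s) -> exists W : 'M[R]_(N, k), W^T *m W = 1%:M /\
    forall t i, (`|N%:R * quadf (W *m D *m W^T) (col i (U t)) - qform (row (t, s) i)| <=
      C * e * sq (row (t, s) i))%R.
  move=> gs; have [|W [WW WP]] := Hcmp N N%:R e (Gm s) N0R ee.
    move=> i j; rewrite leNgt; apply/negP => bad; apply: gs; exists i, j.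
    move: bad; congr (_ < `|_ / _ - _|)%R.
    by rewrite mxE; apply: eq_bigr => l _; rewrite !mxE.
  exists W; split => // t i; have := WP (col i (U t)).
  have -> : qform (row (t, s) i) = (\sum_j a j * ((Gm s)^T *m col i (U t)) j 0 ^+ 2)%R.
    by apply: eq_bigr => j _; rewrite rowE.
  have -> // : sq (row (t, s) i) = (\sum_j ((Gm s)^T *m col i (U t)) j 0 ^+ 2)%R.
  by apply: eq_bigr => j _; rewrite rowE.
(* Two orthonormal k-frames are related by some orthogonal O, so by conjugation invariance the frame
   of [A] can be exchanged for any other, in particular for one that depends on the sample s of
   [G]. *)
have inv (W : 'M[R]_(N, k)) : W^T *m W = 1%:M ->
    pA = P [set t | (forall i, th (quadf (W *m D *m W^T) (col i (U t))) <= c)%R].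
  move=> WW; have [|O [OO OW]] := @frame_transport R N k W0 W; first by rewrite WW0 WW.
  rewrite /pA (goe_conj_invariant A c N0 GOE EV cth OO); congr (P _).
  suff -> : O *m A *m O^T = W *m D *m W^T by [].
  by rewrite AE -OW trmx_mul !mulmxA.
pose E (B : set (coordT R 'I_k)) := [set z : T * T | forall i, B (row z i)].
have mE B : measurable B -> measurable (E B).
  move=> mB; rewrite (_ : E B = \bigcap_(i in [set: 'I_N]) ((fun z => row z i) @^-1` B)); last first.
    by apply/seteqP; split => z /= h i; [move=> _|]; exact: h.
  apply: fin_bigcap_measurable => // i _; rewrite -[X in measurable X]setTI.
  have mr : measurable_fun setT ((fun z => row z i) : T * T -> coordT R 'I_k).
    apply: measurable_coordP => j; apply: measurable_sum => l; apply: measurable_funM.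
      exact: (measurableT_comp (mU l i) measurable_fst).
    exact: (measurableT_comp (gG.1 (l, j)) measurable_snd).
  exact: mr.
pose sec (B : set (coordT R 'I_k)) s := P [set t | E B (t, s)].
have secE (B : set (coordT R 'I_k)) p : measurable B -> P (Y @^-1` B) = p%:E -> \int[P]_s sec B s = (p ^+ N)%:E.
  move=> mB pE.
  have mf : measurable_fun setT (fun z : T * T => (\1_(E B) z)%:E : \bar R).
    by apply/measurable_EFinP; exact: measurable_indic (mE _ mB).
  have f0 z : (0 <= (\1_(E B) z : R)%:E)%E by rewrite lee_fin.
  have := @fubini_tonelli _ _ _ _ R P P _ mf f0.
  move=> fub.
  transitivity (\int[P]_s \int[P]_t (\1_(E B) (t, s))%:E).
    apply: eq_integral => s _; rewrite /sec.
    have ms : measurable [set t | E B (t, s)].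
      have := measurable_ysection s (mE _ mB); congr measurable.
      by rewrite ysectionE; apply/seteqP; split.
    by rewrite -[X in P X]setIT -integral_indic//.
  rewrite -fub.
  transitivity (\int[P]_t (p ^+ N)%:E); last first.
    by rewrite integral_cst//; apply: (etrans (y := (p ^+ N)%:E * 1)); [congr (_ * _); exact: probability_setT|rewrite mule1].
  apply: eq_integral => t _.
  have ms : measurable [set s | E B (t, s)].
    have := measurable_xsection t (mE _ mB); congr measurable.
    by rewrite xsectionE; apply/seteqP; split.
  transitivity (P [set s | E B (t, s)]).
    by rewrite -[X in P X]setIT -integral_indic//.
  have gR := gaussfam_rotate (UU t) gG.
  have := iid_rows gR gY mB pE; rewrite card_ord => <-; congr (P _).
have mbad : measurable [set s | bad_gram e (G s)].
  have := iid_measurable gG measurableT (@measurable_bad_gram N e); rewrite setTI.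
  exact.
have mEs (B : set (coordT R 'I_k)) s : measurable B -> measurable [set t | E B (t, s)].
  move=> mB; have := measurable_ysection s (mE _ mB); congr measurable.
  by rewrite ysectionE; apply/seteqP; split.
have msec (B : set (coordT R 'I_k)) : measurable B -> measurable_fun setT (sec B).
  move=> mB; have := measurable_fun_ysection P (mE _ mB).
  apply: eq_measurable_fun => s _; rewrite /sec /=; congr (P _).
  by rewrite ysectionE; apply/seteqP; split.
have mS (M : 'M[R]_N) : measurable [set t | (forall i, th (quadf M (col i (U t))) <= c)%R].
  rewrite (_ : [set t | _] = \bigcap_(i in [set: 'I_N])
      ((fun t => th (quadf M (col i (U t)))) @^-1` `]-oo, c])).
    apply: fin_bigcap_measurable => // i _; rewrite -[X in measurable X]setTI.
    have mth : measurable_fun setT (fun t => th (quadf M (col i (U t)))).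
      apply: (measurableT_comp (continuous_measurable_fun cth)).
      apply: (eq_measurable_fun (fun t => \sum_p \sum_q U t p i * M p q * U t q i)%R).
        move=> t _; rewrite quadfE; apply: eq_bigr => p _; apply: eq_bigr => q _.
        by rewrite !mxE.
      apply: measurable_sum => p; apply: measurable_sum => q.
      by apply: measurable_funM => //; apply: measurable_funM.
    exact: mth.
  apply/seteqP; split => t /= h i; last by have := h i I; rewrite /= in_itv.
  by move=> _; rewrite /= in_itv; exact: h.
have mind : measurable_fun setT (fun s => (\1_[set s | bad_gram e (G s)] s)%:E : \bar R).
  by apply/measurable_EFinP; exact: measurable_indic.
have Ibad : \int[P]_s (\1_[set s | bad_gram e (G s)] s)%:E = P [set s | bad_gram e (G s)].
  by rewrite integral_indic// setIT.
have I1 (x : \bar R) : 0 <= x -> \int[P]_s cst x s = x.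
  move=> x0; rewrite integral_cst//; apply: (etrans (y := x * 1)); last by rewrite mule1.
  by congr (_ * _); exact: probability_setT.
split.
- rewrite -(secE _ _ mB1 p1E) -Ibad -[pA]I1 ?measure_ge0// -ge0_integralD//.
  apply: ge0_le_integral => //.
  + exact: msec.
  + by apply: emeasurable_funD => //; exact: measurable_cst.
  (* On bad samples the indicator alone is at least the probability on the left; on good ones the
     frame built from [G s] gives an inclusion of events. *)
  move=> s _; rewrite indicE.
  have [bad|gs] := pselect (bad_gram e (G s)).
    by rewrite mem_set//=; apply: (le_trans (probability_le1 _ (mEs _ _ mB1))); rewrite leeDr// measure_ge0.
  rewrite memNset//= adde0; have [W [WW WP]] := good _ gs.
  rewrite (inv _ WW); apply: le_measure; rewrite ?inE//; first exact: mEs.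
  move=> t /= Et i; have := B1P _ _ (Et i) (WP t i).
  by rewrite mulrAC divff ?mul1r// gt_eqF.
- rewrite -(secE _ _ mB2 p2E) -Ibad -[leLHS]I1 ?measure_ge0// -ge0_integralD//; last exact: msec.
  apply: ge0_le_integral => //.
  + by apply: emeasurable_funD => //; exact: msec.
  move=> s _; rewrite indicE.
  have [bad|gs] := pselect (bad_gram e (G s)).
    by rewrite mem_set//=; apply: (le_trans (probability_le1 _ (mS _))); rewrite leeDr// measure_ge0.
  rewrite memNset//= adde0; have [W [WW WP]] := good _ gs.
  rewrite (inv _ WW); apply: le_measure; rewrite ?inE//; first exact: mEs.
  move=> t /= Et i; apply: (B2P _ _ (WP t i)).
  by rewrite mulrAC divff ?mul1r// gt_eqF.
Qed.

End sandwich.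

(** * Gaussian quadratic forms: concentration, tails and small balls *)

Section concentration.
Context (R : realType).

Lemma gauss_exp_moment d (T : measurableType d) (P : probability T R) (I : finType)
    (X : T -> I -> R) (c : I -> R) : gaussfam P X -> (forall i, 0 < c i) ->
  (\int[P]_t (expR (\sum_i X t i ^+ 2 / 2 * (1 - (c i)^-2)))%:E = (\prod_i c i)%:E)%E.
Proof.
move=> gX c0.
have := gauss_tilt gX c0 (measurable_cst (1%E : \bar R)) (fun=> lee01).
under [X in _ = (_ * X)%E -> _]eq_integral do rewrite mul1e.
pose J := (\int[P]_t (expR (\sum_i X t i ^+ 2 / 2 * (1 - (c i)^-2)))%:E)%E; rewrite -/J => h.
have I1 : (\int[P]_t (cst 1 t) = 1)%E by rewrite integral_cst// mul1e; exact: probability_setT.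
have {}h : (1 = (\prod_i c i)^-1%:E * J)%E := etrans (esym I1) h.
have p0 : \prod_i c i != 0 by rewrite gt_eqF// prodr_gt0.
by rewrite -[LHS]mul1e -[X in (X * _)%E](congr1 EFin (divff p0)) EFinM -muleA -h mule1.
Qed.

(** Exponential Markov inequality. For c > 1 the factor 1 - c^-2 is positive and this is an upper
    tail; for c < 1 it is negative and the same statement is a lower tail. *)
Lemma sq_chernoff d (T : measurableType d) (P : probability T R) (I : finType)
    (X : T -> I -> R) (c th : R) : gaussfam P X -> 0 < c ->
  (P [set t | (th <= sq (X t) / 2 * (1 - c^-2))%R] <= (expR (- th) * c ^+ #|I|)%:E)%E.
Proof.
move=> gX c0.
have E t : \sum_i X t i ^+ 2 / 2 * (1 - c^-2) = sq (X t) / 2 * (1 - c^-2).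
  by rewrite /sq !mulr_suml.
have msq : measurable_fun setT (fun t => sq (X t) / 2 * (1 - c^-2)).
  apply: measurable_funM => //; apply: measurable_funM => //.
  exact: (measurableT_comp (@measurable_sq R I) (iid_measurable gX)).
have mA : measurable [set t | th <= sq (X t) / 2 * (1 - c^-2)].
  rewrite -[X in measurable X]setTI.
  have := msq measurableT _ (@measurable_itv R `[th, +oo[).
  by congr (measurable (_ `&` _)); apply/seteqP; split => x /=; rewrite in_itv/= andbT.
have mexp : measurable_fun setT (fun t => (expR (sq (X t) / 2 * (1 - c^-2)))%:E).
  by apply/measurable_EFinP; apply: measurableT_comp.
apply: (@le_trans _ _ (\int[P]_t ((expR (- th))%:E * (expR (sq (X t) / 2 * (1 - c^-2)))%:E))%E).
  rewrite -[X in (P X <= _)%E]setIT -integral_indic//.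
  apply: ge0_le_integral => //.
  - by apply/measurable_EFinP; exact: measurable_indic.
  - by apply: emeasurable_funM.
  move=> t _; rewrite -EFinM -expRD lee_fin indicE.
  have [h|h] := pselect (th <= sq (X t) / 2 * (1 - c^-2)).
    by rewrite mem_set//= -[leLHS]expR0 ler_expR addrC subr_ge0.
  by rewrite memNset//= expR_ge0.
have eth : (0 <= (expR (- th))%:E)%E by rewrite lee_fin expR_ge0.
have e0 t : setT t -> (0 <= (expR (sq (X t) / 2 * (1 - c^-2)))%:E)%E.
  by rewrite lee_fin expR_ge0.
rewrite (ge0_integralZl P measurableT mexp e0 eth).
rewrite EFinM lee_wpmul2l//.
have := gauss_exp_moment gX (fun=> c0); rewrite prodr_const => <-.
by rewrite le_eqVlt; apply/orP; left; apply/eqP; apply: eq_integral => t _; rewrite E.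
Qed.

Lemma expRN_ub (x : R) : 0 <= x -> expR (- x) <= 1 - x + x ^+ 2.
Proof.
move=> x0; rewrite expRN -div1r ler_pdivrMr ?expR_gt0//.
have := expR_ge1Dx x; have : 0 <= 1 - x + x ^+ 2 by nra.
by nra.
Qed.

Lemma expR_ub (x : R) : 0 <= x <= 2^-1 -> expR x <= 1 + x + 2 * x ^+ 2.
Proof.
move=> /andP[x0 x1]; rewrite -[x in expR x]opprK expRN -div1r ler_pdivrMr ?expR_gt0//.
have := expR_ge1Dx (- x); have : 0 <= 1 + x + 2 * x ^+ 2 by nra.
by nra.
Qed.

Lemma sq_concentration d (T : measurableType d) (P : probability T R) (I : finType)
    (X : T -> I -> R) (e : R) : gaussfam P X -> 0 < e <= 1 -> (0 < #|I|)%N ->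
  (P [set t | (e < `|sq (X t) / #|I|%:R - 1|)%R ] <=
   (2 * expR (- (#|I|%:R * e ^+ 2 / 16)))%:E)%E.
Proof.
move=> gX /andP[e0 e1] I0; set n := #|I|%:R.
have n0 : 0 < n :> R by rewrite ltr0n.
have msq : measurable_fun setT (fun t => sq (X t)).
  exact: (measurableT_comp (@measurable_sq R I) (iid_measurable gX)).
have mE (c th : R) : measurable [set t | th <= sq (X t) / 2 * (1 - c^-2)].
  rewrite -[X in measurable X]setTI.
  have m' : measurable_fun setT (fun t => sq (X t) / 2 * (1 - c^-2)).
    by apply: measurable_funM => //; apply: measurable_funM.
  have := m' measurableT _ (@measurable_itv R `[th, +oo[).
  by congr (measurable (_ `&` _)); apply/seteqP; split => x /=; rewrite in_itv/= andbT.
(* With c = exp(g) and c = exp(-g) the two Chernoff exponents per coordinate are at most -3e^2/32 +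
   e^3/32 and -e^2/16 - e^3/16, both at most -e^2/16 for 0 < e <= 1. This is the origin of the
   16. *)
pose g := e / 8.
have g0 : 0 < g by rewrite divr_gt0.
pose c1 := expR g; pose th1 := n * (1 + e) / 2 * (1 - c1^-2).
pose c2 := expR (- g); pose th2 := n * (1 - e) / 2 * (1 - c2^-2).
have c1E : c1^-2 = expR (- (2 * g)) by rewrite /c1 -expRM_natl expRN.
have c2E : c2^-2 = expR (2 * g) by rewrite /c2 -expRM_natl mulrN expRN invrK.
have u1 : 2 * g - 4 * g ^+ 2 <= 1 - c1^-2.
  rewrite c1E; have := @expRN_ub (2 * g); rewrite exprMn.
  have -> : 0 <= 2 * g by rewrite mulr_ge0// ltW.
  by move=> /(_ isT); lra.
have u2 : c2^-2 - 1 <= 2 * g + 8 * g ^+ 2.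
  rewrite c2E; have := @expR_ub (2 * g); rewrite exprMn.
  have -> : 0 <= 2 * g <= 2^-1 by apply/andP; split; rewrite /g; lra.
  by move=> /(_ isT); lra.
have c2ge : 0 <= c2^-2 - 1.
  by rewrite c2E; have := expR_ge1Dx (2 * g); lra.
have cn (x : R) : expR x ^+ #|I| = expR (n * x) by rewrite expRM_natl.
have b1 : expR (- th1) * c1 ^+ #|I| <= expR (- (n * e ^+ 2 / 16)).
  rewrite /c1 cn -expRD ler_expR /th1.
  have h : (1 + e) / 2 * (2 * g - 4 * g ^+ 2) <= (1 + e) / 2 * (1 - c1^-2).
    by apply: ler_wpM2l => //; lra.
  have : - ((1 + e) / 2 * (1 - c1^-2)) + g <= - (e ^+ 2 / 16).
    have : e * e <= 1 * e by rewrite ler_wpM2r// ltW.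
    move: h; rewrite /g; nra.
  move=> h'; have := ler_wpM2l (ltW n0) h'; set w := c1^-2.
  have -> : - (n * (1 + e) / 2 * (1 - w)) + n * g = n * (- ((1 + e) / 2 * (1 - w)) + g).
    by field.
  by have -> : - (n * e ^+ 2 / 16) = n * - (e ^+ 2 / 16) by field.
have b2 : expR (- th2) * c2 ^+ #|I| <= expR (- (n * e ^+ 2 / 16)).
  rewrite /c2 cn -expRD ler_expR /th2.
  have h : (1 - e) / 2 * (c2^-2 - 1) <= (1 - e) / 2 * (2 * g + 8 * g ^+ 2).
    by apply: ler_wpM2l => //; lra.
  have : - ((1 - e) / 2 * (1 - c2^-2)) - g <= - (e ^+ 2 / 16).
    move: h; rewrite /g; nra.
  move=> h'; have := ler_wpM2l (ltW n0) h'; set w := c2^-2.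
  have -> : - (n * (1 - e) / 2 * (1 - w)) + n * - g = n * (- ((1 - e) / 2 * (1 - w)) - g).
    by field.
  by have -> : - (n * e ^+ 2 / 16) = n * - (e ^+ 2 / 16) by field.
have sub : [set t | e < `|sq (X t) / n - 1| ] `<=`
    [set t | th1 <= sq (X t) / 2 * (1 - c1^-2)] `|`
    [set t | th2 <= sq (X t) / 2 * (1 - c2^-2)].
  move=> t /=; rewrite ltr_normr => /orP[h|h]; [left|right].
    have : n * (1 + e) <= sq (X t).
      by rewrite mulrC -ler_pdivlMr//; lra.
    have c1ge : 0 <= 1 - c1^-2 by apply: le_trans u1; move: g0 e1; rewrite /g; nra.
    by move=> h'; rewrite /th1; apply: ler_wpM2r => //; rewrite ler_wpM2r.
  have : sq (X t) <= n * (1 - e).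
    by rewrite mulrC -ler_pdivrMr//; lra.
  move=> h'; rewrite /th2 -lerN2 -!mulrN opprB; apply: ler_wpM2r => //.
  by rewrite ler_wpM2r.
have mS : measurable [set t | e < `|sq (X t) / n - 1| ].
  rewrite -[X in measurable X]setTI.
  have m' : measurable_fun setT (fun t => `|sq (X t) / n - 1|).
    by apply: measurableT_comp => //; apply: measurable_funB => //; apply: measurable_funM.
  have := m' measurableT _ (@measurable_itv R `]e, +oo[).
  by congr (measurable (_ `&` _)); apply/seteqP; split => x /=; rewrite in_itv/= andbT.
apply: (le_trans (le_measure _ _ _ sub)); rewrite ?inE//; first exact: measurableU.
apply: (le_trans (measureU2 _ (mE _ _) (mE _ _))).
rewrite mulr_natl mulr2n EFinD; apply: leeD.
  by apply: (le_trans (sq_chernoff _ gX (expR_gt0 g))); rewrite lee_fin.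
by apply: (le_trans (sq_chernoff _ gX (expR_gt0 (- g)))); rewrite lee_fin.
Qed.

End concentration.

Section gram_concentration.
Context (R : realType).

(** A rotation of R^k sending the first basis vector to v turns the combination of columns into a
    single column of N standard normals. *)
Lemma direction_concentration d (T : measurableType d) (P : probability T R) N k
    (G : T -> 'I_N * 'I_k -> R) (e : R) (v : 'cV[R]_k) : gaussfam P G -> 0 < e <= 1 ->
  (0 < N)%N -> dot v v = 1 ->
  (P [set t | (e < `|(\sum_l (\sum_q v q 0%R * G t (l, q)) ^+ 2) / N%:R - 1|)%R] <=
   (2 * expR (- (N%:R * e ^+ 2 / 16)))%:E)%E.
Proof.
move=> gG e01 N0 vv.
case: k v vv G gG => [|k] v vv G gG.
  by move: vv; rewrite dotE big_ord0 => /esym/eqP; rewrite oner_eq0.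
have [V [VV Vv _]] : exists O : 'M[R]_k.+1, [/\ O^T *m O = 1%:M, O *m delta_mx 0 0 = v &
    forall w, dot w (delta_mx 0 0) = dot w v -> O *m w = w].
  apply: reflection; rewrite vv dotE (bigD1 0)//= big1 ?addr0 ?mxE ?eqxx ?mulr1//.
  by move=> i i0; rewrite !mxE (negbTE i0) mul0r.
have gS : gaussfam P (fun t (p : 'I_k.+1 * 'I_N) => G t (p.2, p.1)).
  by apply: (iid_sub (h := fun p : 'I_k.+1 * 'I_N => (p.2, p.1)) _ gG) => -[a b] [c d'] /= [-> ->].
have gR := iid_sub (h := fun l : 'I_N => (ord0 : 'I_k.+1, l)) (fun _ _ e => congr1 snd e) (gaussfam_rotate VV gS).
have := sq_concentration gR e01; rewrite card_ord => /(_ N0); congr (P _ <= _)%E.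
apply/funext => t /=; congr (is_true (_ < `|_ / _ - _|)).
apply: eq_bigr => l _; congr (_ ^+ _); apply: eq_bigr => q _; congr (_ * _).
by rewrite -Vv -colE mxE.
Qed.

(** Diagonal entries are the case of a basis vector. Off-diagonal ones follow by polarisation from
    the unit vectors (e_i + e_j)/sqrt 2 and (e_i - e_j)/sqrt 2, whence 4 = 2 + 2 exponentials per
    entry; a union bound runs over the k^2 entries. *)
Lemma bad_gram_bound d (T : measurableType d) (P : probability T R) N k
    (G : T -> 'I_N * 'I_k -> R) (e : R) : gaussfam P G -> 0 < e <= 1 -> (0 < N)%N ->
  (P [set t | bad_gram e (G t)] <=
   ((k * k)%:R * (4 * expR (- (N%:R * e ^+ 2 / 16))))%:E)%E.
Proof.
move=> gG e01 N0; set b := expR _.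
have b0 : 0 <= b by exact: expR_ge0.
pose S i j := [set t | (e < `|(\sum_l G t (l, i) * G t (l, j)) / N%:R - (i == j)%:R|)%R].
have mlt (f : T -> R) : measurable_fun setT f -> measurable [set t | e < `|f t / N%:R - 1| ].
  move=> mf; rewrite -[X in measurable X]setTI.
  have m' : measurable_fun setT (fun t => `|f t / N%:R - 1|).
    by apply: measurableT_comp => //; apply: measurable_funB => //; apply: measurable_funM.
  have := m' measurableT _ (@measurable_itv R `]e, +oo[).
  by congr (measurable (_ `&` _)); apply/seteqP; split => x /=; rewrite in_itv/= andbT.
have mS i j : measurable (S i j).
  rewrite -[X in measurable X]setTI.
  have m' : measurable_fun setT (fun t => `|(\sum_l G t (l, i) * G t (l, j)) / N%:R - (i == j)%:R|).
    apply: measurableT_comp => //; apply: measurable_funB => //; apply: measurable_funM => //.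
    by apply: measurable_sum => l; apply: measurable_funM; exact: gG.1.
  have := m' measurableT _ (@measurable_itv R `]e, +oo[).
  by congr (measurable (_ `&` _)); apply/seteqP; split => x /=; rewrite in_itv/= andbT.
pose D (v : 'cV[R]_k) t := \sum_l (\sum_q v q 0%R * G t (l, q)) ^+ 2.
have mD v : measurable_fun setT (D v).
  apply: measurable_sum => l; apply: measurable_funX; apply: measurable_sum => q.
  by apply: measurable_funM => //; exact: gG.1.
have SP i j : (P (S i j) <= (4 * b)%:E)%E.
  have dlt (x y : 'I_k) : dot (delta_mx x 0) (delta_mx y 0) = (x == y)%:R :> R.
    rewrite dotE (bigD1 x)//= big1 ?addr0 ?mxE ?eqxx ?mul1r ?andbT//.
    by move=> i' i0; rewrite !mxE (negbTE i0) mul0r.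
  have sdel (x : 'I_k) t l : \sum_q (delta_mx x 0 : 'cV[R]_k) q 0 * G t (l, q) = G t (l, x).
    by rewrite -[RHS](sum_unitvl (fun q => G t (l, q))); apply: eq_bigr => q _; rewrite mxE eqxx andbT.
  have [->|ij] := eqVneq i j.
    have h := direction_concentration (v := delta_mx j 0) gG e01 N0.
    apply: (@le_trans _ _ ((2 * b)%:E)%E); last by rewrite lee_fin; lra.
    move: h; rewrite dlt eqxx => /(_ erefl); apply: le_trans.
    rewrite le_eqVlt; apply/orP; left; apply/eqP; congr (P _).
    apply/funext => t /=; rewrite /S /= eqxx; congr (is_true (_ < `|_ / _ - _|)).
    by apply: eq_bigr => l _; rewrite sdel expr2.
  have ji : (j == i) = false by rewrite eq_sym (negbTE ij).
  pose r : R := (Num.sqrt 2)^-1.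
  have r2 : r * r = 2^-1 by rewrite /r -invfM -expr2 sqr_sqrtr.
  pose vp : 'cV[R]_k := r *: (delta_mx i 0 + delta_mx j 0).
  pose vm : 'cV[R]_k := r *: (delta_mx i 0 - delta_mx j 0).
  have dadd (x y z : 'cV[R]_k) : dot z (x + y) = dot z x + dot z y.
    by rewrite /dot mulmxDr mxE.
  have vmE : dot vm vm = 1.
    rewrite /vm dotZl dotZr mulrA r2 !dotBl !dotBr !dlt !eqxx ji (negbTE ij) /= ?mulr0n ?mulr1n.
    by field.
  have vpE : dot vp vp = 1.
    rewrite /vp dotZl dotZr mulrA r2 !dadd !(dotC (_ + _)) !dadd !dlt !eqxx ji (negbTE ij) /= ?mulr0n ?mulr1n.
    by field.
  have DE t : \sum_l G t (l, i) * G t (l, j) = 2^-1 * D vp t - 2^-1 * D vm t.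
    rewrite /D !mulr_sumr -sumrB; apply: eq_bigr => l _.
    have -> : \sum_q vp q 0 * G t (l, q) = r * (G t (l, i) + G t (l, j)).
      rewrite -!sdel -big_split/= mulr_sumr; apply: eq_bigr => q _.
      by rewrite !mxE; ring.
    have -> : \sum_q vm q 0 * G t (l, q) = r * (G t (l, i) - G t (l, j)).
      rewrite -!sdel -sumrB/= mulr_sumr; apply: eq_bigr => q _.
      by rewrite !mxE; ring.
    by rewrite !exprMn (expr2 r) r2; field.
  have sub : S i j `<=` [set t | e < `|D vp t / N%:R - 1| ] `|` [set t | e < `|D vm t / N%:R - 1| ].
    move=> t; rewrite /S /= (negbTE ij) subr0 DE => h.
    apply: contrapT => /not_orP[/negP + /negP]; rewrite -!leNgt => h1 h2.
    move: h; rewrite ltNge => /negP; apply.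
    have -> : (2^-1 * D vp t - 2^-1 * D vm t) / N%:R =
      2^-1 * (D vp t / N%:R - 1) - 2^-1 * (D vm t / N%:R - 1) by ring.
    apply: (le_trans (ler_normB _ _)); rewrite !normrM gtr0_norm ?invr_gt0//.
    lra.
  apply: (le_trans (le_measure _ _ _ sub)); rewrite ?inE//; first by apply: measurableU; exact: mlt.
  apply: (le_trans (measureU2 _ (mlt _ (mD _)) (mlt _ (mD _)))).
  have -> : (4 * b)%:E = ((2 * b)%:E + (2 * b)%:E)%E by rewrite -EFinD; congr EFin; ring.
  by apply: leeD; exact: direction_concentration.
have mbad : measurable [set t | bad_gram e (G t)].
  have := iid_measurable gG measurableT (@measurable_bad_gram R k N e); rewrite setTI.
  exact.
apply: (@le_trans _ _ (\sum_(p : 'I_k * 'I_k) P (S p.1 p.2))%E).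
  have mU (s : seq ('I_k * 'I_k)) : measurable (\big[setU/set0]_(p <- s) S p.1 p.2).
    by apply: bigsetU_measurable.
  have ub (s : seq ('I_k * 'I_k)) :
      (P (\big[setU/set0]_(p <- s) S p.1 p.2) <= \sum_(p <- s) P (S p.1 p.2))%E.
    elim: s => [|p s IH]; first by rewrite !big_nil measure0.
    rewrite !big_cons; apply: (le_trans (measureU2 _ (mS _ _) (mU _))).
    exact: leeD.
  apply: le_trans (ub _); apply: le_measure; rewrite ?inE//.
  move=> t [i [j h]]; rewrite -bigcup_seq; exists (i, j) => //.
  by rewrite /= mem_index_enum.
apply: (@le_trans _ _ (\sum_(p : 'I_k * 'I_k) (4 * b)%:E)%E).
  by apply: lee_sum => p _; exact: SP.
by rewrite sumEFin sumr_const card_prod !card_ord -[X in (X%:E <= _)%E]mulr_natl lexx.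
Qed.

End gram_concentration.

(** * Density of half a chi-square from the homogeneity of balls *)

Section chi_square_law.
Context (R : realType).
Local Notation leb := (@lebesgue_measure R).

Lemma ge0_integralZR d (T : measurableType d) (mu : {measure set T -> \bar R}) (k : R)
    (f : T -> R) : measurable_fun setT f -> (forall x, 0 <= f x) -> 0 <= k ->
  (\int[mu]_x (k * f x)%:E = k%:E * \int[mu]_x (f x)%:E)%E.
Proof.
move=> mf f0 k0.
have mE : measurable_fun setT (fun x => (f x)%:E) by exact/measurable_EFinP.
have fE x : setT x -> (0 <= (f x)%:E)%E by rewrite lee_fin.
have kE : (0 <= k%:E)%E by rewrite lee_fin.
by rewrite -(ge0_integralZl mu measurableT mE fE kE).
Qed.

Lemma measurable_le_ind d (T : measurableType d) (f g : T -> R) :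
  measurable_fun setT f -> measurable_fun setT g ->
  measurable_fun setT (fun x => (f x <= g x)%R%:R : R).
Proof.
move=> mf mg; apply: (eq_measurable_fun (fun x => if f x <= g x then (1 : R) else 0)).
  by move=> x _; case: ifP.
by apply: measurable_fun_ifT => //; exact: measurable_fun_ler.
Qed.

Lemma measurable_lt_ind d (T : measurableType d) (f g : T -> R) :
  measurable_fun setT f -> measurable_fun setT g ->
  measurable_fun setT (fun x => (f x < g x)%R%:R : R).
Proof.
move=> mf mg; apply: (eq_measurable_fun (fun x => if f x < g x then (1 : R) else 0)).
  by move=> x _; case: ifP.
by apply: measurable_fun_ifT => //; exact: measurable_fun_ltr.
Qed.

Lemma integral_prop d (T : measurableType d) (P : probability T R) (b : T -> bool) :
  measurable [set t | b t] -> (\int[P]_t ((b t)%:R : R)%:E = P [set t | b t])%E.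
Proof.
move=> mb; rewrite -[in RHS](setIT [set t | b t]) -integral_indic//.
apply: eq_integral => t _; rewrite indicE; congr ((_ %:R)%:E).
by apply: congr1; apply/idP/idP; rewrite inE.
Qed.

Lemma integral_exp_tail (w : R) :
  (\int[leb]_z (expR (- z) * (w <= z)%R%:R)%:E = (expR (- w))%:E)%E.
Proof.
pose f (z : R) : \bar R := (exponential_pdf 1 z)%:E.
have mf : measurable_fun setT f by apply/measurable_EFinP; exact: measurable_exponential_pdf.
have f0 z : (0 <= f z)%E by rewrite lee_fin exponential_pdf_ge0.
have := ge0_integral_affine (- w) (oner_neq0 R) mf f0.
rewrite normr1 invr1 mul1e integral_exponential_pdf// => h.
rewrite -[RHS]mule1 -h -ge0_integralZl//.
- apply: eq_integral => z _; rewrite /f mul1r -EFinM; congr EFin; case: (leP w z) => wz.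
    rewrite exponential_pdfE ?subr_ge0// mulr1.
    by rewrite mul1r -expRD; congr expR; ring.
  by rewrite lt0_exponential_pdf ?subr_lt0// !mulr0.
- apply: (measurableT_comp mf); apply: measurable_funD => //; exact: measurable_funM.
Qed.

Lemma integral_powR_seg (al u z : R) : 0 < u -> u <= z ->
  (\int[leb]_w (al * w `^ (al - 1) * ((u <= w)%R%:R * (w <= z)%R%:R))%:E =
   (z `^ al - u `^ al)%:E)%E.
Proof.
move=> u0; rewrite le_eqVlt => /predU1P[<-|uz].
  rewrite subrr; apply: (etrans (y := (\int[leb]_(w in [set u]) (al * w `^ (al - 1))%:E)%E)).
    rewrite [RHS]integral_mkcond; apply: eq_integral => w _; rewrite patchE.
    case: ifPn => [|wu].
      by rewrite inE /= => ->; rewrite lexx !mulr1.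
    case: (leP u w) => [|_]; last by rewrite mul0r mulr0.
    case: (leP w u) => [|_]; last by rewrite mulr0 mulr0.
    move=> wu' uw; case/negP: wu; rewrite inE /=; apply/eqP; rewrite eq_le wu' uw//.
  by rewrite integral_set1.
transitivity (\int[leb]_(w in `[u, z]) (al * w `^ (al - 1))%:E)%E.
  rewrite [RHS]integral_mkcond; apply: eq_integral => w _; rewrite patchE.
  case: ifPn => [|wu].
    by rewrite inE /= in_itv/= => /andP[-> ->]; rewrite !mulr1.
  case: (leP u w) => uw; last by rewrite mul0r mulr0.
  case: (leP w z) => wz; last by rewrite mulr0 mulr0.
  by case/negP: wu; rewrite inE /= in_itv/= uw wz.
have dpow (x : R) : 0 < x -> derivable (@powR R ^~ al) x 1.
  by move=> x0; apply: derivable_powR; rewrite in_itv/= andbT.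
have cpow (p x : R) : 0 < x -> {for x, continuous (@powR R ^~ p)}.
  move=> x0; apply: differentiable_continuous; apply/derivable1_diffP.
  by apply: derivable_powR; rewrite in_itv/= andbT.
rewrite EFinB; apply: (continuous_FTC2 (F := @powR R ^~ al)) => //.
- apply: continuous_in_subspaceT => x; rewrite inE /= in_itv/= => /andP[ux _].
  have x0 : 0 < x by apply: lt_le_trans ux.
  by apply: cvgM; [exact: cvg_cst|exact: cpow].
- split.
  + move=> x; rewrite in_itv/= => /andP[ux _]; apply: dpow; exact: lt_trans ux.
  + by apply: cvg_at_right_filter; exact: cpow.
  + by apply: cvg_at_left_filter; apply: cpow; exact: lt_trans uz.
- move=> x; rewrite in_itv/= => /andP[ux _].
  by rewrite powR_derive1// in_itv/= andbT; exact: lt_trans ux.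
Qed.

Context d (T : measurableType d) (P : probability T R) (J : finType) (X : T -> J -> R).
Hypothesis gX : gaussfam P X.
Let Z t := sq (X t) / 2.
Let al : R := #|J|%:R / 2.

Lemma measurable_halfsq : measurable_fun setT Z.
Proof.
apply: measurable_funM => //.
exact: (measurableT_comp (@measurable_sq R J) (iid_measurable gX)).
Qed.

Definition exp_trunc r : \bar R := (\int[P]_t (expR (Z t) * (Z t <= r)%R%:R)%:E)%E.

(** Mass of the ball Z <= 1 under exp(Z) dP; [chisq_gamma] later identifies it as 1/(al
    Gamma(al)). *)
Definition chisqK : R := fine (exp_trunc 1).

Lemma measurable_exp_trunc r : measurable_fun setT (fun t => (expR (Z t) * (Z t <= r)%R%:R)%:E).
Proof.
have mZ := measurable_halfsq.
apply/measurable_EFinP; apply: measurable_funM; first exact: measurableT_comp.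
exact: measurable_le_ind.
Qed.

Lemma exp_trunc_ge0 r : (0 <= exp_trunc r)%E.
Proof. by apply: integral_ge0 => t _; rewrite lee_fin mulr_ge0// expR_ge0. Qed.

Lemma exp_trunc_le r : (exp_trunc r <= (expR r)%:E)%E.
Proof.
apply: (@le_trans _ _ (\int[P]_t (cst (expR r)%:E t))%E); last first.
  rewrite integral_cst// -[leRHS]mule1; apply: lee_wpmul2l; rewrite ?lee_fin ?expR_ge0//.
  exact: probability_le1.
apply: ge0_le_integral => //.
- exact: measurable_exp_trunc.
move=> t _; rewrite lee_fin; case: (leP (Z t) r) => h; last by rewrite mulr0 expR_ge0.
by rewrite mulr1 ler_expR.
Qed.

Lemma exp_trunc_fin r : exp_trunc r \is a fin_num.
Proof.
rewrite ge0_fin_numE ?exp_trunc_ge0//.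
exact: le_lt_trans (exp_trunc_le r) (ltry _).
Qed.

(* Under the measure exp(Z) dP the vector X has a constant Lebesgue density, so
   the mass of a ball is homogeneous in its radius. *)
Lemma exp_trunc_homogeneous r : 0 < r -> exp_trunc r = (chisqK * r `^ al)%:E.
Proof.
move=> r0; have s0 : 0 < Num.sqrt r by rewrite sqrtr_gt0.
pose c : R := (Num.sqrt r)^-1; have c0 : 0 < c by rewrite invr_gt0.
have c2 : c^-2 = r by rewrite /c exprVn invrK sqr_sqrtr// ltW.
pose f (x : coordT R J) : \bar R := (expR (sq x / 2 * c^-2) * (sq x / 2 <= 1)%R%:R)%:E.
have msq := @measurable_sq R J.
have ms2 : measurable_fun setT (fun x : coordT R J => sq x / 2) by exact: measurable_funM.
have mf : measurable_fun setT f.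
  apply/measurable_EFinP; apply: measurable_funM.
    by apply: measurableT_comp => //; apply: measurable_funM.
  exact: measurable_le_ind.
have f0 x : (0 <= f x)%E by rewrite lee_fin mulr_ge0// expR_ge0.
have := gauss_tilt gX (fun=> c0) mf f0.
have E1 t : f (fun i => c * X t i) = (expR (Z t) * (Z t <= r)%R%:R)%:E.
  have -> : f (fun i => c * X t i) = (expR (c ^+ 2 * Z t * c^-2) * (c ^+ 2 * Z t <= 1)%R%:R)%:E.
    have E : sq (fun i => c * X t i) / 2 = c ^+ 2 * Z t.
      by rewrite /Z mulrA; congr (_ / 2); rewrite /sq mulr_sumr; apply: eq_bigr => i _; rewrite exprMn.
    by rewrite /f E.
  congr (expR _ * _)%:E.
    by field; rewrite gt_eqF.
  by rewrite -c2 -[in RHS]div1r ler_pdivlMr ?exprn_gt0// mulrC.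
under [X in X = _ -> _]eq_integral do rewrite E1.
rewrite -/(exp_trunc r) => ->.
have -> : (\int[P]_t (f (X t) * (expR (\sum_i X t i ^+ 2 / 2 * (1 - c^-2))%R)%:E))%E = exp_trunc 1.
  apply: eq_integral => t _; rewrite -EFinM mulrAC -expRD; congr (expR _ * _)%:E.
  have -> : \sum_i X t i ^+ 2 / 2 * (1 - c^-2) = Z t * (1 - c^-2).
    by rewrite /Z /sq !mulr_suml.
  by rewrite -/(Z t); ring.
rewrite -[exp_trunc 1]fineK ?exp_trunc_fin// -EFinM -/chisqK mulrC; congr (_ * _)%:E.
rewrite prodr_const /c exprVn invrK -powR12_sqrt ?ltW// -powR_mulrn ?powR_ge0//.
by rewrite -powRrM /al mulrC.
Qed.

Lemma chisqK_ge0 : 0 <= chisqK.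
Proof. by rewrite fine_ge0 ?exp_trunc_ge0. Qed.

(** This is the Gamma density, derived without polar coordinates: write 1 as exp(Z) times the
    integral of exp(-z) over z >= Z, exchange integrals so that truncated ball masses appear, write
    these as integrals of their derivative, and exchange again. *)
Lemma chisq_tail u : 0 < u ->
  (P [set t | u < Z t]%R =
   \int[leb]_w (chisqK * (al * w `^ (al - 1) * ((u <= w)%R%:R * expR (- w))))%:E)%E.
Proof.
move=> u0; have mZ := measurable_halfsq; have K0 := chisqK_ge0.
have al0 : 0 <= al by rewrite /al divr_ge0.
have mS : measurable [set t | u < Z t].
  rewrite -[X in measurable X]setTI.
  have := mZ measurableT _ (@measurable_itv R `]u, +oo[).
  by congr (measurable (_ `&` _)); apply/seteqP; split => x /=; rewrite in_itv/= andbT.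
rewrite -integral_prop//.
pose F (x : T * measurableTypeR R) : \bar R :=
  ((u < Z x.1)%R%:R * expR (Z x.1) * (expR (- x.2) * (Z x.1 <= x.2)%R%:R))%:E.
have mZ1 : measurable_fun setT (fun x : T * measurableTypeR R => Z x.1) by exact: (measurableT_comp mZ measurable_fst).
have m2 : measurable_fun setT (fun x : T * measurableTypeR R => x.2) by exact: measurable_snd.
have mF : measurable_fun setT F.
  apply/measurable_EFinP; apply: measurable_funM; apply: measurable_funM.
  - exact: measurable_lt_ind.
  - exact: measurableT_comp.
  - by apply: measurableT_comp => //; exact: measurableT_comp.
  - exact: measurable_le_ind.
have F0 x : (0 <= F x)%E by rewrite lee_fin !mulr_ge0// expR_ge0.
transitivity (\int[P]_t \int[leb]_z F (t, z))%E.
  apply: eq_integral => t _.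
  pose g : measurableTypeR R -> R := fun z => expR (- z) * (Z t <= z)%R%:R.
  have mg : measurable_fun setT g.
    apply: measurable_funM; last exact: measurable_le_ind.
    by apply: measurableT_comp => //; exact: measurableT_comp.
  have g0 z : 0 <= g z by rewrite mulr_ge0// expR_ge0.
  have k0 : 0 <= (u < Z t)%R%:R * expR (Z t) by rewrite mulr_ge0// expR_ge0.
  have E := ge0_integralZR leb mg g0 k0.
  apply: (etrans _ (esym E)); rewrite (integral_exp_tail (Z t)).
  by rewrite -EFinM -mulrA -expRD addrN expR0 mulr1.
apply: (etrans (fubini_tonelli (m1 := P) (m2 := leb) F mF F0)).
(* The mass of the shell u < Z <= z, which is K (z^al - u^al), equals the integral over w in [u, z]
   of K al w^(al - 1); [H] records that integrand with the weight exp(-z). *)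
pose H (x : measurableTypeR R * measurableTypeR R) : \bar R := (chisqK * (al * x.2 `^ (al - 1) * ((u <= x.2)%R%:R * (x.2 <= x.1)%R%:R)) * expR (- x.1))%:E.
have mH : measurable_fun setT H.
  have m1 : measurable_fun setT (fun x : measurableTypeR R * measurableTypeR R => x.1) by exact: measurable_fst.
  have m2' : measurable_fun setT (fun x : measurableTypeR R * measurableTypeR R => x.2) by exact: measurable_snd.
  apply/measurable_EFinP; apply: measurable_funM; last first.
    by apply: measurableT_comp => //; exact: measurableT_comp.
  apply: measurable_funM => //; apply: measurable_funM.
    apply: measurable_funM => //.
    have := measurableT_comp (@measurable_powR R (al - 1)) m2'; exact.
  by apply: measurable_funM; exact: measurable_le_ind.
have H0 x : (0 <= H x)%E by rewrite lee_fin !mulr_ge0// ?powR_ge0 ?expR_ge0.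
transitivity (\int[leb]_z \int[leb]_w H (z, w))%E.
  apply: eq_integral => z _.
  have [uz|zu] := leP u z; last first.
    rewrite !integral0_eq//.
      move=> w _; rewrite /H /=; case: (leP u w) => uw; last by rewrite !(mul0r, mulr0).
      by rewrite (leNgt w z) (lt_le_trans zu uw) !(mul0r, mulr0).
    move=> t _; rewrite /F /=; case: (ltP u (Z t)) => uw; last by rewrite !(mul0r, mulr0).
    by rewrite (leNgt (Z t) z) (lt_trans zu uw) !(mul0r, mulr0).
  have -> : (\int[leb]_w H (z, w) = (chisqK * expR (- z) * (z `^ al - u `^ al))%:E)%E.
    rewrite EFinM -(integral_powR_seg al u0 uz) -ge0_integralZR.
    - by apply: eq_integral => w _; rewrite /H/=; congr EFin; ring.
    - apply: measurable_funM.
        by apply: measurable_funM => //; exact: measurable_powR.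
      by apply: measurable_funM; exact: measurable_le_ind.
    - by move=> w; rewrite !mulr_ge0// powR_ge0.
    - by rewrite mulr_ge0// expR_ge0.
  have z0 : 0 < z by exact: lt_le_trans uz.
  have split_z : (exp_trunc z = exp_trunc u + \int[P]_t ((u < Z t)%R%:R * expR (Z t) * (Z t <= z)%R%:R)%:E)%E.
    rewrite /exp_trunc -ge0_integralD//; last 2 first.
    - exact: measurable_exp_trunc.
    - apply/measurable_EFinP; apply: measurable_funM; last exact: measurable_le_ind.
      by apply: measurable_funM; [exact: measurable_lt_ind|exact: measurableT_comp].
    apply: eq_integral => t _; rewrite -EFinD; congr EFin.
    case: (leP (Z t) u) => h; last by rewrite mulr0 add0r mul1r.
    by rewrite (le_trans h uz) mul0r mul0r addr0.
  have IE : (\int[P]_t ((u < Z t)%R%:R * expR (Z t) * (Z t <= z)%R%:R)%:E = (chisqK * (z `^ al - u `^ al))%:E)%E.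
    have := split_z; rewrite !exp_trunc_homogeneous// => h.
    by rewrite mulrBr EFinB h addeAC subee ?add0e.
  transitivity (\int[P]_t (expR (- z) * ((u < Z t)%R%:R * expR (Z t) * (Z t <= z)%R%:R))%:E)%E.
    by apply: eq_integral => t _; rewrite /F /=; congr EFin; ring.
  rewrite ge0_integralZR.
  - by rewrite IE -EFinM; congr EFin; ring.
  - apply: measurable_funM; last exact: measurable_le_ind.
    by apply: measurable_funM; [exact: measurable_lt_ind|exact: measurableT_comp].
  - by move=> t; rewrite !mulr_ge0// expR_ge0.
  - exact: expR_ge0.
apply: (etrans (fubini_tonelli (m1 := leb) (m2 := leb) H mH H0)).
apply: eq_integral => w _.
transitivity (\int[leb]_z ((chisqK * (al * w `^ (al - 1) * (u <= w)%R%:R)) *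
    (expR (- z) * (w <= z)%R%:R))%:E)%E.
  by apply: eq_integral => z _; rewrite /H /=; congr EFin; ring.
rewrite ge0_integralZR.
- by rewrite integral_exp_tail -EFinM; congr EFin; ring.
- apply: measurable_funM; last exact: measurable_le_ind.
  by apply: measurableT_comp => //; exact: measurableT_comp.
- by move=> z; rewrite mulr_ge0// expR_ge0.
- by rewrite !mulr_ge0// powR_ge0.
Qed.

End chi_square_law.

Section power_bounds.
Context (R : realType).

(** Exponents of either sign occur (a single coordinate gives al - 1 = -1/2), so the ratio is
    bounded on both sides and one integer power serves for domination. *)
Lemma powR_ratio_bound (r w p : R) (n : nat) : 0 <= w -> (1 + w)^-1 <= r <= 1 + w ->
  `|p| <= n%:R -> r `^ p <= (1 + w) ^+ n.
Proof.
move=> w0 /andP[r1 r2] pn.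
have w1 : 1 <= 1 + w by rewrite lerDl.
have w10 : 0 < 1 + w by rewrite ltr_pwDl.
have r0 : 0 < r by apply: lt_le_trans r1; rewrite invr_gt0.
rewrite -(powR_mulrn n (ltW w10)).
have [p0|p0] := leP 0 p.
  apply: (@le_trans _ _ ((1 + w) `^ p)).
    by apply: ge0_ler_powR => //; rewrite nnegrE ltW.
  by apply: ler_powR => //; apply: le_trans pn; exact: ler_norm.
have -> : r `^ p = r^-1 `^ (- p).
  by rewrite -powR_inv1 ?ltW// -powRrM mulrNN mul1r.
apply: (@le_trans _ _ ((1 + w) `^ (- p))).
  apply: ge0_ler_powR; rewrite ?nnegrE ?invr_ge0 ?oppr_ge0 ?(ltW r0) ?(ltW p0) ?(ltW w10)//.
  by rewrite -[leRHS]invrK lef_pV2 ?posrE ?invr_gt0.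
by apply: ler_powR => //; apply: le_trans pn; rewrite ltr0_norm.
Qed.

(** Polynomial growth is traded for an arbitrarily small exponential rate [dl], from 1 + x <= exp x
    at x = dl w/(n + 1). *)
Lemma exprn_le_expR (w dl : R) (n : nat) : 0 <= w -> 0 < dl <= 1 ->
  (1 + w) ^+ n <= (n.+1%:R / dl) ^+ n * expR (dl * w).
Proof.
move=> w0 /andP[d0 d1].
have n0 : 0 < n.+1%:R :> R by rewrite ltr0n.
have c1 : 1 <= n.+1%:R / dl.
  by rewrite ler_pdivlMr// mul1r (le_trans d1)// ler1n.
have c0 : 0 < n.+1%:R / dl by exact: lt_le_trans c1.
have h : 1 + w <= n.+1%:R / dl * expR (dl * w / n.+1%:R).
  have := expR_ge1Dx (dl * w / n.+1%:R) => h.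
  apply: le_trans (ler_wpM2l (ltW c0) h).
  rewrite mulrDr mulr1; apply: lerD => //.
  by rewrite le_eqVlt; apply/orP; left; apply/eqP; field; rewrite !gt_eqF.
have w10 : 0 <= 1 + w by rewrite addr_ge0.
apply: (le_trans (lerXn2r n _ _ h)); rewrite ?nnegrE//.
  by rewrite mulr_ge0 ?expR_ge0// ltW.
rewrite exprMn; apply: ler_wpM2l; first by rewrite exprn_ge0// ltW.
rewrite -expRM_natl ler_expR mulrA ler_pdivrMr// [leRHS]mulrC; apply: ler_wpM2r.
  by rewrite mulr_ge0// ltW.
by rewrite ler_nat.
Qed.

Lemma integral_half_exp : (\int[lebesgue_measure]_v (expR (- (v / 2)) * (0 <= v)%R%:R : R)%:E = (2 : R)%:E)%E.
Proof.
pose f (z : measurableTypeR R) : \bar R := (expR (- z) * (0 <= z)%R%:R)%:E.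
have mf : measurable_fun setT f.
  apply/measurable_EFinP; apply: measurable_funM; last exact: measurable_le_ind.
  by apply: measurableT_comp => //; exact: measurableT_comp.
have f0 z : (0 <= f z)%E by rewrite lee_fin mulr_ge0// expR_ge0.
have h20 : 2^-1 != 0 :> R by rewrite invr_eq0 pnatr_eq0.
have := ge0_integral_affine 0 h20 mf f0.
rewrite (integral_exp_tail 0) oppr0 expR0 mule1 gtr0_norm ?invr_gt0// invrK => <-.
apply: eq_integral => v _; rewrite /f addr0 [2^-1 * v]mulrC.
by rewrite pmulr_lge0 ?invr_gt0.
Qed.

End power_bounds.

(** * Gamma normalisation and tail asymptotics *)

Section chi_square_tail.
Context (R : realType) d (T : measurableType d) (P : probability T R) (J : finType)
  (X : T -> J -> R).
Hypotheses (gX : gaussfam P X) (J0 : (0 < #|J|)%N).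
Local Notation leb := (@lebesgue_measure R).
Let Z t := sq (X t) / 2.
Let al : R := #|J|%:R / 2.
Let K := chisqK P X.

Let al0 : 0 < al. Proof. by rewrite divr_gt0// ltr0n. Qed.
Let K0 : 0 <= K. Proof. exact: chisqK_ge0. Qed.
Let mZ : measurable_fun setT Z. Proof. exact: (measurable_halfsq gX). Qed.

Lemma measurable_lt_halfsq u : measurable [set t | u < Z t].
Proof.
rewrite -[X in measurable X]setTI.
have := mZ measurableT (@measurable_itv R `]u, +oo[).
by congr (measurable (_ `&` _)); apply/seteqP; split => x /=; rewrite in_itv/= andbT.
Qed.

Lemma prob_halfsq_le r : 0 < r -> (P [set t | (Z t <= r)%R] <= (K * r `^ al)%:E)%E.
Proof.
move=> r0; rewrite /K /al -(exp_trunc_homogeneous gX r0).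
have mS : measurable [set t | Z t <= r].
  rewrite -[X in measurable X]setTI.
  have := mZ measurableT (@measurable_itv R `]-oo, r]).
  by congr (measurable (_ `&` _)); apply/seteqP; split => x /=; rewrite in_itv/=.
rewrite -integral_prop//; apply: ge0_le_integral => //.
- apply/measurable_EFinP; exact: measurable_le_ind.
- exact: (measurable_exp_trunc gX r).
move=> t _; rewrite lee_fin ler_peMl// -[leLHS]expR0 ler_expR.
by rewrite divr_ge0// sq_ge0.
Qed.

Lemma prob_halfsq_gt0 : P [set t | (0 < Z t)%R] = 1%E.
Proof.
have mS : measurable [set t | Z t <= 0].
  rewrite -[X in measurable X]setTI.
  have := mZ measurableT (@measurable_itv R `]-oo, 0]).
  by congr (measurable (_ `&` _)); apply/seteqP; split => x /=; rewrite in_itv/=.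
suff P0 : P [set t | (Z t <= 0)%R] = 0%E.
  have -> : [set t | (0 < Z t)%R] = ~` [set t | (Z t <= 0)%R].
    by apply/seteqP; split => t /=; rewrite ltNge => /negP.
  by rewrite probability_setC// P0 sube0.
have [p pE] : exists p : R, P [set t | (Z t <= 0)%R] = p%:E.
  by exists (fine (P [set t | (Z t <= 0)%R])); rewrite fineK// fin_num_measure.
have p0 : 0 <= p by rewrite -lee_fin -pE measure_ge0.
(* The radius e^(1/al) makes the ball bound linear in e, so the mass at the origin is below every
   positive number. *)
have ub e : 0 < e -> p <= K * e.
  move=> e0; have r0 : 0 < e `^ al^-1 by exact: powR_gt0.
  have sub : [set t | (Z t <= 0)%R] `<=` [set t | (Z t <= e `^ al^-1)%R].
    by move=> t /= h; apply: (le_trans h); exact: ltW.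
  have mr : measurable [set t | Z t <= e `^ al^-1].
    rewrite -[X in measurable X]setTI.
    have := mZ measurableT (@measurable_itv R `]-oo, (e `^ al^-1)]).
    by congr (measurable (_ `&` _)); apply/seteqP; split => x /=; rewrite in_itv/=.
  rewrite -lee_fin -pE; apply: (le_trans (le_measure P _ _ sub)); rewrite ?inE//.
  have E : (e `^ al^-1) `^ al = e by rewrite -powRrM mulVf ?gt_eqF// powRr1// ltW.
  by have := prob_halfsq_le r0; rewrite E.
rewrite pE; congr EFin; apply/eqP; rewrite eq_le p0 andbT leNgt; apply/negP => pp.
have c0 : 0 < K + K + 1 by rewrite ltr_wpDl// addr_ge0.
have := ub (p / (K + K + 1)) (divr_gt0 pp c0).
rewrite mulrA ler_pdivlMr// => h; have : p * (K + 1) <= 0 by lra.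
by rewrite leNgt mulr_gt0// ltr_wpDl.
Qed.

(** Letting the threshold of the tail formula decrease to 0 gives total mass 1, that is K al
    Gamma(al) = 1. Finiteness and positivity of the Gamma integral come with it, so [fine] in
    [GammaR] loses nothing. *)
Lemma chisq_gamma : 0 < GammaR al /\ K * al = (GammaR al)^-1.
Proof.
pose f n (w : measurableTypeR R) : \bar R := (K * (al * w `^ (al - 1) * ((n.+1%:R^-1 <= w)%R%:R * expR (- w))))%:E.
pose g (w : measurableTypeR R) : \bar R := (K * (al * w `^ (al - 1) * ((0 < w)%R%:R * expR (- w))))%:E.
have fmeas n : measurable_fun setT (f n).
  apply/measurable_EFinP; apply: measurable_funM => //; apply: measurable_funM.
    by apply: measurable_funM => //; exact: measurable_powR.
  apply: measurable_funM; first exact: measurable_le_ind.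
  by apply: measurableT_comp => //; exact: measurableT_comp.
have f0 n w : (0 <= f n w)%E by rewrite lee_fin !mulr_ge0// ?powR_ge0 ?expR_ge0// ltW.
have nd w : {homo f ^~ w : n m / (n <= m)%N >-> (n <= m)%E}.
  move=> n m nm; rewrite lee_fin; apply: ler_wpM2l => //; apply: ler_wpM2l.
    by rewrite mulr_ge0 ?powR_ge0// ltW.
  apply: ler_wpM2r; first exact: expR_ge0.
  rewrite ler_nat; case: (leP (n.+1%:R^-1) w) => h //=.
  by rewrite (le_trans _ h)// lef_pV2 ?posrE ?ltr0n// ler_nat.
have fg w : (fun n => f n w) @ \oo --> g w.
  apply: cvg_near_cst; case: (ltP 0 w) => w0; last first.
    near=> n; rewrite /f /g; congr (_ * (_ * (_%:R * _)))%:E.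
    by rewrite (ltNge 0 w) w0/=; apply/eqP; rewrite eqb0 -ltNge (le_lt_trans w0)// invr_gt0 ltr0n.
  near=> n; rewrite /f /g w0; congr (_ * (_ * (_%:R * _)))%:E.
  apply/eqP; rewrite eqb1 ltW//; near: n; exact: near_infty_natSinv_lt (PosNum w0).
have I1 : (fun n => \int[leb]_w f n w)%E @ \oo --> (\int[leb]_w g w)%E.
  have -> : (\int[leb]_w g w = \int[leb]_w limn (f ^~ w))%E.
    by apply: eq_integral => w _; apply/esym/cvg_lim => //; exact: fg.
  apply: (cvg_monotone_convergence measurableT fmeas) => [n w _|w _]; [exact: f0|exact: nd].
have fI n : (\int[leb]_w f n w = P [set t | (n.+1%:R^-1 < Z t)%R])%E.
  by rewrite (chisq_tail gX)// invr_gt0 ltr0n.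
have I2 : (fun n => P [set t | (n.+1%:R^-1 < Z t)%R]) @ \oo --> P [set t | (0 < Z t)%R].
  have -> : [set t | (0 < Z t)%R] = \bigcup_n [set t | (n.+1%:R^-1 < Z t)%R].
    apply/seteqP; split => t /=.
      by move=> /ltr_add_invr[n]; rewrite add0r => h; exists n.
    by move=> [n _ /=]; apply: lt_trans; rewrite invr_gt0 ltr0n.
  apply: nondecreasing_cvg_mu.
  - by move=> n; exact: measurable_lt_halfsq.
  - by apply: bigcupT_measurable => n; exact: measurable_lt_halfsq.
  - move=> n m nm; apply/subsetPset => t /=; apply: le_lt_trans.
    by rewrite lef_pV2 ?posrE ?ltr0n// ler_nat.
have gI : (\int[leb]_w g w = 1)%E.
  have fIe : (fun n => \int[leb]_w f n w)%E = (fun n => P [set t | (n.+1%:R^-1 < Z t)%R]).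
    by apply/funext => n; exact: fI.
  rewrite fIe in I1; rewrite -prob_halfsq_gt0.
  exact: (cvg_unique _ I1 I2).
pose G := (\int[leb]_(t in `]0%R, +oo[) (t `^ (al - 1) * expR (- t))%:E)%E.
have Ka0 : 0 <= K * al by rewrite mulr_ge0// ltW.
have GE : ((K * al)%:E * G = 1)%E.
  rewrite -gI /G integral_mkcond -ge0_integralZl//.
  - apply: eq_integral => w _; rewrite patchE mem_setE in_itv/= andbT /g.
    case: (ltP 0 w) => w0; last by rewrite !(mul0r, mulr0) mule0.
    by rewrite -EFinM mul1r; congr EFin; ring.
  - apply: (proj1 (measurable_restrictT _ _)) => //; apply: measurable_funTS.
    apply/measurable_EFinP; apply: measurable_funM; first exact: measurable_powR.
    by apply: measurableT_comp => //; exact: measurableT_comp.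
  - by move=> w _; rewrite patchE; case: ifP => // _; rewrite lee_fin mulr_ge0 ?powR_ge0 ?expR_ge0.
have G0 : (0 <= G)%E by apply: integral_ge0 => w _; rewrite lee_fin mulr_ge0 ?powR_ge0 ?expR_ge0.
have Kan0 : K * al != 0.
  by apply/eqP => h; move: GE; rewrite h mul0e => -[] /esym/eqP; rewrite oner_eq0.
have Kap : 0 < K * al by rewrite lt_neqAle eq_sym Kan0.
have Gfin : G \is a fin_num.
  rewrite ge0_fin_numE// ltey; apply/eqP => h.
  by move: GE; rewrite h gt0_muley ?lte_fin.
have GR : G = (GammaR al)%:E by rewrite /GammaR fineK.
move: GE; rewrite GR -EFinM => -[GE].
have Gn0 : GammaR al != 0 by apply/eqP => h; move: GE => /eqP; rewrite h mulr0 eq_sym oner_eq0.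
split; first by rewrite lt_neqAle eq_sym Gn0 -lee_fin -GR.
by rewrite -[LHS]mulr1 -(divff Gn0) mulrA GE mul1r.
Unshelve. all: by end_near.
Qed.

Definition tailp u : R := fine (P [set t | (u < Z t)%R]).

Lemma tailpE u : P [set t | (u < Z t)%R] = (tailp u)%:E.
Proof. by rewrite fineK// fin_num_measure//; exact: measurable_lt_halfsq. Qed.

Lemma tailp_ge0 u : 0 <= tailp u.
Proof. by rewrite fine_ge0. Qed.

Lemma tailp_le1 u : tailp u <= 1.
Proof. by rewrite -lee_fin -tailpE probability_le1//; exact: measurable_lt_halfsq. Qed.

(** The integrand of the tail formula after w = u + v, multiplied by exp(u) u^(1 - al); as u grows
    it tends to a multiple of exp(-v). *)
Definition ratio_int u (v : R) : R :=
  K * al * (((u + v) / u) `^ (al - 1) * (expR (- v) * (0 <= v)%R%:R)).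

Lemma measurable_ratio_int u : measurable_fun setT (ratio_int u).
Proof.
apply: measurable_funM => //; apply: measurable_funM.
  apply: (measurableT_comp (@measurable_powR R (al - 1))).
  by apply: measurable_funM => //; exact: measurable_funD.
apply: measurable_funM; last exact: measurable_le_ind.
by apply: measurableT_comp => //; exact: measurableT_comp.
Qed.

Lemma chisq_tail_ratio u : 0 < u ->
  ((expR u * u `^ (1 - al) * tailp u)%:E = \int[leb]_v (ratio_int u v)%:E)%E.
Proof.
move=> u0; rewrite EFinM -tailpE (chisq_tail gX u0).
pose f (w : measurableTypeR R) : R := K * (al * w `^ (al - 1) * ((u <= w)%R%:R * expR (- w))).
have mf : measurable_fun setT f.
  apply: measurable_funM => //; apply: measurable_funM.
    by apply: measurable_funM => //; exact: measurable_powR.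
  apply: measurable_funM; first exact: measurable_le_ind.
  by apply: measurableT_comp => //; exact: measurableT_comp.
have mfE : measurable_fun setT (fun w => (f w)%:E) by exact/measurable_EFinP.
have f0 w : 0 <= f w by rewrite !mulr_ge0// ?powR_ge0 ?expR_ge0// ltW.
have fE0 w : (0 <= (f w)%:E)%E by rewrite lee_fin.
have c0 : 0 <= expR u * u `^ (1 - al) by rewrite mulr_ge0 ?expR_ge0 ?powR_ge0.
rewrite -(ge0_integralZR leb mf f0 c0).
pose g (w : R) : \bar R := (expR u * u `^ (1 - al) * f w)%:E.
have mg : measurable_fun setT g by apply/measurable_EFinP; exact: measurable_funM.
have g0 w : (0 <= g w)%E by rewrite lee_fin mulr_ge0.
have := ge0_integral_affine u (oner_neq0 R) mg g0.
rewrite normr1 invr1 mul1e => <-; apply: eq_integral => v _.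
rewrite /g /f /ratio_int mul1r; congr EFin.
rewrite lerDr [v + u]addrC.
case: (leP 0 v) => v0; last by rewrite !(mulr0, mul0r).
have uv : 0 < u + v by rewrite ltr_pwDl.
have -> : ((u + v) / u) `^ (al - 1) = (u + v) `^ (al - 1) * u `^ (1 - al).
  rewrite powRM ?invr_ge0 ?(ltW u0) ?(ltW uv)//; congr (_ * _).
  by rewrite -powR_inv1 ?ltW// -powRrM mulN1r opprB.
have -> : expR (- (u + v)) = expR (- u) * expR (- v) by rewrite opprD expRD.
have : expR u * expR (- u) = 1 by rewrite -expRD addrN expR0.
move: (expR u) (expR (- u)) => a b ab; rewrite -[RHS]mul1r -ab; ring.
Qed.

Let nJ := #|J|.
Let alnJ : `|al - 1| <= nJ%:R.
Proof.
have : 1 <= nJ%:R :> R by rewrite ler1n.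
by rewrite ler_norml /al => h; apply/andP; split; lra.
Qed.

Let Cb := (nJ.+1%:R / 2^-1) ^+ nJ : R.

Lemma ratio_int_bound u v : 1 <= u ->
  0 <= ratio_int u v <= K * al * Cb * (expR (- (v / 2)) * (0 <= v)%R%:R).
Proof.
move=> u1; have u0 : 0 < u by exact: lt_le_trans u1.
have Ka0 : 0 <= K * al by rewrite mulr_ge0// ltW.
apply/andP; split; first by rewrite !mulr_ge0// ?powR_ge0 ?expR_ge0.
rewrite /ratio_int -[leRHS]mulrA; apply: ler_wpM2l => //.
case: (leP 0 v) => v0; last by rewrite !mulr0.
rewrite !mulr1.
have h1 : ((u + v) / u) `^ (al - 1) <= (1 + v) ^+ nJ.
  apply: powR_ratio_bound => //; apply/andP; split.
    apply: (@le_trans _ _ 1); first by rewrite invf_le1 ?lerDl// ltr_pwDl.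
    by rewrite ler_pdivlMr// mul1r lerDl.
  rewrite ler_pdivrMr// mulrDl mul1r lerD2l -[leLHS]mulr1.
  exact: ler_wpM2l.
have h2 : (1 + v) ^+ nJ <= Cb * expR (2^-1 * v).
  by apply: exprn_le_expR => //; apply/andP; split; lra.
apply: (le_trans (ler_wpM2r (expR_ge0 _) (le_trans h1 h2))).
rewrite -mulrA -expRD le_eqVlt; apply/orP; left; apply/eqP; congr (_ * expR _); by field.
Qed.

Lemma integrable_half_exp c :
  leb.-integrable setT (fun v : R => (c * (expR (- (v / 2)) * (0 <= v)%R%:R))%:E).
Proof.
have mf : measurable_fun setT (fun v : measurableTypeR R => expR (- (v / 2)) * (0 <= v)%R%:R).
  apply: measurable_funM; last exact: measurable_le_ind.
  apply: measurableT_comp => //; apply: measurableT_comp => //.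
  exact: measurable_funM.
have g0 (v : measurableTypeR R) : 0 <= expR (- (v / 2)) * (0 <= v)%R%:R by rewrite mulr_ge0// expR_ge0.
apply/integrableP; split; first by apply/measurable_EFinP; exact: measurable_funM.
rewrite (_ : integral _ _ _ = \int[leb]_v (`|c| * (expR (- (v / 2)) * (0 <= v)%R%:R))%:E)%E; last first.
  by apply: eq_integral => v _; rewrite /= normrM (ger0_norm (g0 v)).
by rewrite (ge0_integralZR leb mf g0 (normr_ge0 c)) integral_half_exp -EFinM ltry.
Qed.

(** Dominated convergence: ((u + v)/u)^(al - 1) tends to 1 under the bound [ratio_int_bound], and
    exp(-v) has integral 1 over v >= 0. The sequence is truncated below at 1 so that the bound holds
    at every index. *)
Lemma chisq_tail_cvg (u : nat -> R) : u @ \oo --> +oo ->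
  (fun n => expR (u n) * u n `^ (1 - al) * tailp (u n)) @ \oo --> (GammaR al)^-1.
Proof.
move=> uoo; rewrite -chisq_gamma.2.
pose u' n := Num.max (u n) 1.
have u'1 n : 1 <= u' n by rewrite le_max lexx orbT.
have u'0 n : 0 < u' n by apply: lt_le_trans (u'1 n).
have u'oo : u' @ \oo --> +oo.
  apply/cvgryPge => A; move/cvgryPge: uoo => /(_ A); apply: filterS => n /= h.
  by rewrite le_max h.
suff : (fun n => expR (u' n) * u' n `^ (1 - al) * tailp (u' n)) @ \oo --> K * al.
  apply: cvg_trans; apply: near_eq_cvg; move/cvgryPge: uoo => /(_ 1); apply: filterS => n /= h.
  by rewrite /u'; have /max_idPl -> : 1 <= u n by [].
have dct := @dominated_convergence _ _ R leb setT measurableT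
  (fun n v => (ratio_int (u' n) v)%:E) (fun v : measurableTypeR R => (K * al * (expR (- v) * (0 <= v)%R%:R))%:E)
  (fun v : measurableTypeR R => (K * al * Cb * (expR (- (v / 2)) * (0 <= v)%R%:R))%:E).
have [|||||_ _] := dct.
- by move=> n; apply/measurable_EFinP; exact: measurable_ratio_int.
- apply/measurable_EFinP; apply: measurable_funM => //; apply: measurable_funM; last exact: measurable_le_ind.
  by apply: measurableT_comp => //; exact: measurableT_comp.
- apply: aeW => v _; apply: cvg_EFin; first by near=> n.
  have cpow : {for (1 : R), continuous (@powR R ^~ (al - 1))}.
    apply: differentiable_continuous; apply/derivable1_diffP.
    by apply: derivable_powR; rewrite in_itv/= andbT ltr01.
  have c1 : (fun n => (u' n + v) / u' n) @ \oo --> (1 : R).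
    have -> : (fun n => (u' n + v) / u' n) = (fun n => 1 + v * (u' n)^-1).
      by apply/funext => n; rewrite mulrDl divff// gt_eqF.
    rewrite -[X in _ --> X]addr0; apply: cvgD; first exact: cvg_cst.
    rewrite -[X in _ --> X](mulr0 v); apply: cvgM; first exact: cvg_cst.
    by apply/gtr0_cvgV0 => //; near=> n; exact: u'0.
  have c2 : (fun n => ((u' n + v) / u' n) `^ (al - 1)) @ \oo --> (1 : R).
    have := cvg_comp _ _ c1 cpow; rewrite powR1; exact.
  rewrite /ratio_int; apply: cvgM; first exact: cvg_cst.
  rewrite -[X in _ --> X]mul1r; apply: cvgM; [exact: c2|exact: cvg_cst].
- exact: integrable_half_exp.
- apply: aeW => v n _; have /andP[h1 h2] := ratio_int_bound v (u'1 n).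
  by rewrite gee0_abs lee_fin.
have Ka0 : 0 <= K * al by rewrite mulr_ge0// ltW.
pose g (v : measurableTypeR R) : R := expR (- v) * (0 <= v)%R%:R.
have mg : measurable_fun setT g.
  apply: measurable_funM; last exact: measurable_le_ind.
  by apply: measurableT_comp => //; exact: measurableT_comp.
have g0 v : 0 <= g v by rewrite mulr_ge0// expR_ge0.
rewrite (ge0_integralZR leb mg g0 Ka0) (integral_exp_tail 0) oppr0 expR0 mule1 => cv.
have {}cv : (fun n => (expR (u' n) * u' n `^ (1 - al) * tailp (u' n))%:E) @ \oo --> (K * al)%:E.
  by under eq_fun do rewrite chisq_tail_ratio//.
by move/fine_cvgP : cv => [].
Unshelve. all: by end_near.
Qed.

(** Serves as a domination, so it must hold for every u, including negative ones, where the tail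
    probability is merely at most 1; hence the maximum with 1. *)
Lemma chisq_tail_bound : exists2 C : R, 0 < C &
  forall u, expR u * tailp u <= C * Num.max u 1 `^ (al - 1).
Proof.
have Ka0 : 0 <= K * al by rewrite mulr_ge0// ltW.
have Cb0 : 0 <= Cb by rewrite exprn_ge0.
exists (expR 1 + K * al * Cb * 2); first by rewrite ltr_wpDr ?expR_gt0// !mulr_ge0.
move=> u; have [u1|u1] := leP 1 u; last first.
  rewrite powR1 mulr1; apply: (@le_trans _ _ (expR 1 * 1)).
    by apply: ler_pM; rewrite ?expR_ge0 ?tailp_ge0 ?tailp_le1// ler_expR ltW.
  by rewrite mulr1 lerDl !mulr_ge0.
have u0 : 0 < u by exact: lt_le_trans u1.
have : expR u * u `^ (1 - al) * tailp u <= K * al * Cb * 2.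
  rewrite -lee_fin chisq_tail_ratio//.
  have mf : measurable_fun setT (fun v : measurableTypeR R => expR (- (v / 2)) * (0 <= v)%R%:R).
    apply: measurable_funM; last exact: measurable_le_ind.
    apply: measurableT_comp => //; apply: measurableT_comp => //.
    exact: measurable_funM.
  have f0 (v : measurableTypeR R) : 0 <= expR (- (v / 2)) * (0 <= v)%R%:R by rewrite mulr_ge0// expR_ge0.
  rewrite EFinM -integral_half_exp -(ge0_integralZR leb mf f0 (mulr_ge0 Ka0 Cb0)).
  apply: ge0_le_integral => //.
  - by move=> v _; rewrite lee_fin; have /andP[] := ratio_int_bound v u1.
  - by apply/measurable_EFinP; exact: measurable_ratio_int.
  - by apply/measurable_EFinP; exact: measurable_funM.
  - by move=> v _; rewrite lee_fin; have /andP[] := ratio_int_bound v u1.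
have p0 : 0 < u `^ (al - 1) by exact: powR_gt0.
have -> : u `^ (1 - al) = (u `^ (al - 1))^-1 by rewrite -powRN opprB.
rewrite mulrAC ler_pdivrMr// => h; apply: (le_trans h); apply: ler_wpM2r; first exact: ltW.
by rewrite lerDr expR_ge0.
Qed.

End chi_square_tail.

(** * Small balls of positive quadratic forms *)

Section small_ball.
Context (R : realType).

Lemma sqrtr_prod (I : finType) (Q : pred I) (F : I -> R) : (forall i, Q i -> 0 <= F i) ->
  Num.sqrt (\prod_(i | Q i) F i) = \prod_(i | Q i) Num.sqrt (F i).
Proof.
move=> F0; elim/big_rec2 : _ => [|i y x Qi <-]; first by rewrite sqrtr1.
by rewrite sqrtrM// F0.
Qed.

Lemma measurable_qform k (b : 'I_k -> R) : measurable_fun setT (qform b : coordT R 'I_k -> R).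
Proof.
apply: measurable_sum => j; apply: measurable_funM => //.
by apply: measurable_funX; exact: measurable_coord.
Qed.

Lemma measurable_qform_comp d (T : measurableType d) (P : probability T R) k
    (Y : T -> 'I_k -> R) (b : 'I_k -> R) : gaussfam P Y ->
  measurable_fun setT (fun t => qform b (Y t) / 2).
Proof.
move=> gY; apply: measurable_funM => //.
exact: (measurableT_comp (measurable_qform b) (iid_measurable gY)).
Qed.

Lemma measurable_le_set d (T : measurableType d) (f : T -> R) c :
  measurable_fun setT f -> measurable [set t | f t <= c].
Proof.
move=> mf; rewrite -[X in measurable X]setTI.
have := mf measurableT _ (@measurable_itv R `]-oo, c]).
by congr (measurable (_ `&` _)); apply/seteqP; split => x /=; rewrite in_itv/=.
Qed.

Lemma measurable_lt_set d (T : measurableType d) (f : T -> R) c :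
  measurable_fun setT f -> measurable [set t | c < f t].
Proof.
move=> mf; rewrite -[X in measurable X]setTI.
have := mf measurableT _ (@measurable_itv R `]c, +oo[).
by congr (measurable (_ `&` _)); apply/seteqP; split => x /=; rewrite in_itv/= andbT.
Qed.

Context d (T : measurableType d) (P : probability T R) (k : nat) (Y : T -> 'I_k -> R)
  (b : 'I_k -> R).
Hypotheses (gY : gaussfam P Y) (k0 : (0 < k)%N) (b0 : forall j, 0 < b j).
Let V t := qform b (Y t) / 2.
Let Z t := sq (Y t) / 2.
Let al : R := k%:R / 2.

(** Scaling coordinate j by b_j^(-1/2) turns V into Z, at the price of a density factor exp(ex). On
    V <= r its exponent is O(r), because each Y_j^2/2 is at most V/b_j. The Jacobian is the product
    of the square roots of the b_j. *)
Lemma small_ball_bounds : exists2 C : R, 0 <= C & forall r, 0 < r ->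
  expR (- (C * r)) * ((GammaR al * al)^-1 / \prod_j Num.sqrt (b j) * r `^ al) <=
    fine (P [set t | (V t <= r)%R]) <=
  expR (C * r) * ((GammaR al * al)^-1 / \prod_j Num.sqrt (b j) * r `^ al).
Proof.
pose C0 := \sum_j `|1 - b j| / b j.
have C00 : 0 <= C0 by apply: sumr_ge0 => j _; rewrite divr_ge0// ltW.
have J0 : (0 < #|'I_k|)%N by rewrite card_ord.
have al0 : 0 < al by rewrite divr_gt0// ltr0n.
pose K := chisqK P Y.
have [G0 KE] := chisq_gamma gY J0; rewrite card_ord -/al -/K in G0 KE.
have {}KE : K = (GammaR al * al)^-1.
  by rewrite invfM -KE mulfK// gt_eqF.
have mV : measurable_fun setT V by exact: (measurable_qform_comp b gY).
have mZ : measurable_fun setT Z by exact: measurable_halfsq gY.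
(* [C0] controls the tilt exponent on the ball; the extra 1 accounts for exp(Z) <= exp(r), which
   separates P(Z <= r) from the exactly homogeneous mass K r^al. *)
exists (C0 + 1) => [|r r0]; first by rewrite addr_ge0.
pose c j := (Num.sqrt (b j))^-1.
have sb j : 0 < Num.sqrt (b j) by rewrite sqrtr_gt0.
have c0 j : 0 < c j by rewrite invr_gt0.
have c2 j : (c j)^-2 = b j by rewrite /c exprVn invrK sqr_sqrtr// ltW.
pose f (x : coordT R 'I_k) : \bar R := ((qform b x / 2 <= r)%R%:R : R)%:E.
have mf : measurable_fun setT f.
  apply/measurable_EFinP; apply: measurable_le_ind => //.
  by apply: measurable_funM => //; exact: measurable_qform.
have := gauss_tilt gY c0 mf (fun x => _ : (0 <= f x)%E).
have f0 x : (0 <= f x)%E by rewrite lee_fin.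
move=> /(_ f0) tilt.
have PZ : P [set t | (Z t <= r)%R] = (\int[P]_t f (fun i => (c i * Y t i)%R))%E.
  rewrite -integral_prop; last exact: measurable_le_set.
  apply: eq_integral => t _; congr ((_ <= r)%R%:R)%:E; rewrite /Z; congr (_ / 2).
  apply: eq_bigr => j _; rewrite exprMn mulrA -c2 mulVf ?mul1r//.
  by rewrite expf_neq0// gt_eqF.
pose pV := fine (P [set t | (V t <= r)%R]).
have pVE : P [set t | (V t <= r)%R] = pV%:E by rewrite fineK// fin_num_measure//; exact: measurable_le_set.
pose pZ := fine (P [set t | (Z t <= r)%R]).
have pZE : P [set t | (Z t <= r)%R] = pZ%:E by rewrite fineK// fin_num_measure//; exact: measurable_le_set.
have IV : (\int[P]_t (f (Y t)) = pV%:E)%E.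
  by rewrite -pVE -integral_prop//; exact: measurable_le_set.
have pV0 : 0 <= pV by rewrite fine_ge0.
pose ex t := \sum_i Y t i ^+ 2 / 2 * (1 - (c i)^-2).
have exb t : V t <= r -> `|ex t| <= C0 * r.
  move=> Vr; apply: (@le_trans _ _ (C0 * V t)); last exact: ler_wpM2l.
  apply: (le_trans (ler_norm_sum _ _ _)); rewrite /C0 mulr_suml; apply: ler_sum => j _.
  rewrite normrM ger0_norm; last by rewrite divr_ge0// sqr_ge0.
  rewrite c2 mulrC -mulrA; apply: ler_wpM2l => //.
  rewrite ler_pdivlMl// /V /qform mulr_suml (bigD1 j)//= mulrA lerDl.
  by apply: sumr_ge0 => i _; rewrite divr_ge0// mulr_ge0 ?sqr_ge0// ltW.
pose D := (\prod_i c i)^-1.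
have DE : D = \prod_j Num.sqrt (b j).
  by rewrite /D /c prodfV invrK.
have D0 : 0 < D by rewrite DE prodr_gt0.
have mex : measurable_fun setT (fun t => expR (ex t)).
  apply: measurableT_comp => //; apply: measurable_sum => i; apply: measurable_funM => //.
  by apply: measurable_funM => //; apply: measurable_funX; exact: gY.1.
have mfY : measurable_fun setT (fun t => f (Y t)) by exact: (measurableT_comp mf (iid_measurable gY)).
have mI : measurable_fun setT (fun t => (f (Y t) * (expR (ex t))%:E)%E).
  by apply: emeasurable_funM => //; exact/measurable_EFinP.
have tiltE : (pZ%:E = D%:E * \int[P]_t (f (Y t) * (expR (ex t))%:E))%E by rewrite -pZE PZ tilt.
have I_le : (\int[P]_t (f (Y t) * (expR (ex t))%:E) <= (expR (C0 * r) * pV)%:E)%E.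
  rewrite EFinM -IV -ge0_integralZl//.
  apply: ge0_le_integral => //.
  - by move=> t _; rewrite mule_ge0// ?lee_fin ?expR_ge0.
  - exact: emeasurable_funM.
  move=> t _; rewrite /f -!EFinM lee_fin -/(V t); case: (leP (V t) r) => h; last by rewrite mul0r mulr0.
  by rewrite mul1r mulr1 ler_expR; apply: le_trans (exb _ h); exact: ler_norm.
have I_ge : ((expR (- (C0 * r)) * pV)%:E <= \int[P]_t (f (Y t) * (expR (ex t))%:E))%E.
  rewrite EFinM -IV -ge0_integralZl//.
  apply: ge0_le_integral => //.
  - by move=> t _; rewrite mule_ge0// ?lee_fin ?expR_ge0.
  - exact: emeasurable_funM.
  move=> t _; rewrite /f -!EFinM lee_fin -/(V t); case: (leP (V t) r) => h; last by rewrite mul0r mulr0.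
  rewrite mul1r mulr1 ler_expR lerNl; apply: le_trans (exb _ h); rewrite -normrN; exact: ler_norm.
have Zle : pZ <= K * r `^ al.
  by rewrite -lee_fin -pZE; have := prob_halfsq_le gY r0; rewrite card_ord.
have Zge : K * r `^ al * expR (- r) <= pZ.
  have h : ((K * r `^ al)%:E <= (expR r)%:E * pZ%:E)%E.
    have := exp_trunc_homogeneous gY r0; rewrite card_ord => <-.
    rewrite -pZE -integral_prop; last exact: measurable_le_set.
    rewrite -ge0_integralZR//; last exact: measurable_le_ind.
    apply: ge0_le_integral => //.
    - exact: measurable_exp_trunc gY _.
    - by apply/measurable_EFinP; apply: measurable_funM => //; exact: measurable_le_ind.
    move=> t _; rewrite lee_fin; case: (leP (Z t) r) => h; last by rewrite !mulr0.
    by rewrite !mulr1 ler_expR.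
  move: h; rewrite -EFinM lee_fin => h.
  by rewrite expRN ler_pdivrMr ?expR_gt0// [leRHS]mulrC.
have [J1 J1E] : exists J1 : R, (\int[P]_t (f (Y t) * (expR (ex t))%:E) = J1%:E)%E.
  exists (fine (\int[P]_t (f (Y t) * (expR (ex t))%:E)))%E; rewrite fineK// ge0_fin_numE.
    exact: le_lt_trans I_le (ltry _).
  by apply: integral_ge0 => t _; rewrite mule_ge0// ?lee_fin ?expR_ge0.
rewrite J1E lee_fin in I_le; rewrite J1E lee_fin in I_ge; rewrite J1E -EFinM in tiltE; case: tiltE => tiltE.
rewrite -/pV -KE -DE.
set A := K / D * r `^ al.
have AE : A = K * r `^ al / D by rewrite /A mulrAC.
have A0 : 0 <= A by rewrite AE divr_ge0 ?mulr_ge0 ?powR_ge0 ?(ltW D0)// chisqK_ge0.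
clearbody D; have Dn0 : D != 0 by rewrite gt_eqF.
have J1p : J1 = pZ / D by rewrite tiltE [D * J1]mulrC mulfK.
have iD0 : 0 < D^-1 by rewrite invr_gt0.
have u1 : J1 <= A by rewrite J1p AE ler_pM2r.
have u2 : A * expR (- r) <= J1.
  by rewrite J1p AE mulrAC ler_pM2r.
have eC : expR ((C0 + 1) * r) = expR (C0 * r) * expR r by rewrite -expRD; congr expR; ring.
apply/andP; split.
  rewrite expRN eC ler_pdivrMl ?mulr_gt0 ?expR_gt0//.
  have : A <= expR r * J1 by move: u2; rewrite expRN ler_pdivrMr ?expR_gt0// mulrC.
  move=> h; apply: (le_trans h); rewrite mulrAC mulrC; apply: ler_wpM2r; first exact: expR_ge0.
  exact: I_le.
apply: (@le_trans _ _ (expR (C0 * r) * A)).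
  move: I_ge; rewrite expRN ler_pdivrMl ?expR_gt0// => h; apply: (le_trans h).
  by apply: ler_wpM2l => //; exact: expR_ge0.
apply: ler_wpM2r => //; rewrite ler_expR; apply: ler_wpM2r; first exact: ltW.
by rewrite lerDl.
Qed.

Lemma small_ball_cvg (r : nat -> R) : (forall n, 0 < r n) -> r @ \oo --> (0 : R) ->
  (fun n => fine (P [set t | (V t <= r n)%R]) / r n `^ al) @ \oo -->
    (GammaR al * al)^-1 / \prod_j Num.sqrt (b j).
Proof.
move=> r0 rc; have [C C0 H] := small_ball_bounds.
set L := _ / _.
have cexp (s : R) : (fun n => expR (s * (C * r n)) * L) @ \oo --> L.
  rewrite -[X in _ --> X]mul1r -expR0; apply: cvgM; last exact: cvg_cst.
  have c1 : (fun n => s * (C * r n)) @ \oo --> (0 : R).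
    have -> : 0 = s * (C * 0) :> R by rewrite !mulr0.
    apply: cvgM; first exact: cvg_cst.
    by apply: cvgM => //; exact: cvg_cst.
  exact: (cvg_comp _ _ c1 (@continuous_expR R 0)).
apply: (squeeze_cvgr _ (cexp (-1)) (cexp 1)); near=> n.
have p0 : 0 < r n `^ al by exact: powR_gt0.
have /andP[h1 h2] := H _ (r0 n).
rewrite ler_pdivlMr// ler_pdivrMr// mulN1r mul1r -!mulrA.
by rewrite /L; move: h1 h2; rewrite -!mulrA => -> ->.
Unshelve. all: by end_near.
Qed.

End small_ball.

(** * Tails of quadratic forms *)

Section qform_tail.
Context (R : realType) d (T : measurableType d) (P : probability T R) (k : nat)
  (Y : T -> 'I_k -> R).
Hypothesis gY : gaussfam P Y.

Lemma exp_qform_moment (b : 'I_k -> R) : (forall j, b j < 1) ->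
  (\int[P]_t (expR (qform b (Y t) / 2))%:E = (\prod_j (Num.sqrt (1 - b j))^-1)%:E)%E.
Proof.
move=> b1; have s0 j : 0 < Num.sqrt (1 - b j) by rewrite sqrtr_gt0 subr_gt0.
rewrite -(gauss_exp_moment gY); last by move=> j; rewrite invr_gt0.
apply: eq_integral => t _; congr (expR _)%:E; rewrite /qform mulr_suml.
apply: eq_bigr => j _; rewrite exprVn invrK sqr_sqrtr ?subr_ge0 ?(ltW (b1 j))//.
by field.
Qed.

(** Finitely many coefficients below 1 stay below 1 after a common small dilation; this slack
    provides exponential moments of order slightly above 1. *)
Lemma gap_exists (b : 'I_k -> R) : exists2 dl : R, 0 < dl <= 1 &
  forall j, b j < 1 -> (1 + dl) * b j < 1.
Proof.
have : \forall dl \near (0 : R)^'+, forall j, b j < 1 -> (1 + dl) * b j < 1.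
  apply: filter_forall => j; have [bj|bj] := ltP (b j) 1; last by near=> dl.
  near=> dl => _.
  have n0 : 0 < `|b j| + 1 by rewrite ltr_wpDl.
  have h : dl < (1 - b j) / (`|b j| + 1).
    by near: dl; apply: nbhs_right_lt; rewrite divr_gt0// subr_gt0.
  have dl0 : 0 < dl by [].
  rewrite ltr_pdivlMr// in h; have := ler_norm (b j); nra.
move=> h; have [dl [h1 h2 h3]] : exists dl : R, [/\ 0 < dl, dl < 1 &
    forall j, b j < 1 -> (1 + dl) * b j < 1].
  near (0 : R)^'+ => dl; exists dl; split.
  - by [].
  - by near: dl; apply: nbhs_right_lt.
  - by near: dl.
by exists dl => //; rewrite h1 ltW.
Unshelve. all: by end_near.
Qed.

(* Chernoff: when every coefficient is below 1, the tail beats e^(-s) exponentially. *)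
Lemma qform_tail_lt1 (b : 'I_k -> R) (p : R) (s : nat -> R) : (forall j, b j < 1) ->
  s @ \oo --> +oo ->
  (fun n => expR (s n) * s n `^ p * fine (P [set t | (s n < qform b (Y t) / 2)%R])) @ \oo --> 0.
Proof.
move=> b1 soo; have [dl /andP[d0 d1] hd] := gap_exists b.
pose K := \prod_j (Num.sqrt (1 - (1 + dl) * b j))^-1.
have K0 : 0 <= K by apply: prodr_ge0 => j _; rewrite invr_ge0 sqrtr_ge0.
have mV c : measurable_fun setT (fun t => qform c (Y t) / 2) by exact: (measurable_qform_comp c gY).
have pb u : fine (P [set t | (u < qform b (Y t) / 2)%R]) <= K * expR (- ((1 + dl) * u)).
  have mS := measurable_lt_set u (mV b).
  rewrite expRN ler_pdivlMr ?expR_gt0// mulrC -lee_fin EFinM fineK ?fin_num_measure//.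
  have := exp_qform_moment (b := fun j => (1 + dl) * b j) (fun j => hd j (b1 j)); rewrite -/K => <-.
  rewrite -integral_prop// -ge0_integralZR ?expR_ge0//; last exact: measurable_lt_ind.
  apply: ge0_le_integral => //.
  - apply/measurable_EFinP; apply: measurable_funM => //; exact: measurable_lt_ind.
  - by apply/measurable_EFinP; apply: measurableT_comp.
  move=> t _; rewrite lee_fin; case: (ltP u (qform b (Y t) / 2)) => h; last by rewrite mulr0 expR_ge0.
  rewrite mulr1 ler_expR.
  have -> : qform (fun j => (1 + dl) * b j) (Y t) / 2 = (1 + dl) * (qform b (Y t) / 2).
    by rewrite /qform !mulr_suml mulr_sumr; apply: eq_bigr => j _; ring.
  by rewrite ler_pM2l ?(ltW h)//; lra.
pose n0 := (Num.truncn `|p|).+1.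
have pn : `|p| <= n0%:R by apply: ltW; apply: truncnS_gt.
(* Half of the excess rate [dl] absorbs the power of s, the other half drives the bound to 0. *)
pose C := K * (n0.+1%:R / (dl / 2)) ^+ n0 * expR (dl / 2).
have lim0 : (fun n => C * expR (- (dl / 2 * s n))) @ \oo --> 0.
  rewrite -[X in _ --> X](mulr0 C); apply: cvgM; first exact: cvg_cst.
  have c1 : (fun n => dl / 2 * s n) @ \oo --> +oo.
    have dl2 : 0 < dl / 2 by rewrite divr_gt0.
    apply/cvgryPge => A; move/cvgryPge: soo => /(_ (A / (dl / 2))); apply: filterS => n.
    by rewrite ler_pdivrMr// mulrC.
  exact: (cvg_comp _ _ c1 (@cvgr_expR R)).
apply: (squeeze_cvgr _ (cvg_cst 0) lim0); near=> n.
have s1 : 1 <= s n by near: n; move/cvgryPge: soo; exact.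
have s0 : 0 < s n by exact: lt_le_trans s1.
apply/andP; split; first by rewrite !mulr_ge0 ?expR_ge0 ?powR_ge0 ?fine_ge0.
apply: (le_trans (ler_wpM2l _ (pb (s n)))); first by rewrite mulr_ge0 ?expR_ge0 ?powR_ge0.
have h1 : s n `^ p <= (1 + s n) ^+ n0.
  apply: powR_ratio_bound => //; first exact: ltW.
  apply/andP; split; last by rewrite lerDr.
  by rewrite (le_trans _ s1)// invf_le1 ?lerDl ?(ltW s0)// ltr_pwDl ?ltW.
have h2 : (1 + s n) ^+ n0 <= (n0.+1%:R / (dl / 2)) ^+ n0 * expR (dl / 2 * s n).
  apply: exprn_le_expR; first exact: ltW.
  by apply/andP; split; lra.
have e1 : expR (s n) * expR (- ((1 + dl) * s n)) = expR (- (dl * s n)).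
  by rewrite -expRD; congr expR; ring.
rewrite (_ : _ * _ * _ = K * s n `^ p * expR (- (dl * s n))); last by rewrite -e1; ring.
have e2 : expR (- (dl / 2 * s n)) = expR (- (dl * s n)) * expR (dl / 2 * s n).
  by rewrite -expRD; congr expR; field.
rewrite /C e2.
have e3 : 1 <= expR (dl / 2) by rewrite -[leLHS]expR0 ler_expR; lra.
rewrite -!mulrA; apply: ler_wpM2l => //.
apply: (@le_trans _ _ ((n0.+1%:R / (dl / 2)) ^+ n0 * (expR (- (dl * s n)) * expR (dl / 2 * s n)))).
  rewrite [_ * expR (dl / 2 * s n)]mulrC mulrA; apply: ler_wpM2r; first exact: expR_ge0.
  exact: le_trans h2.
apply: ler_wpM2l; first by rewrite exprn_ge0// divr_ge0//; lra.
by rewrite (mulrA dl); apply: ler_peMl => //; rewrite mulr_ge0 ?expR_ge0.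
Unshelve. all: by end_near.
Qed.

End qform_tail.

Section qform_tail_max.
Context (R : realType) d (T : measurableType d) (P : probability T R) (k : nat)
  (Y : T -> 'I_k -> R) (b : 'I_k -> R).
Hypotheses (gY : gaussfam P Y) (b1 : forall j, b j <= 1).
Let J := [pred j | b j == 1].
Let YJ t (j : {j | J j}) := Y t (val j).
Let m := #|[pred j | b j == 1]|.
Hypothesis m0 : (0 < m)%N.
Let b' j := if J j then 0 else b j.
Let V t := qform b' (Y t) / 2.
Let al : R := m%:R / 2.

Let cardJ : #|{: {j | J j}}| = m.
Proof. by rewrite card_sig. Qed.

Let gYJ : gaussfam P YJ.
Proof. exact: (iid_sub (h := val) val_inj gY). Qed.

Let b'1 j : b' j < 1.
Proof. by rewrite /b'; case: ifPn => //= bj; rewrite lt_neqAle bj b1. Qed.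

Let mV : measurable_fun setT V.
Proof. exact: (measurable_qform_comp b' gY). Qed.

(* Conditioning on the coordinates whose coefficient is below 1. *)
Lemma qform_tail_cond s : P [set t | (s < qform b (Y t) / 2)%R] =
  (\int[P]_t (tailp P YJ (s - V t))%:E)%E.
Proof.
pose X (z : T * T) i := if ~~ J i then Y z.1 i else Y z.2 i.
have gX : gaussfam (P \x P)%E X by exact: (iid_mix (fun i => ~~ J i) gY gY).
pose A := [set y : coordT R 'I_k | s < qform b y / 2].
have mA : measurable A.
  by apply: measurable_lt_set; apply: measurable_funM => //; exact: measurable_qform.
have -> : P [set t | s < qform b (Y t) / 2] = P (Y @^-1` A) by [].
apply: (etrans (iid_law gY gX mA)).
rewrite [LHS](_ : _ = (\int[P]_x (P (xsection (X @^-1` A) x)))%E)//.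
apply: eq_integral => t _; rewrite -(tailpE gYJ); congr (P _).
have E t' : qform b (X (t, t')) / 2 = V t + sq (YJ t') / 2.
  rewrite -mulrDl /qform (bigID J)/= addrC; congr ((_ + _) / 2).
    rewrite [RHS](bigID J)/= [X in X + _]big1 ?add0r; last by move=> j; rewrite /b' /= => ->; rewrite mul0r.
    by apply: eq_bigr => j bj; rewrite /b' /X /= bj (negbTE bj).
  rewrite /sq big_sub; apply: eq_bigr => -[j bj] _; have bj1 : b j == 1 by [].
  by rewrite /X /YJ /= bj1/= (eqP bj1) mul1r.
by rewrite xsectionE; apply/seteqP; split => t' /=; rewrite /A /= E ltrBlDl.
Qed.

Lemma exp_scaled_moment (l : R) : (forall j, l * b' j < 1) ->
  (\int[P]_t (expR (l * V t))%:E = (\prod_j (Num.sqrt (1 - l * b' j))^-1)%:E)%E.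
Proof.
move=> h; rewrite -(exp_qform_moment gY h); apply: eq_integral => t _; congr (expR _)%:E.
by rewrite /V /qform !mulr_suml mulr_sumr; apply: eq_bigr => j _; ring.
Qed.

Lemma integrable_exp_qform (l c : R) : (forall j, l * b' j < 1) ->
  P.-integrable setT (fun t => (c * expR (l * V t))%:E).
Proof.
move=> h; have mE : measurable_fun setT (fun t => expR (l * V t)).
  by apply: measurableT_comp => //; exact: measurable_funM.
have -> : (fun t => (c * expR (l * V t))%:E) = (fun t => c%:E * (expR (l * V t))%:E)%E by [].
apply: integrableZl => //; apply/integrableP; split; first exact/measurable_EFinP.
rewrite [X in (X < _)%E](_ : _ = \int[P]_t (expR (l * V t))%:E)%E.
  by rewrite exp_scaled_moment// ltry.
by apply: eq_integral => t _; rewrite gee0_abs ?lee_fin ?expR_ge0.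
Qed.

(** The coordinates with coefficient 1 form a chi-square independent of V, whose tail at s - V is
    asymptotically exp(V) times that at s. Averaging exp(V) produces the product of the (1 -
    b_j)^(-1/2) over the other coordinates. *)
Lemma qform_tail_max_cvg (s : nat -> R) : s @ \oo --> +oo ->
  (fun n => expR (s n) * s n `^ (1 - al) * fine (P [set t | (s n < qform b (Y t) / 2)%R]))
   @ \oo --> (GammaR al * Num.sqrt (\prod_(j | b j != 1) (1 - b j)))^-1.
Proof.
move=> soo; pose u n := Num.max (s n) 1.
have u1 n : 1 <= u n by rewrite le_max lexx orbT.
have u0 n : 0 < u n by apply: lt_le_trans (u1 n).
have uoo : u @ \oo --> +oo.
  apply/cvgryPge => A; move/cvgryPge: soo => /(_ A); apply: filterS => n /= h.
  by rewrite le_max h.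
suff : (fun n => expR (u n) * u n `^ (1 - al) * fine (P [set t | (u n < qform b (Y t) / 2)%R]))
   @ \oo --> (GammaR al * Num.sqrt (\prod_(j | b j != 1) (1 - b j)))^-1.
  apply: cvg_trans; apply: near_eq_cvg; move/cvgryPge: soo => /(_ 1); apply: filterS => n /= h.
  by rewrite /u; have /max_idPl -> : 1 <= s n by [].
have J0 : (0 < #|{: {j | J j}}|)%N by rewrite cardJ.
have [C C0 hC] := chisq_tail_bound gYJ J0.
have [G0 _] := chisq_gamma gYJ J0.
have hcv := chisq_tail_cvg gYJ J0.
rewrite cardJ -/al in hC G0 hcv.
have [dl /andP[d0 d1] hd] := gap_exists b'.
pose Kd := (m.+1%:R / dl) ^+ m.
have Kd0 : 0 <= Kd by rewrite exprn_ge0// divr_ge0// ltW.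
pose f n t := expR (u n) * u n `^ (1 - al) * tailp P YJ (u n - V t).
have ft x t : expR (u x) * tailp P YJ (u x - V t) = expR (V t) * (expR (u x - V t) * tailp P YJ (u x - V t)).
  by rewrite mulrA -expRD [V t + _]addrC subrK.
have f0 n t : 0 <= f n t by rewrite !mulr_ge0 ?expR_ge0 ?powR_ge0 ?tailp_ge0.
have mtail : measurable_fun setT (tailp P YJ).
  apply: nonincreasing_measurable => // x y xy; rewrite -lee_fin -!(tailpE gYJ).
  by apply: le_measure; rewrite ?classical_sets.inE; [exact: measurable_lt_set (measurable_halfsq gYJ)..|move=> t /=; exact: le_lt_trans].
have mf n : measurable_fun setT (f n).
  apply: measurable_funM => //; apply: measurableT_comp => //.
  exact: measurable_funB.
(* The two exponentials together dominate exp(V + dl |V|) for either sign of V. The choice of [dl]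
   keeps (1 + dl) b'_j < 1, which makes both integrable. *)
have := @dominated_convergence _ _ R P setT measurableT
  (fun n t => (f n t)%:E) (fun t => ((GammaR al)^-1 * expR (1 * V t))%:E)
  (fun t => ((C * Kd) * expR ((1 + dl) * V t))%:E + ((C * Kd) * expR ((1 - dl) * V t))%:E)%E.
have hl (l : R) j : 0 <= l -> l <= 1 + dl -> l * b' j < 1.
  move=> l0 l1; have [bj|bj] := leP (b' j) 0; first by nra.
  by have := hd j (b'1 j); nra.
case=> [|||||_ _].
- by move=> n; exact/measurable_EFinP.
- apply/measurable_EFinP; apply: measurable_funM => //; apply: measurableT_comp => //.
  exact: measurable_funM.
- apply: aeW => t _; apply: cvg_EFin; first by near=> n.
  have voo : (fun n => u n - V t) @ \oo --> +oo.
    apply/cvgryPge => A; move/cvgryPge: uoo => /(_ (A + V t)); apply: filterS => n /= h.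
    by rewrite lerBrDr.
  have cpow : {for (1 : R), continuous (@powR R ^~ (1 - al))}.
    apply: differentiable_continuous; apply/derivable1_diffP.
    by apply: derivable_powR; rewrite in_itv/= andbT ltr01.
  have c1 : (fun n => u n / (u n - V t)) @ \oo --> (1 : R).
    have c0 : (fun n => 1 + V t * (u n - V t)^-1) @ \oo --> (1 : R).
      rewrite -[X in _ --> X]addr0; apply: cvgD; first exact: cvg_cst.
      rewrite -[X in _ --> X](mulr0 (V t)); apply: cvgM; first exact: cvg_cst.
      apply/gtr0_cvgV0 => //; move/cvgryPgt: voo; exact.
    apply: cvg_trans c0; apply: near_eq_cvg; move/cvgryPgt: voo => /(_ 0); apply: filterS => n /= h.
    by field; rewrite gt_eqF.
  have c2 : (fun n => (u n / (u n - V t)) `^ (1 - al)) @ \oo --> (1 : R).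
    have := cvg_comp _ _ c1 cpow; rewrite powR1; exact.
  have c3 : (fun n => expR (u n - V t) * (u n - V t) `^ (1 - al) * tailp P YJ (u n - V t) *
      (u n / (u n - V t)) `^ (1 - al) * expR (V t)) @ \oo --> (GammaR al)^-1 * expR (V t).
    rewrite -[(GammaR al)^-1]mulr1; apply: cvgM; last exact: cvg_cst.
    by apply: cvgM; [exact: hcv|exact: c2].
  rewrite mul1r; suff : (fun n => f n t) @ \oo --> (GammaR al)^-1 * expR (V t) by [].
  apply: cvg_trans c3; apply: near_eq_cvg.
  move/cvgryPgt: voo => /(_ 0); apply: filterS => n /= h.
  have up : u n `^ (1 - al) = (u n / (u n - V t)) `^ (1 - al) * (u n - V t) `^ (1 - al).
    by rewrite -powRM ?divr_ge0 ?(ltW h) ?(ltW (u0 n))// divfK// gt_eqF.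
  by rewrite /f [in RHS]mulrAC ft up; ring.
- by apply: integrableD => //; apply: integrable_exp_qform => j; apply: hl; lra.
- apply: aeW => t n _ /=; rewrite lee_fin ger0_norm//.
  pose w := `|V t|; have w0 : 0 <= w by exact: normr_ge0.
  have Vw : V t <= w /\ - V t <= w by split; [exact: ler_norm|rewrite /w -normrN; exact: ler_norm].
  pose M := Num.max (u n - V t) 1.
  have M1 : 1 <= M by rewrite le_max lexx orbT.
  have M2 : u n - V t <= M by rewrite le_max lexx.
  have M3 : M <= u n + w by rewrite ge_max; have := u1 n; case: Vw => ? ? ?; apply/andP; split; lra.
  have M0 : 0 < M by exact: lt_le_trans M1.
  have rb : (M / u n) `^ (al - 1) <= (1 + w) ^+ m.
    apply: powR_ratio_bound => //.
      rewrite ler_pdivrMr// ler_pdivlMr// mulrC ler_pdivrMr ?ltr_pwDl//.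
      by have := u1 n; case: Vw => ? ? ?; apply/andP; split; nra.
    rewrite ler_norml /al; have : 1 <= m%:R :> R by rewrite ler1n.
    by move=> ?; apply/andP; split; lra.
  have eb : (1 + w) ^+ m <= Kd * expR (dl * w) by apply: exprn_le_expR => //; rewrite d0 d1.
  have ew : expR (V t) * expR (dl * w) <= expR ((1 + dl) * V t) + expR ((1 - dl) * V t).
    rewrite -expRD /w; case: (ler0P (V t)) => _.
      by rewrite -[leLHS]add0r; apply: lerD; rewrite ?expR_ge0// ler_expR; lra.
    by rewrite -[leLHS]addr0; apply: lerD; rewrite ?expR_ge0// ler_expR; lra.
  have up : 0 < u n `^ (al - 1) by exact: powR_gt0.
  have Mp : M `^ (al - 1) = (M / u n) `^ (al - 1) * u n `^ (al - 1).
    by rewrite -powRM ?divr_ge0 ?(ltW M0) ?(ltW (u0 n))// divfK// gt_eqF.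
  have hh := hC (u n - V t); rewrite -/M Mp in hh.
  rewrite /f mulrAC ft.
  have -> : u n `^ (1 - al) = (u n `^ (al - 1))^-1 by rewrite -powRN opprB.
  rewrite ler_pdivrMr//.
  apply: (le_trans (ler_wpM2l (expR_ge0 _) hh)).
  have -> : expR (V t) * (C * ((M / u n) `^ (al - 1) * u n `^ (al - 1))) =
     C * (expR (V t) * (M / u n) `^ (al - 1)) * u n `^ (al - 1) by ring.
  apply: ler_wpM2r; first exact: ltW.
  rewrite -mulrDr -mulrA; apply: ler_wpM2l; first exact: ltW.
  apply: (le_trans (ler_wpM2l (expR_ge0 _) (le_trans rb eb))).
  by rewrite mulrCA; exact: ler_wpM2l.
move=> cv.
have e1 : (\int[P]_t ((GammaR al)^-1 * expR (1 * V t))%:E)%E =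
    ((GammaR al * Num.sqrt (\prod_(j | b j != 1) (1 - b j)))^-1)%:E.
  rewrite ge0_integralZR ?invr_ge0 ?(ltW G0)//; last first.
    by apply: measurableT_comp => //; exact: measurable_funM.
  rewrite exp_scaled_moment => [|j]; last by rewrite mul1r.
  rewrite -EFinM invfM; congr (_ * _)%:E.
  rewrite sqrtr_prod; last by move=> j _; rewrite subr_ge0.
  rewrite prodfV; congr (_^-1); rewrite (bigID J)/= big1 ?mul1r => [|j bj].
    by apply: eq_bigr => j bj; rewrite /b' /= (negbTE bj) mul1r.
  by rewrite /b' /= bj mulr0 subr0 sqrtr1.
rewrite e1 in cv.
have {}cv : (fun n => (expR (u n) * u n `^ (1 - al) * fine (P [set t | (u n < qform b (Y t) / 2)%R]))%:E) @ \oo -->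
  ((GammaR al * Num.sqrt (\prod_(j | b j != 1) (1 - b j)))^-1)%:E.
  apply: cvg_trans cv; apply: near_eq_cvg; near=> n => /=.
  rewrite /f; have k0 : 0 <= expR (u n) * u n `^ (1 - al) by rewrite mulr_ge0 ?expR_ge0 ?powR_ge0.
  have mt : measurable_fun setT (fun t => tailp P YJ (u n - V t)).
    by apply: measurableT_comp => //; exact: measurable_funB.
  rewrite (ge0_integralZR P mt (fun t => tailp_ge0 _ _ _) k0).
  rewrite -qform_tail_cond.
  have : P [set t | (u n < qform b (Y t) / 2)%R] \is a fin_num.
    by rewrite fin_num_measure//; exact: (measurable_lt_set _ (measurable_qform_comp b gY)).
  by case: (P _).
by move/fine_cvgP : cv => [].
Unshelve. all: by end_near.
Qed.

End qform_tail_max.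

(** * Limits of maxima *)

Section log_asymptotics.
Context (R : realType).
Implicit Types (u s p : nat -> R).

Lemma cvgry_ln u : u @ \oo --> +oo -> (fun n => ln (u n)) @ \oo --> +oo.
Proof.
move=> uoo; apply/cvgryPge => A; move/cvgryPge: uoo => /(_ (expR A)); apply: filterS => n h.
by rewrite -[leLHS]expRK ler_ln// posrE ?expR_gt0// (lt_le_trans _ h)// expR_gt0.
Qed.

Lemma cvgr0_powRN u (q : R) : 0 < q -> u @ \oo --> +oo -> (fun n => u n `^ (- q)) @ \oo --> 0.
Proof.
move=> q0 uoo.
have c1 : (fun n => q * ln (u n)) @ \oo --> +oo.
  apply/cvgryPge => A; move/cvgryPge: (cvgry_ln uoo) => /(_ (A / q)); apply: filterS => n.
  by rewrite ler_pdivrMr// mulrC.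
apply: cvg_trans (cvg_comp _ _ c1 (@cvgr_expR R)); apply: near_eq_cvg.
move/cvgryPgt: uoo => /(_ 0); apply: filterS => n h /=.
by rewrite /powR gt_eqF// mulNr.
Qed.

Lemma ln_le_powR (q y : R) : 0 < q -> 0 < y -> ln y <= y `^ q / q.
Proof.
move=> q0 y0; rewrite ler_pdivlMr// mulrC -ln_powR.
by apply: ltW; apply: ln_sublinear; exact: powR_gt0.
Qed.

Lemma cvgr0_ln_div u (q : R) : 0 < q -> u @ \oo --> +oo ->
  (fun n => ln (u n) * u n `^ (- q)) @ \oo --> 0.
Proof.
move=> q0 uoo; have q2 : 0 < q / 2 by rewrite divr_gt0.
have c1 : (fun n => (q / 2)^-1 * u n `^ (- (q / 2))) @ \oo --> 0.
  rewrite -[X in _ --> X](mulr0 (q / 2)^-1); apply: cvgM; first exact: cvg_cst.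
  exact: cvgr0_powRN.
apply: (squeeze_cvgr _ (cvg_cst 0) c1); move/cvgryPge: uoo => /(_ 1); apply: filterS => n h.
have u0 : 0 < u n by exact: lt_le_trans h.
apply/andP; split; first by rewrite mulr_ge0 ?powR_ge0// ln_ge0.
apply: (le_trans (ler_wpM2r (powR_ge0 _ _) (ln_le_powR q2 u0))).
rewrite mulrAC mulrC ler_pM2l ?invr_gt0// -powRD; last by rewrite (gt_eqF u0) implybT.
by rewrite le_eqVlt; apply/orP; left; apply/eqP; congr powR; field.
Qed.

Lemma cvgry_nat : (fun n => n%:R : R) @ \oo --> +oo.
Proof. exact: cvgr_idn. Qed.

(** Squeeze from 1 + x <= exp x, used at x = -p for the upper bound exp(-n p) and at x = p/(1 - p)
    for the lower bound exp(-n p/(1 - p)). *)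
Lemma cvgr_exprn_1B p (l : R) : (forall n, 0 <= p n <= 1) ->
  (fun n => n%:R * p n) @ \oo --> l -> (fun n => (1 - p n) ^+ n) @ \oo --> expR (- l).
Proof.
move=> p01 c.
have cinv : (fun n => (n%:R : R)^-1) @ \oo --> (0 : R).
  by apply/gtr0_cvgV0; [near=> n; rewrite ltr0n; near: n; exact: nbhs_infty_gt|exact: cvgry_nat].
have cp : p @ \oo --> (0 : R).
  have : (fun n => n%:R * p n * (n%:R : R)^-1) @ \oo --> l * 0 by exact: cvgM.
  rewrite mulr0; apply: cvg_trans; apply: near_eq_cvg; near=> n.
  rewrite /= mulrAC divff ?mul1r// pnatr_eq0 -lt0n; near: n; exact: nbhs_infty_gt.
have cq : (fun n => (1 - p n)^-1) @ \oo --> (1 : R).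
  rewrite -[X in _ --> X]invr1; apply: cvgV => //.
  by rewrite -[X in _ --> X]subr0; apply: cvgB => //; exact: cvg_cst.
have c1 : (fun n => expR (- (n%:R * p n * (1 - p n)^-1))) @ \oo --> expR (- l).
  have c0 : (fun n => - (n%:R * p n * (1 - p n)^-1)) @ \oo --> - l.
    by apply: cvgN; rewrite -[X in _ --> X]mulr1; apply: cvgM.
  exact: (cvg_comp _ _ c0 (@continuous_expR R _)).
have c2 : (fun n => expR (- (n%:R * p n))) @ \oo --> expR (- l).
  exact: (cvg_comp _ _ (cvgN c) (@continuous_expR R _)).
apply: (squeeze_cvgr _ c1 c2); near=> n.
have /andP[pn0 pn1] := p01 n.
have pl1 : p n < 1 by near: n; apply: (cvgr_lt _ cp).
have q0 : 0 < 1 - p n by rewrite subr_gt0.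
apply/andP; split; last first.
  rewrite -mulrN mulrC expRM_natr; apply: lerXn2r; rewrite ?nnegrE ?expR_ge0 ?(ltW q0)//.
  exact: expR_ge1Dx.
rewrite -mulrA -mulrN mulrC expRM_natr; apply: lerXn2r; rewrite ?nnegrE ?expR_ge0 ?(ltW q0)//.
rewrite expRN -[leRHS]invrK lef_pV2 ?posrE ?expR_gt0 ?invr_gt0//.
apply: le_trans (expR_ge1Dx _); rewrite le_eqVlt; apply/orP; left; apply/eqP.
by field; rewrite gt_eqF.
Unshelve. all: by end_near.
Qed.

(* The centring [s n] inverts [x |-> exp(-x) x^(M/2 - 1)] at [exp(c - x) / n]. *)
Lemma gumbel_norming (q c : R) (s := fun n : nat => ln n%:R + q * ln (ln n%:R) + c : R) :
  (s @ \oo --> +oo) /\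
  (fun n => n%:R * (expR (- s n) * s n `^ q)) @ \oo --> expR (- c).
Proof.
pose L n : R := ln n%:R.
have Loo : L @ \oo --> +oo by exact: (cvgry_ln cvgry_nat).
have c1 : (fun n => s n / L n) @ \oo --> (1 : R).
  have c0 : (fun n => 1 + q * (ln (L n) * L n `^ (-1)) + c * L n `^ (-1)) @ \oo --> (1 : R).
    rewrite -[X in _ --> X]addr0; apply: cvgD.
      rewrite -[X in _ --> X]addr0; apply: cvgD; first exact: cvg_cst.
      rewrite -[X in _ --> X](mulr0 q); apply: cvgM; [exact: cvg_cst|exact: cvgr0_ln_div].
    rewrite -[X in _ --> X](mulr0 c); apply: cvgM; [exact: cvg_cst|exact: cvgr0_powRN].
  apply: cvg_trans c0; apply: near_eq_cvg; near=> n.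
  have L0 : 0 < L n by near: n; move/cvgryPgt: Loo; exact.
  by rewrite powR_inv1 ?(ltW L0)// /s -/(L n); field; rewrite gt_eqF.
have spos : \forall n \near \oo, 2^-1 * L n <= s n.
  near=> n; have L0 : 0 < L n by near: n; move/cvgryPgt: Loo; exact.
  rewrite -ler_pdivlMr//; near: n; apply: (cvgr_ge _ c1).
  by rewrite invf_lt1// ltr1n.
split.
  apply/cvgryPge => A; near=> n; apply: (@le_trans _ _ (2^-1 * L n)); last by near: n.
  by rewrite mulrC ler_pdivlMr//; near: n; move/cvgryPge: Loo; exact.
have cpow : {for (1 : R), continuous (@powR R ^~ q)}.
  apply: differentiable_continuous; apply/derivable1_diffP.
  by apply: derivable_powR; rewrite in_itv/= andbT ltr01.
have := cvg_comp _ _ c1 cpow; rewrite powR1 => c2.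
have : (fun n => (s n / L n) `^ q * expR (- c)) @ \oo --> expR (- c).
  by rewrite -[X in _ --> X]mul1r; apply: cvgM => //; exact: cvg_cst.
apply: cvg_trans; apply: near_eq_cvg; near=> n.
have L0 : 0 < L n by near: n; move/cvgryPgt: Loo; exact.
have n0 : 0 < n%:R :> R by rewrite ltr0n; near: n; exact: nbhs_infty_gt.
have s0 : 0 < s n by apply: (@lt_le_trans _ _ (2^-1 * L n)); [rewrite mulr_gt0|near: n].
have e1 : s n `^ q = (s n / L n) `^ q * L n `^ q.
  by rewrite -powRM ?divr_ge0 ?(ltW s0) ?(ltW L0)// divfK// gt_eqF.
have e2 : L n `^ q = expR (q * ln (L n)) by rewrite /powR gt_eqF.
have e3 : n%:R * expR (- s n) * expR (q * ln (L n)) = expR (- c).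
  rewrite -{1}(lnK (x := n%:R)) ?posrE// -!expRD; congr expR; rewrite /s -/(L n); ring.
by rewrite e1 e2 -e3; ring.
Unshelve. all: by end_near.
Qed.

(** Approximation errors shift the threshold by a small h; continuity of [G] lets h go to 0 after n
    has gone to infinity. The cap [h0] is there because in the Weibull case x + h must stay
    negative. *)
Lemma cvg_sandwich (F : nat -> \bar R) (G : R -> R) (x h0 : R) : 0 < h0 ->
  {for x, continuous G} ->
  (forall h, 0 < h < h0 -> exists f1 f2 : nat -> R,
    [/\ f1 @ \oo --> G (x - h), f2 @ \oo --> G (x + h),
        \forall n \near \oo, ((f1 n)%:E <= F n)%E & \forall n \near \oo, (F n <= (f2 n)%:E)%E]) ->
  F @ \oo --> (G x)%:E.
Proof.
move=> h00 cG H.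
have key (e : R) : 0 < e -> \forall n \near \oo, ((G x - e)%:E <= F n <= (G x + e)%:E)%E.
  move=> e0.
  have e2 : 0 < e / 2 by rewrite divr_gt0.
  have [h [hh h1 h2]] : exists h, [/\ 0 < h < h0, G x - e / 2 < G (x - h) & G (x + h) < G x + e / 2].
    have cp : (fun h => G (x + h)) @ (0 : R)^'+ --> G x.
      have : (fun h => x + h) @ (0 : R)^'+ --> x.
        rewrite -[X in _ --> X]addr0; apply: cvgD; first exact: cvg_cst.
        exact: cvg_at_right_filter.
      by move=> c; exact: (cvg_comp _ _ c cG).
    have cm : (fun h => G (x - h)) @ (0 : R)^'+ --> G x.
      have : (fun h => x - h) @ (0 : R)^'+ --> x.
        rewrite -[X in _ --> X]subr0; apply: cvgB; first exact: cvg_cst.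
        exact: cvg_at_right_filter.
      by move=> c; exact: (cvg_comp _ _ c cG).
    near (0 : R)^'+ => h; exists h; split.
    - by apply/andP; split; [by []|near: h; exact: nbhs_right_lt].
    - by near: h; apply: (cvgr_gt _ cm); rewrite ltrBlDr ltrDl.
    - by near: h; apply: (cvgr_lt _ cp); rewrite ltrDl.
  have [f1 [f2 [c1 c2 n1 n2]]] := H h hh.
  near=> n; apply/andP; split.
    apply: (@le_trans _ _ (f1 n)%:E); last by near: n.
    rewrite lee_fin ltW//; near: n; apply: (cvgr_gt _ c1); lra.
  apply: (@le_trans _ _ (f2 n)%:E); first by near: n.
  rewrite lee_fin ltW//; near: n; apply: (cvgr_lt _ c2); lra.
apply/fine_cvgP; split.
  have := key 1 ltr01; apply: filterS => n /andP[h1 h2].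
  by rewrite fin_numElt (lt_le_trans _ h1) ?ltNyr// (le_lt_trans h2) ?ltry.
apply/cvgrPdist_le => e e0; have := key e e0; apply: filterS => n /andP[].
rewrite /=; case: (F n) => [r| |]; rewrite ?lee_fin ?leye_eq ?leeNy_eq//= => h1 h2.
by rewrite ler_distl; apply/andP; split; lra.
Unshelve. all: by end_near.
Qed.

(** The maximum is taken in the extended reals and then truncated by [fine]; a nonempty index set
    makes it finite, so no default value interferes. *)
Lemma maxI_leP n (f : 'I_n -> R) (y : R) : (0 < n)%N ->
  (maxI f <= y) <-> (forall i, f i <= y).
Proof.
move=> n0; rewrite /maxI; set E := \big[_/_]_(i < n) _.
have leE z : (E <= z%:E)%E <-> (forall i, f i <= z).
  split => [/bigmax_leP[_ h] i|h]; first by rewrite -lee_fin; exact: h.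
  by apply/bigmax_leP; split => [|i _]; rewrite ?leNye// lee_fin.
have fE : E \is a fin_num.
  have h1 : ((f (Ordinal n0))%:E <= E)%E by exact: (le_bigmax _ (fun i => (f i)%:E)).
  have h2 : (E <= (\sum_i `|f i|)%:E)%E.
    apply/leE => i; apply: (le_trans (ler_norm _)); rewrite (bigD1 i)//= lerDl.
    by apply: sumr_ge0.
  by rewrite fin_numElt (lt_le_trans _ h1) ?ltNyr// (le_lt_trans h2) ?ltry.
by rewrite -lee_fin fineK.
Qed.

End log_asymptotics.

(** [M] may exceed the multiplicity, in which case the limit is 0. For the maximum of absolute
    values this lets both signs be normalised by the larger of [mult_p] and [mult_n]; a sign
    contributes only if it attains that maximum. *)
Lemma qform_tail_cvg (R : realType) d (T : measurableType d) (P : probability T R) k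
    (Y : T -> 'I_k -> R) (b : 'I_k -> R) (M : nat) (s : nat -> R) :
  gaussfam P Y -> (forall j, b j <= 1) -> (#|[pred j | b j == 1%R]| <= M)%N -> (0 < M)%N ->
  s @ \oo --> +oo ->
  (fun n => expR (s n) * s n `^ (1 - M%:R / 2) * fine (P [set t | (s n < qform b (Y t) / 2)%R]))
   @ \oo --> (#|[pred j | b j == 1]| == M)%:R *
             (GammaR (M%:R / 2) * Num.sqrt (\prod_(j | b j != 1) (1 - b j)))^-1.
Proof.
move=> gY b1 mM M0 soo; set m := #|_| in mM *.
have [m0|m0] := posnP m.
  have /negbTE -> : m != M by rewrite m0 eq_sym -lt0n.
  rewrite mul0r; apply: (qform_tail_lt1 gY) => // j; rewrite lt_neqAle b1 andbT.
  by have := card0_eq m0 j; rewrite inE => ->.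
have [mMe|mMn] := eqVneq m M.
  by rewrite mul1r -mMe; exact: (qform_tail_max_cvg gY b1 m0 soo).
rewrite mul0r; have q0 : 0 < (M%:R - m%:R) / 2 :> R.
  by rewrite divr_gt0// subr_gt0 ltr_nat ltn_neqAle mMn.
have : (fun n => (expR (s n) * s n `^ (1 - m%:R / 2) * fine (P [set t | (s n < qform b (Y t) / 2)%R])) *
    s n `^ (- ((M%:R - m%:R) / 2))) @ \oo --> (0 : R).
  rewrite -[X in _ --> X](mulr0 (GammaR (m%:R / 2) * Num.sqrt (\prod_(j | b j != 1) (1 - b j)))^-1).
  by apply: cvgM; [exact: (qform_tail_max_cvg gY b1 m0 soo)|exact: cvgr0_powRN].
apply: cvg_trans; apply: near_eq_cvg; move/cvgryPgt: soo => /(_ 0); apply: filterS => n s0 /=.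
have -> : s n `^ (1 - M%:R / 2) = s n `^ (1 - m%:R / 2) * s n `^ (- ((M%:R - m%:R) / 2)).
  by rewrite -powRD ?(gt_eqF s0) ?implybT//; congr powR; field.
by ring.
Qed.

Section row_count.
Context (R : realType).

(** With e = N^(-1/4) the exponent N e^2/16 is N^(1/2)/16, so the bound tends to 0. *)
Lemma bad_gram_cvg0 d (T : measurableType d) (P : probability T R) k
    (G : forall N, T -> 'I_N * 'I_k -> R) : (forall N, gaussfam P (G N)) ->
  exists2 r : nat -> R, r @ \oo --> 0 & \forall N \near \oo,
    (P [set t | bad_gram (N%:R `^ (- 4^-1)) (G N t)] <= (r N)%:E)%E.
Proof.
move=> gG.
pose r N : R := (k * k)%:R * (4 * expR (- (16^-1 * N%:R `^ 2^-1))).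
exists r.
  rewrite -[X in _ --> X](mulr0 (k * k)%:R); apply: cvgM; first exact: cvg_cst.
  rewrite -[X in _ --> X](mulr0 4); apply: cvgM; first exact: cvg_cst.
  have c1 : (fun n : nat => 16^-1 * (n%:R : R) `^ 2^-1) @ \oo --> +oo.
    have h : (fun n : nat => (n%:R : R) `^ (- 2^-1)) @ \oo --> 0.
      by apply: cvgr0_powRN; [rewrite invr_gt0|exact: cvgry_nat].
    apply/cvgryPge => A; near=> n.
    have n0 : 0 < n%:R :> R by rewrite ltr0n; near: n; exact: nbhs_infty_gt.
    have p0 : 0 < n%:R `^ 2^-1 :> R by exact: powR_gt0.
    have A0 : 0 < 16 * (`|A| + 1) by rewrite mulr_gt0// ltr_wpDl.
    have hn : n%:R `^ (- 2^-1) <= (16 * (`|A| + 1))^-1.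
      near: n; apply: (cvgr_le _ h); by rewrite invr_gt0.
    rewrite powRN lef_pV2 ?posrE// in hn.
    by rewrite ler_pdivlMl//; apply: le_trans hn; rewrite ler_pM2l//; have := ler_norm A; lra.
  exact: (cvg_comp _ _ c1 (@cvgr_expR R)).
near=> N.
have N0 : (0 < N)%N by near: N; exact: nbhs_infty_gt.
have n0 : 0 < N%:R :> R by rewrite ltr0n.
have n1 : 1 <= N%:R :> R by rewrite ler1n.
have e01 : 0 < (N%:R : R) `^ (- 4^-1) <= 1.
  by rewrite powR_gt0//= -[leRHS](powRr0 N%:R) ler_powR// oppr_le0 invr_ge0.
apply: le_trans (bad_gram_bound (gG N) e01 N0) _.
rewrite lee_fin le_eqVlt; apply/orP; left; apply/eqP; rewrite /r; congr (_ * (_ * expR (- _))).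
have -> : (N%:R `^ (- 4^-1)) ^+ 2 = (N%:R : R) `^ (- 2^-1).
  by rewrite expr2 -powRD ?(gt_eqF n0) ?implybT//; congr powR; field.
have {1}-> : N%:R = N%:R `^ 2^-1 * N%:R `^ 2^-1 :> R.
  by rewrite -powRD ?(gt_eqF n0) ?implybT// -[LHS]powRr1 ?(ltW n0)//; congr powR; field.
by rewrite powRN mulfK ?gt_eqF ?powR_gt0// mulrC.
Unshelve. all: by end_near.
Qed.

End row_count.

Section row_max.
Context (R : realType).

(** Common core of both limits. It remains to give, for each small h, an inner and an outer event
    for a single row, stable under the frame error C N^(-1/4) [sq], whose complements have
    probability about lam(x - h)/N and lam(x + h)/N. Raising to the power N yields exp(-lam). *)
Lemma row_max_cvg k (a : 'I_k -> R) : exists2 C : R, 0 < C &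
  forall d (T : measurableType d) (P : probability T R)
    (A : forall N, 'M[R]_N) (H U : forall N, T -> 'M[R]_N) (th : R -> R) (Y : T -> 'I_k -> R)
    (thr : nat -> R) (lam : R -> R) (x h0 : R),
  (forall N, (k <= N)%N -> (A N)^T = A N /\
     char_poly (A N) = (\prod_(i < k) ('X - (a i)%:P)) * 'X^(N - k)) ->
  (forall N, is_GOE P (H N)) -> (forall N, is_eigvec_matrix (H N) (U N)) ->
  continuous th -> gaussfam P Y -> 0 < h0 -> {for x, continuous lam} ->
  (forall h, 0 < h < h0 -> exists B1 B2 : nat -> set (coordT R 'I_k),
    [/\ forall N, measurable (B1 N) /\ measurable (B2 N),
      \forall N \near \oo, forall (y : coordT R 'I_k) q, B1 N y ->
        `|q - qform a y| <= C * N%:R `^ (- 4^-1) * sq y -> th (q / N%:R) <= thr N,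
      \forall N \near \oo, forall (y : coordT R 'I_k) q,
        `|q - qform a y| <= C * N%:R `^ (- 4^-1) * sq y -> th (q / N%:R) <= thr N -> B2 N y,
      (fun N => N%:R * (1 - fine (P (Y @^-1` B1 N)))) @ \oo --> lam (x - h) &
      (fun N => N%:R * (1 - fine (P (Y @^-1` B2 N)))) @ \oo --> lam (x + h)]) ->
  (fun N => P [set t | forall i : 'I_N, th (quadf (A N) (col i (U N t))) <= thr N]) @ \oo -->
    (expR (- lam x))%:E.
Proof.
have [C [e0 [C0 e00 FS]]] := frame_sandwich a; exists C => //.
move=> d T P A H U th Y thr lam x h0 hA hH hU cth gY h00 clam hB.
have [G gG] : exists G : forall N, T -> 'I_N * 'I_k -> R, forall N, gaussfam P (G N).
  exists (fun N => sval (cid (gauss_exists ('I_N * 'I_k)%type hH))) => N.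
  by case: cid.
have [r r0 hr] := bad_gram_cvg0 gG.
have cG : {for x, continuous (fun z => expR (- lam z))}.
  apply: continuous_comp; last exact: continuous_expR.
  by apply: cvgN; exact: clam.
apply: (cvg_sandwich h00 cG) => h hh.
have [B1 [B2 [mB n1 n2 c1 c2]]] := hB h hh.
pose p1 N := fine (P (Y @^-1` B1 N)); pose p2 N := fine (P (Y @^-1` B2 N)).
have mY := iid_measurable gY.
have mYB (B : set (coordT R 'I_k)) : measurable B -> measurable (Y @^-1` B).
  by move=> mB'; have := mY measurableT _ mB'; rewrite setTI.
have pE (B : set (coordT R 'I_k)) : measurable B -> P (Y @^-1` B) = (fine (P (Y @^-1` B)))%:E.
  by move=> mB'; rewrite fineK// fin_num_measure//; exact: mYB.
have p01 (B : set (coordT R 'I_k)) : measurable B -> 0 <= 1 - fine (P (Y @^-1` B)) <= 1.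
  move=> mB'; rewrite subr_ge0 gerBl fine_ge0// andbT -lee_fin -pE//.
  by apply: probability_le1; exact: mYB.
have e01 : \forall N \near \oo, 0 <= (N%:R : R) `^ (- 4^-1) <= e0.
  have q0 : 0 < 4^-1 :> R by rewrite invr_gt0.
  have c := cvgr0_powRN q0 (@cvgry_nat R).
  by near=> N; rewrite powR_ge0/=; near: N; exact: (cvgr_le _ c).
have FSN : \forall N \near \oo,
   ((p1 N ^+ N)%:E <= P [set t | forall i : 'I_N, (th (quadf (A N) (col i (U N t))) <= thr N)%R] +
      P [set t | bad_gram (N%:R `^ (- 4^-1)) (G N t)] /\
    P [set t | forall i : 'I_N, (th (quadf (A N) (col i (U N t))) <= thr N)%R] <=
      (p2 N ^+ N)%:E + P [set t | bad_gram (N%:R `^ (- 4^-1)) (G N t)])%E.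
  near=> N.
  have kN : (k <= N)%N by near: N; exact: nbhs_infty_ge.
  have N0 : (0 < N)%N by near: N; exact: nbhs_infty_gt.
  have [AT Ac] := hA N kN; have [m1 m2] := mB N.
  apply: (FS _ _ _ N (A N) (H N) (U N) th (thr N) (N%:R `^ (- 4^-1)) Y (G N) (B1 N) (B2 N)) => //.
  - by near: N.
  - by near: N.
  - by near: N.
  - exact: pE.
  - exact: pE.
exists (fun N => p1 N ^+ N - r N), (fun N => p2 N ^+ N + r N); split.
- rewrite -[X in _ --> X]subr0; apply: cvgB => //.
  have -> : (fun N => p1 N ^+ N) = (fun N => (1 - (1 - p1 N)) ^+ N) by apply/funext => N; rewrite subKr.
  by apply: cvgr_exprn_1B => // N; apply: p01; case: (mB N).
- rewrite -[X in _ --> X]addr0; apply: cvgD => //.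
  have -> : (fun N => p2 N ^+ N) = (fun N => (1 - (1 - p2 N)) ^+ N) by apply/funext => N; rewrite subKr.
  by apply: cvgr_exprn_1B => // N; apply: p01; case: (mB N).
- move: FSN hr; apply: filterS2 => N [h1 _] h2.
  by rewrite EFinB leeBlDr//; apply: (le_trans h1); rewrite leeD2l.
- move: FSN hr; apply: filterS2 => N [_ h1] h2.
  by apply: (le_trans h1); rewrite EFinD leeD2l.
Unshelve. all: by end_near.
Qed.

(** * Gumbel limit *)

Section gumbel.
Context k (a : 'I_k -> R) (c c0 : R) (M : nat) (th : R -> R).
Hypotheses (cpos : 0 < c) (cth : continuous th)
  (thZ : forall q N, th (q / N%:R) = th q / N%:R)
  (thL : forall p q, th p <= th q + `|p - q|).

(** The form is of order log N at the threshold, while the frame error is of order N^(-1/4) |y|^2.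
    Setting aside the rows with |y|^2 > 8 log N, too rare to matter, makes the error smaller than
    any fixed shift h. Compatibility with division by N and the 1-Lipschitz bound are what the
    identity and the absolute value share. *)
Lemma gumbel_engine d (T : measurableType d) (P : probability T R)
    (A : forall N, 'M[R]_N) (H U : forall N, T -> 'M[R]_N) (Y : T -> 'I_k -> R) (x : R) :
  (forall N, (k <= N)%N -> (A N)^T = A N /\
     char_poly (A N) = (\prod_(i < k) ('X - (a i)%:P)) * 'X^(N - k)) ->
  (forall N, is_GOE P (H N)) -> (forall N, is_eigvec_matrix (H N) (U N)) ->
  gaussfam P Y ->
  (forall s : nat -> R, s @ \oo --> +oo ->
    (fun n => expR (s n) * s n `^ (1 - M%:R / 2) *
      fine (P [set t | (s n < th (qform a (Y t)) / (2 * c))%R])) @ \oo --> expR (- c0)) ->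
  (fun N => P [set t | forall i : 'I_N, th (quadf (A N) (col i (U N t))) <=
     2 * c / N%:R * (ln N%:R + (M%:R / 2 - 1) * ln (ln N%:R) + (x - c0))]) @ \oo -->
    (gumbel_cdf x)%:E.
Proof.
move=> hA hH hU gY tail; rewrite /gumbel_cdf.
have [C C0 H0] := row_max_cvg a.
pose lam (z : R) := expR (- z).
have clam : continuous lam.
  by move=> z; apply: continuous_comp; [exact: opp_continuous|exact: continuous_expR].
apply: (H0 _ _ _ _ _ _ _ _ _ lam x 1 hA hH hU cth gY ltr01 (clam x)) => h /andP[hp _].
pose L n : R := ln n%:R.
pose s z n : R := L n + (M%:R / 2 - 1) * ln (L n) + (z - c0).
have c2 : 0 < 2 * c by rewrite mulr_gt0.
have mth : measurable_fun setT th by exact: continuous_measurable_fun.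
have mthq : measurable_fun setT (fun y : coordT R 'I_k => th (qform a y) / (2 * c)).
  by apply: measurable_funM => //; apply: measurableT_comp => //; exact: measurable_qform.
have msq := @measurable_sq R 'I_k.
pose S z n : set (coordT R 'I_k) := [set y | s z n < th (qform a y) / (2 * c)].
(* The 8 comes from [sq_chernoff] with c = sqrt 2 at level 2 log N: |y|^2 > 8 log N has probability
   at most 2^(k/2) N^-2, negligible against 1/N. *)
pose D n : set (coordT R 'I_k) := [set y | 8 * L n < sq y].
have mS z n : measurable (S z n) by exact: measurable_lt_set.
have mD n : measurable (D n) by exact: measurable_lt_set.
have mYB (B : set (coordT R 'I_k)) : measurable B -> measurable (Y @^-1` B).
  by move=> mB'; have := iid_measurable gY measurableT mB'; rewrite setTI.
pose pr (B : set (coordT R 'I_k)) := fine (P (Y @^-1` B)).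
have prE (B : set (coordT R 'I_k)) : measurable B -> P (Y @^-1` B) = (pr B)%:E.
  by move=> mB'; rewrite fineK// fin_num_measure//; exact: mYB.
have prC (B : set (coordT R 'I_k)) : measurable B -> 1 - pr (~` B) = pr B.
  move=> mB; rewrite /pr preimage_setC probability_setC; last exact: mYB.
  by rewrite prE//= subKr.
have prU (B B' E : set (coordT R 'I_k)) : measurable B -> measurable B' -> measurable E -> E `<=` B `|` B' -> pr E <= pr B + pr B'.
  move=> mB mB' mE sE; rewrite -lee_fin EFinD -!prE//.
  apply: (@le_trans _ _ (P (Y @^-1` B `|` Y @^-1` B'))); last by apply: measureU2; exact: mYB.
  apply: le_measure; rewrite ?classical_sets.inE; first exact: mYB.
    by apply: measurableU; exact: mYB.
  by move=> t /sE.
have prle (B E : set (coordT R 'I_k)) : measurable B -> measurable E -> E `<=` B -> pr E <= pr B.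
  by move=> mB mE sE; have := prU B set0 E mB measurable0 mE; rewrite setU0 /pr preimage_set0 measure0/= addr0; apply.
have ScvG z : (fun N => N%:R * pr (S z N)) @ \oo --> expR (- z).
  have [soo sc] := gumbel_norming (M%:R / 2 - 1) (z - c0).
  have : (fun n => n%:R * (expR (- s z n) * s z n `^ (M%:R / 2 - 1)) *
      (expR (s z n) * s z n `^ (1 - M%:R / 2) * pr (S z n))) @ \oo --> expR (- z).
    rewrite (_ : - z = - (z - c0) + - c0); last by ring.
    by rewrite expRD; apply: cvgM; [exact: sc|exact: (tail _ soo)].
  apply: cvg_trans; apply: near_eq_cvg; move/cvgryPgt: soo => /(_ 0); apply: filterS => n s0 /=.
  have -> : (s z n) `^ (1 - M%:R / 2) = ((s z n) `^ (M%:R / 2 - 1))^-1 by rewrite -powRN opprB.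
  rewrite expRN.
  by field; rewrite !gt_eqF// ?expR_gt0// powR_gt0.
have D0 : (fun N => N%:R * pr (D N)) @ \oo --> 0.
  pose K : R := Num.sqrt 2 ^+ k.
  have c1 : (fun N : nat => K * (N%:R : R) `^ (-1)) @ \oo --> 0.
    rewrite -[X in _ --> X](mulr0 K); apply: cvgM; first exact: cvg_cst.
    by apply: cvgr0_powRN => //; exact: cvgry_nat.
  apply: (squeeze_cvgr _ (cvg_cst 0) c1); near=> N.
  have N0 : 0 < N%:R :> R by rewrite ltr0n; near: N; exact: nbhs_infty_gt.
  rewrite mulr_ge0 ?fine_ge0//=.
  have s20 : 0 < Num.sqrt 2 :> R by rewrite sqrtr_gt0.
  have := sq_chernoff (2 * L N) gY s20; rewrite card_ord sqr_sqrtr// => ch.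
  have : pr (D N) <= expR (- (2 * L N)) * K.
    rewrite -lee_fin -prE//; apply: le_trans ch; apply: le_measure; rewrite ?classical_sets.inE.
    - exact: mYB.
    - have mf := measurable_funM (measurable_halfsq gY) (measurable_cst (1 - 2^-1 : R)).
      rewrite -[X in measurable X]setTI.
      have := mf measurableT _ (@measurable_itv R `[2 * L N, +oo[).
      by congr (measurable (_ `&` _)); apply/seteqP; split => t /=; rewrite in_itv/= andbT.
    by move=> t /=; rewrite /D /= => ?; lra.
  move=> h1; apply: (le_trans (ler_wpM2l (ltW N0) h1)).
  rewrite powR_inv1 ?(ltW N0)// le_eqVlt; apply/orP; left; apply/eqP.
  have -> : expR (- (2 * L N)) = N%:R^-1 * N%:R^-1.
    by rewrite expRN mulr_natl mulr2n expRD lnK ?posrE// invfM.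
  by field; rewrite gt_eqF.
have e0 : \forall N \near \oo, 0 < N%:R :> R /\
    C * N%:R `^ (- 4^-1) * (8 * L N) <= 2 * c * h.
  have q0 : 0 < 4^-1 :> R by rewrite invr_gt0.
  have c1 : (fun N => (C * 8) * (L N * (N%:R : R) `^ (- 4^-1))) @ \oo --> 0.
    rewrite -[X in _ --> X](mulr0 (C * 8)); apply: cvgM; first exact: cvg_cst.
    exact: (cvgr0_ln_div q0 (@cvgry_nat R)).
  near=> N; split; first by rewrite ltr0n; near: N; exact: nbhs_infty_gt.
  rewrite (_ : _ * _ * _ = C * 8 * (L N * N%:R `^ (- 4^-1))); last by ring.
  by near: N; apply: (cvgr_le _ c1); rewrite !mulr_gt0.
have thrE N : 0 < N%:R :> R -> 2 * c / N%:R * s x N = 2 * c * s x N / N%:R by move=> ?; rewrite mulrAC.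
have sE z h' n : s (z + h') n = s z n + h' by rewrite /s; ring.
(* The inner event must guarantee the inequality, so it excludes all rows in [S] or in [D]; the
   outer one must follow from the inequality, so it excludes only rows of [S] outside [D], where the
   error is controlled. *)
exists (fun N => ~` (S (x - h) N `|` D N)), (fun N => ~` (S (x + h) N `\` D N)); split.
- by move=> N; split; apply: measurableC; [exact: measurableU|exact: measurableD].
- move: e0; apply: filterS => N [N0 eN] y q /= /not_orP[/negP yS /negP yD] qy.
  rewrite -leNgt sE ler_pdivrMr// in yS; rewrite -leNgt in yD.
  rewrite thZ thrE// ler_pM2r ?invr_gt0//.
  have := ler_wpM2l (mulr_ge0 (ltW C0) (powR_ge0 _ _) : 0 <= C * N%:R `^ (- 4^-1)) yD.
  by have := thL q (qform a y); lra.
- move: e0; apply: filterS => N [N0 eN] y q /= qy.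
  rewrite thZ thrE// ler_pM2r ?invr_gt0// => hq [yS /negP yD].
  rewrite /S /= sE ltr_pdivlMr// in yS; rewrite -leNgt in yD.
  have := ler_wpM2l (mulr_ge0 (ltW C0) (powR_ge0 _ _) : 0 <= C * N%:R `^ (- 4^-1)) yD.
  by have := thL (qform a y) q; rewrite distrC; lra.
- rewrite (_ : (fun N => _) = (fun N => N%:R * pr (S (x - h) N `|` D N))); last first.
    by apply/funext => N; rewrite -prC//; exact: measurableU.
  have cu : (fun N => N%:R * pr (S (x - h) N) + N%:R * pr (D N)) @ \oo --> expR (- (x - h)).
    by rewrite -[X in _ --> X]addr0; apply: cvgD.
  apply: (squeeze_cvgr _ (ScvG (x - h)) cu); near=> N.
  rewrite -mulrDr !ler_wpM2l//=.
    by apply: prU => //; exact: measurableU.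
  by apply: prle => //; exact: measurableU.
- rewrite (_ : (fun N => _) = (fun N => N%:R * pr (S (x + h) N `\` D N))); last first.
    by apply/funext => N; rewrite -prC//; exact: measurableD.
  have cu : (fun N => N%:R * pr (S (x + h) N) - N%:R * pr (D N)) @ \oo --> expR (- (x + h)).
    by rewrite -[X in _ --> X]subr0; apply: cvgB.
  apply: (squeeze_cvgr _ cu (ScvG (x + h))); near=> N.
  rewrite -mulrBr !ler_wpM2l//=.
    by apply: prle => //; exact: measurableD.
  rewrite lerBlDr; apply: prU => //; first exact: measurableD.
  by move=> y yS; have [yD|yD] := pselect (D N y); [right|left].
Unshelve. all: by end_near.
Qed.

End gumbel.
End row_max.

(** * Weibull limit *)

Section weibull.
Context (R : realType) (k : nat) (a : 'I_k -> R).
Hypotheses (k0 : (0 < k)%N) (aneg : forall j, a j < 0).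
Let al : R := k%:R / 2.
Let Pi : R := \prod_(j < k) `|a j|.
Let b j := - a j.
(* [rad n] is the half-width of the interval at [0] that carries a [1/n] share of a row's law. *)
Let c1 : R := Pi `^ k%:R^-1 / (2 * gamma_k k).
Let rad (n : nat) : R := c1 * (Num.max n%:R 1) `^ (- (2 / k%:R)).

Let kR0 : 0 < k%:R :> R. Proof. by rewrite ltr0n. Qed.
Let al0 : 0 < al. Proof. by rewrite divr_gt0. Qed.
Let b0 j : 0 < b j. Proof. by rewrite oppr_gt0. Qed.
Let Pi0 : 0 < Pi. Proof. by rewrite prodr_gt0// => j _; rewrite normr_gt0 lt_eqF. Qed.

Context d (T : measurableType d) (P : probability T R) (Y : T -> 'I_k -> R).
Hypothesis gY : gaussfam P Y.

Let G0 : 0 < GammaR al.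
Proof. by have := (chisq_gamma gY _).1; rewrite card_ord; apply. Qed.

Let gam0 : 0 < gamma_k k :> R.
Proof. by rewrite mulr_gt0 ?invr_gt0// powR_gt0// divr_gt0// mulr_gt0. Qed.

Let c10 : 0 < c1. Proof. by rewrite divr_gt0 ?powR_gt0// mulr_gt0. Qed.
Let rad0 n : 0 < rad n.
Proof. by rewrite mulr_gt0// powR_gt0// lt_max ltr01 orbT. Qed.

Let radcvg : rad @ \oo --> (0 : R).
Proof.
rewrite -[X in _ --> X](mulr0 c1); apply: cvgM; first exact: cvg_cst.
apply: cvgr0_powRN; first exact: divr_gt0.
apply/cvgryPge => A; have /cvgryPge /(_ A) := @cvgry_nat R; apply: filterS => n /= h.
by rewrite le_max h.
Qed.

(** [gamma_k] is designed for this: c1^al cancels the small ball constant 1/(Gamma(al) al sqrt Pi),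
    leaving exactly z^al in the count below. *)
Let c1E : c1 `^ al = Num.sqrt Pi * (GammaR al * al).
Proof.
rewrite /c1 powRM ?invr_ge0 ?powR_ge0 ?(ltW (mulr_gt0 _ gam0))//.
have -> : 2 * gamma_k k = (2 / (k%:R * GammaR al)) `^ (2 / k%:R) :> R.
  by rewrite /gamma_k mulrA divff ?mul1r.
rewrite -[(_ `^ (2 / k%:R))^-1]powRN -!powRrM.
have -> : k%:R^-1 * al = 2^-1 by rewrite /al; field; rewrite gt_eqF.
have -> : - (2 / k%:R) * al = -1 by rewrite /al; field; rewrite gt_eqF.
rewrite powR12_sqrt ?(ltW Pi0)// powRN powRr1; last by rewrite divr_ge0// mulr_ge0// ltW.
by congr (_ * _); rewrite /al; field; rewrite !gt_eqF.
Qed.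

Lemma small_ball_count z : 0 < z ->
  (fun N => N%:R * fine (P [set t | (qform b (Y t) / 2 <= rad N * z)%R])) @ \oo --> z `^ al.
Proof.
move=> z0.
have rz0 n : 0 < rad n * z by rewrite mulr_gt0.
have rzc : (fun n => rad n * z) @ \oo --> (0 : R).
  by rewrite -[X in _ --> X](mul0r z); apply: cvgM => //; exact: cvg_cst.
have := small_ball_cvg gY k0 b0 rz0 rzc; rewrite -/al => sb.
have sPi : Num.sqrt Pi = \prod_j Num.sqrt (b j).
  rewrite /Pi sqrtr_prod; last by move=> j _; exact: normr_ge0.
  by apply: eq_bigr => j _; rewrite ltr0_norm.
have sP0 : 0 < Num.sqrt Pi by rewrite sqrtr_gt0.
have : (fun n => fine (P [set t | (qform b (Y t) / 2 <= rad n * z)%R]) / (rad n * z) `^ al *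
    (c1 `^ al * z `^ al)) @ \oo --> z `^ al.
  rewrite [X in _ --> X](_ : _ = (GammaR al * al)^-1 / (\prod_j Num.sqrt (b j)) * (c1 `^ al * z `^ al)).
    by apply: cvgM => //; exact: cvg_cst.
  by rewrite c1E -sPi; field; rewrite !gt_eqF.
apply: cvg_trans; apply: near_eq_cvg; near=> n.
have n0 : (0 < n)%N by near: n; exact: nbhs_infty_gt.
have nR0 : 0 < n%:R :> R by rewrite ltr0n.
have -> : (rad n * z) `^ al = c1 `^ al * n%:R^-1 * z `^ al.
  rewrite powRM ?(ltW (rad0 n)) ?(ltW z0)//; congr (_ * _).
  rewrite /rad powRM ?powR_ge0 ?(ltW c10)//; congr (_ * _).
  have /max_idPl -> : 1 <= n%:R :> R by rewrite ler1n.
  rewrite -powRrM (_ : - (2 / k%:R) * al = -1) ?powR_inv1 ?(ltW nR0)//.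
  by rewrite /al; field; rewrite gt_eqF.
have p1 : 0 < c1 `^ al by exact: powR_gt0.
have p2 : 0 < z `^ al by exact: powR_gt0.
by rewrite /=; field; rewrite !gt_eqF.
Unshelve. all: by end_near.
Qed.

(** All b_j are positive, so [sq] is at most [be] times the form: the frame error is relative, of
    size [de N] tending to 0, and it scales with the form however small the ball. *)
Lemma weibull_engine (A : forall N, 'M[R]_N) (H U : forall N, T -> 'M[R]_N) (x : R) :
  (forall N, (k <= N)%N -> (A N)^T = A N /\
     char_poly (A N) = (\prod_(i < k) ('X - (a i)%:P)) * 'X^(N - k)) ->
  (forall N, is_GOE P (H N)) -> (forall N, is_eigvec_matrix (H N) (U N)) ->
  (fun N => P [set t | forall i : 'I_N, quadf (A N) (col i (U N t)) <=
     x / (gamma_k k * N%:R `^ (1 + 2 / k%:R) / Pi `^ k%:R^-1)]) @ \oo -->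
    (weibull_cdf al x)%:E.
Proof.
move=> hA hH hU; rewrite /weibull_cdf; case: ltP => x0; last first.
  (* For x >= 0 the event is certain once k <= N, since all the forms are nonpositive. *)
  have : (fun _ : nat => (1%E : \bar R)) @ \oo --> (1%E : \bar R) by exact: cvg_cst.
  apply: cvg_trans; apply: near_eq_cvg; near=> N.
  have kN : (k <= N)%N by near: N; exact: nbhs_infty_ge.
  rewrite -(@probability_setT _ _ _ P); congr (P _); apply/esym; apply/seteqP; split => // t _ i /=.
  have [AT Ac] := hA N kN; have [W [_ AE]] := frame_decomposition kN AT Ac.
  apply: (@le_trans _ _ 0).
    rewrite AE quadf_conj quadf_diag; apply: sumr_le0 => j _.
    by rewrite mulr_le0_ge0 ?sqr_ge0// ltW.
  by rewrite divr_ge0// divr_ge0 ?powR_ge0// mulr_ge0 ?powR_ge0// ltW.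
have [C C0 H0] := row_max_cvg a.
have clam : {for x, continuous (fun z => (- z) `^ al)}.
  have cp : {for - x, continuous (@powR R ^~ al)}.
    apply: differentiable_continuous; apply/derivable1_diffP.
    by apply: derivable_powR; rewrite in_itv/= andbT oppr_gt0.
  have cn : (fun z : R => - z) @ x --> - x by apply: cvgN; exact: cvg_id.
  exact: (cvg_comp _ _ cn cp).
have cid : continuous (@id R) by move=> z; exact: cvg_id.
have x0' : 0 < - x by rewrite oppr_gt0.
(* The cap h < -x keeps x + h negative, so that both radii h - x and -x - h are positive. *)
apply: (H0 _ _ _ _ _ _ _ _ _ (fun z => (- z) `^ al) x (- x) hA hH hU cid gY x0' clam) => h /andP[hp hx].
pose be := \sum_j (b j)^-1.
have be0 : 0 <= be by apply: sumr_ge0 => j _; rewrite invr_ge0 ltW.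
have sqb (y : 'I_k -> R) : sq y <= be * qform b y.
  rewrite /be mulr_suml; apply: ler_sum => j _.
  rewrite ler_pdivlMl// /qform (bigD1 j)//= lerDl; apply: sumr_ge0 => i _.
  by rewrite mulr_ge0 ?sqr_ge0// ltW.
have qab (y : 'I_k -> R) : qform a y = - qform b y.
  by rewrite /qform -sumrN; apply: eq_bigr => j _; rewrite /b mulNr opprK.
have qb0 (y : 'I_k -> R) : 0 <= qform b y.
  by apply: sumr_ge0 => j _; rewrite mulr_ge0 ?sqr_ge0// ltW.
pose de (N : nat) : R := C * N%:R `^ (- 4^-1) * be.
have de0 N : 0 <= de N by rewrite !mulr_ge0 ?powR_ge0// ltW.
have dec : de @ \oo --> 0.
  rewrite -[X in _ --> X](mul0r be); apply: cvgM; last exact: cvg_cst.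
  rewrite -[X in _ --> X](mulr0 C); apply: cvgM; first exact: cvg_cst.
  by apply: cvgr0_powRN; [rewrite invr_gt0|exact: cvgry_nat].
have thrE : \forall N \near \oo, 0 < N%:R :> R /\
    x / (gamma_k k * N%:R `^ (1 + 2 / k%:R) / Pi `^ k%:R^-1) = 2 * rad N * x / N%:R.
  near=> N.
  have nR0 : 0 < N%:R :> R by rewrite ltr0n; near: N; exact: nbhs_infty_gt.
  have n1 : 1 <= N%:R :> R by rewrite ler1n; near: N; exact: nbhs_infty_ge.
  split => //; rewrite /rad; have /max_idPl -> := n1.
  rewrite powRN powRD ?(gt_eqF nR0) ?implybT// powRr1 ?(ltW nR0)// /c1.
  have p1 : 0 < N%:R `^ (2 / k%:R) :> R by exact: powR_gt0.
  have p2 : 0 < Pi `^ k%:R^-1 by exact: powR_gt0.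
  by field; rewrite !gt_eqF.
(* Equivalent to (1 - de)(h - x) > -x, and it also gives (1 + de)(-x - h) < -x because -x - h <= h -
   x: a radius moved by h absorbs the relative error. *)
have den : \forall N \near \oo, de N * (h - x) < h.
  have hx0 : 0 < h - x by lra.
  near=> N; rewrite -ltr_pdivlMr//; near: N; apply: (cvgr_lt _ dec); exact: divr_gt0.
have de1 : \forall N \near \oo, de N < 1 by near=> N; near: N; exact: (cvgr_lt _ dec).
pose B z N : set (coordT R 'I_k) := [set y | rad N * z < qform b y / 2].
have mqb : measurable_fun setT (fun y : coordT R 'I_k => qform b y / 2).
  by apply: measurable_funM => //; exact: measurable_qform.
have mB z N : measurable (B z N) by exact: measurable_lt_set.
have cB z : 0 < z -> (fun N => N%:R * (1 - fine (P (Y @^-1` B z N)))) @ \oo --> z `^ al.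
  move=> z0; rewrite (_ : (fun N => _) = (fun N => N%:R * fine (P [set t | (qform b (Y t) / 2 <= rad N * z)%R]))).
    exact: small_ball_count.
  apply/funext => N; congr (_ * _).
  have mS : measurable [set t | qform b (Y t) / 2 <= rad N * z].
    exact: (measurable_le_set _ (measurable_qform_comp b gY)).
  have -> : Y @^-1` B z N = ~` [set t | qform b (Y t) / 2 <= rad N * z].
    by apply/seteqP; split => t /=; rewrite /B /= ltNge => /negP.
  rewrite probability_setC//.
  have : P [set t | (qform b (Y t) / 2 <= rad N * z)%R] \is a fin_num by rewrite fin_num_measure.
  by case: (P _) => //= p _; rewrite subKr.
exists (fun N => B (h - x) N), (fun N => B (- x - h) N); split => //.
- near=> N => y q; rewrite /B /= => yB qy.
  have [N0 ->] : 0 < N%:R :> R /\ x / (gamma_k k * N%:R `^ (1 + 2 / k%:R) / Pi `^ k%:R^-1) = 2 * rad N * x / N%:R by near: N.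
  have h1 : de N * (h - x) < h by near: N.
  have h2 : de N < 1 by near: N.
  rewrite ler_pM2r ?invr_gt0//.
  have := ler_wpM2l (mulr_ge0 (ltW C0) (powR_ge0 _ _) : 0 <= C * N%:R `^ (- 4^-1)) (sqb y).
  rewrite mulrA -/(de N) => h3; rewrite qab opprK in qy.
  have h4 := le_trans qy h3; move: h4; rewrite ler_norml => /andP[_ h4].
  have := rad0 N; have := de0 N; nra.
- near=> N => y q qy; rewrite /B /=.
  have [N0 ->] : 0 < N%:R :> R /\ x / (gamma_k k * N%:R `^ (1 + 2 / k%:R) / Pi `^ k%:R^-1) = 2 * rad N * x / N%:R by near: N.
  have h1 : de N * (h - x) < h by near: N.
  have h2 : de N < 1 by near: N.
  rewrite ler_pM2r ?invr_gt0// => hq.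
  have := ler_wpM2l (mulr_ge0 (ltW C0) (powR_ge0 _ _) : 0 <= C * N%:R `^ (- 4^-1)) (sqb y).
  rewrite mulrA -/(de N) => h3; rewrite qab opprK in qy.
  have h4 := le_trans qy h3; move: h4; rewrite ler_norml => /andP[h4 _].
  rewrite ltNge; apply/negP; rewrite ler_pdivrMr// => h5.
  have d1 : 0 <= 1 + de N by rewrite addr_ge0.
  have k1 := ler_wpM2r d1 h5.
  have k2 : 0 < rad N * (h - de N * (h - x)) by rewrite mulr_gt0// subr_gt0.
  have k3 : 0 <= rad N * (de N * h) by apply: mulr_ge0; [exact: ltW|apply: mulr_ge0 => //; exact: ltW].
  lra.
- by rewrite opprB; apply: cB; lra.
- by rewrite opprD; apply: cB; lra.
Unshelve. all: by end_near.
Qed.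

End weibull.

(** * Identification of the constants and conclusion *)

Section constants.
Context (R : realType).

Lemma maxI_max n (f : 'I_n -> R) : (0 < n)%N ->
  (forall i, f i <= maxI f) /\ exists i, f i = maxI f.
Proof.
move=> n0; have le_f i : f i <= maxI f by exact: ((maxI_leP f (maxI f) n0).1 (lexx _)).
split => //; case: (@arg_maxP _ _ _ (Ordinal n0) xpredT f erefl) => j _ hj; exists j.
by apply/eqP; rewrite eq_le le_f/=; apply/(maxI_leP f _ n0) => i; exact: hj.
Qed.

Lemma card_eq_ratio k (a : 'I_k -> R) (c : R) : c != 0 ->
  #|[set i | a i == c]| = #|[pred i | a i / c == 1]|.
Proof.
move=> c0; apply: eq_card => i; rewrite !inE /=.
apply/idP/idP => [/asboolP/eqP ->|/eqP h]; first by rewrite divff.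
by apply/asboolP/eqP; rewrite -(divfK c0 (a i)) h mul1r.
Qed.

Lemma qform_scale k (a : 'I_k -> R) (c : R) y : c != 0 ->
  qform a y / (2 * c) = qform (fun j => a j / c) y / 2.
Proof.
by move=> c0; rewrite /qform !mulr_suml; apply: eq_bigr => j _; field.
Qed.

Lemma ratio_neq1 (x c : R) : c != 0 -> (x / c != 1) = (x != c).
Proof.
move=> c0; congr negb; apply/eqP/eqP => [h|->]; last by rewrite divff.
by rewrite -(divfK c0 x) h mul1r.
Qed.

End constants.

Section tail_constants.
Context (R : realType) (k : nat) (a : 'I_k -> R).
Context d (T : measurableType d) (P : probability T R).
Hypothesis gE : forall I : finType, exists Y : T -> I -> R, gaussfam P Y.

(** Positivity is read off a Gaussian family of size m, where it is part of the chi-square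
    normalisation. *)
Lemma GammaR_half_gt0 m : (0 < m)%N -> 0 < GammaR (m%:R / 2 : R).
Proof.
move=> m0; have [Y gY] := gE 'I_m.
by have := (chisq_gamma gY _).1; rewrite card_ord; apply.
Qed.

Context (Y : T -> 'I_k -> R).
Hypotheses (gY : gaussfam P Y) (k0 : (0 < k)%N).

Lemma amax_tail (s : nat -> R) : 0 < amax a -> s @ \oo --> +oo ->
  (fun n => expR (s n) * s n `^ (1 - (mult_m a)%:R / 2) *
    fine (P [set t | (s n < qform a (Y t) / (2 * amax a))%R])) @ \oo --> expR (- c_m a).
Proof.
move=> c0 soo; have [le_a [j0 aj0]] := maxI_max a k0.
have cn0 : amax a != 0 by rewrite gt_eqF.
have me := card_eq_ratio a cn0; rewrite -/(mult_m a) in me.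
have m0 : (0 < mult_m a)%N by rewrite me; apply/card_gt0P; exists j0; rewrite inE /= aj0 divff.
have b1 j : a j / amax a <= 1 by rewrite ler_pdivrMr// mul1r le_a.
have := qform_tail_cvg gY b1 (eq_leq (esym me)) m0 soo.
rewrite -me eqxx mul1r.
have -> : (fun n => expR (s n) * s n `^ (1 - (mult_m a)%:R / 2) *
    fine (P [set t | (s n < qform (fun j => a j / amax a) (Y t) / 2)%R])) =
  (fun n => expR (s n) * s n `^ (1 - (mult_m a)%:R / 2) *
    fine (P [set t | (s n < qform a (Y t) / (2 * amax a))%R])).
  apply/funext => n; congr (_ * fine (P _)); apply/funext => t /=.
  by rewrite qform_scale.
have -> : \prod_(j < k | a j / amax a != 1) (1 - a j / amax a) =
          \prod_(j < k | a j != amax a) (1 - a j / amax a).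
  by apply: eq_bigl => j; rewrite ratio_neq1.
rewrite expRN lnK// posrE mulr_gt0 ?GammaR_half_gt0// sqrtr_gt0.
apply: prodr_gt0 => j aj; rewrite subr_gt0 ltr_pdivrMr// mul1r lt_neqAle aj.
exact: le_a.
Qed.

(** For s >= 0 the event |q| > s is the disjoint union of the upper tails of q and -q, that is of
    the forms normalised by [astar a] and by [- astar a], so the two limits add. *)
Lemma astar_tail (s : nat -> R) : (forall j, a j != 0) -> s @ \oo --> +oo ->
  (fun n => expR (s n) * s n `^ (1 - (maxn (mult_p a) (mult_n a))%:R / 2) *
    fine (P [set t | (s n < `|qform a (Y t)| / (2 * astar a))%R])) @ \oo --> expR (- c_star a).
Proof.
move=> an0 soo; have [le_a [j0 aj0]] := maxI_max (fun j => `|a j|) k0.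
have c0 : 0 < astar a by rewrite -[astar a]aj0 normr_gt0.
have cn0 : astar a != 0 by rewrite gt_eqF.
have cn0' : - astar a != 0 by rewrite oppr_eq0.
have mpe := card_eq_ratio a cn0; rewrite -/(mult_p a) in mpe.
have mne := card_eq_ratio a cn0'; rewrite -/(mult_n a) in mne.
set M := maxn _ _.
have M0 : (0 < M)%N.
  rewrite leq_max mpe mne; apply/orP; have := aj0; rewrite -/(astar a).
  case: (ler0P (a j0)) => _ e; [right|left]; apply/card_gt0P; exists j0; rewrite inE /=.
    by rewrite -e opprK divff.
  by rewrite -e divff// e.
have lea j : `|a j| <= astar a by exact: le_a.
have bp j : a j / astar a <= 1 by rewrite ler_pdivrMr// mul1r (le_trans (ler_norm _)).
have bn j : a j / - astar a <= 1.
  by rewrite invrN mulrN -mulNr ler_pdivrMr// mul1r (le_trans _ (lea j))// -normrN ler_norm.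
have leMp : (#|[pred j | (a j / astar a == 1)%R]| <= M)%N by rewrite -mpe leq_maxl.
have leMn : (#|[pred j | (a j / - astar a == 1)%R]| <= M)%N by rewrite -mne leq_maxr.
have tp := qform_tail_cvg gY bp leMp M0 soo.
have tn := qform_tail_cvg gY bn leMn M0 soo.
rewrite -mpe in tp; rewrite -mne in tn.
have G0 := GammaR_half_gt0 M0.
have pE : \prod_(j < k | a j / astar a != 1) (1 - a j / astar a) = prod_p a.
  by apply: eq_bigl => j; rewrite ratio_neq1.
have nE : \prod_(j < k | a j / - astar a != 1) (1 - a j / - astar a) = prod_n a.
  by apply: eq_big => [j|j _]; rewrite ?ratio_neq1// invrN mulrN opprK.
rewrite pE in tp; rewrite nE in tn.
have sp0 : 0 < Num.sqrt (prod_p a).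
  rewrite sqrtr_gt0 -pE; apply: prodr_gt0 => j aj.
  by rewrite subr_gt0 lt_neqAle aj bp.
have sn0 : 0 < Num.sqrt (prod_n a).
  rewrite sqrtr_gt0 -nE; apply: prodr_gt0 => j aj.
  by rewrite subr_gt0 lt_neqAle aj bn.
(* The three cases of [c_star] become one formula: a sign contributes when its multiplicity attains
   the maximum, and in a tie the two reciprocals add, which explains the bracket in the third
   case. *)
have cE : expR (- c_star a) =
   (mult_p a == M)%:R * (GammaR (M%:R / 2) * Num.sqrt (prod_p a))^-1 +
   (mult_n a == M)%:R * (GammaR (M%:R / 2) * Num.sqrt (prod_n a))^-1.
  rewrite expRN /c_star; have [lt|lt|e] := ltngtP (mult_n a) (mult_p a).
  - have ME : M = mult_p a by apply/maxn_idPl; exact: ltnW.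
    rewrite lnK ?posrE ?mulr_gt0 -?ME//.
    by rewrite ME eqxx (ltn_eqF lt) mul1r mul0r addr0.
  - have ME : M = mult_n a by apply/maxn_idPr; exact: ltnW.
    rewrite lnK ?posrE ?mulr_gt0 -?ME//.
    by rewrite ME eqxx (ltn_eqF lt) mul1r mul0r add0r.
  have ME : M = mult_p a by rewrite /M e maxnn.
  rewrite lnK -?ME ?e -?ME ?eqxx ?mul1r; last first.
    by rewrite posrE mulr_gt0// invr_gt0 addr_gt0// invr_gt0.
  by rewrite !invfM invrK mulrDr.
pose S c n := [set t | s n < qform (fun j => a j / c) (Y t) / 2].
have : (fun n => expR (s n) * s n `^ (1 - M%:R / 2) * fine (P (S (astar a) n)) +
    expR (s n) * s n `^ (1 - M%:R / 2) * fine (P (S (- astar a) n))) @ \oo --> expR (- c_star a).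
  by rewrite cE; apply: cvgD; [exact: tp|exact: tn].
apply: cvg_trans; apply: near_eq_cvg.
move/cvgryPge: soo => /(_ 0); apply: filterS => n s0.
rewrite /= -mulrDr; congr (_ * _).
have mS c : measurable (S c n) by exact: (measurable_lt_set _ (measurable_qform_comp _ gY)).
have -> : [set t | s n < `|qform a (Y t)| / (2 * astar a)] = S (astar a) n `|` S (- astar a) n.
  apply/seteqP; split => t; rewrite /S /= -!qform_scale// mulrN invrN mulrN -mulNr.
    by case: (ler0P (qform a (Y t))) => _; [right|left].
  case => h; apply: (lt_le_trans h); rewrite ler_pM2r ?invr_gt0 ?mulr_gt0// ?ler_norm//.
  by rewrite -normrN ler_norm.
rewrite measureU//; last first.
  apply/seteqP; split => // t; rewrite /S /= -!qform_scale// mulrN invrN mulrN => -[h1 h2].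
  lra.
by rewrite fineD// fin_num_measure.
Qed.

End tail_constants.

Unset Implicit Arguments.

Theorem theorem2p6 (R : realType) (k : nat) (a : 'I_k -> R)
  (d : measure_display) (T : measurableType d) (P : probability T R)
  (A : forall N : nat, 'M[R]_N) (H U : forall N : nat, T -> 'M[R]_N) :
  (0 < k)%N ->
  (forall i, a i != 0) ->
  (forall N, (k <= N)%N ->
     (A N)^T = A N /\
     char_poly (A N) = (\prod_(i < k) ('X - (a i)%:P)) * 'X^(N - k)) ->
  (forall N, is_GOE P (H N)) ->
  (forall N, is_eigvec_matrix (H N) (U N)) ->
  (0 < amax a ->
     cvg_dist P
       (fun N t => N%:R / (2 * amax a) *
                     maxI (fun i => quadf (A N) (col i (U N t)))
                   - ln N%:R + (1 - (mult_m a)%:R / 2) * ln (ln N%:R)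
                   + c_m a)
       gumbel_cdf /\
     cvg_dist P
       (fun N t => N%:R / (2 * astar a) *
                     maxI (fun i => `|quadf (A N) (col i (U N t))|)
                   - ln N%:R
                   + (1 - (maxn (mult_p a) (mult_n a))%:R / 2) * ln (ln N%:R)
                   + c_star a)
       gumbel_cdf) /\
  (amax a < 0 ->
     cvg_dist P
       (fun N t => gamma_k k * N%:R `^ (1 + 2 / k%:R) /
                     ((\prod_(j < k) `|a j|) `^ (k%:R^-1)) *
                     maxI (fun i => quadf (A N) (col i (U N t))))
       (weibull_cdf (k%:R / 2))).
Proof.
move=> k0 an0 hA hH hU; have gE I := gauss_exists I hH.
have [Y gY] := gE 'I_k.
(* Turns a bound on the centred and scaled maximum into one on the raw maximum, the form in which
   [gumbel_engine] states its threshold. *)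
have rescale (N M : nat) (c c0 x y : R) : (0 < N)%N -> 0 < c ->
    (N%:R / (2 * c) * y - ln N%:R + (1 - M%:R / 2) * ln (ln N%:R) + c0 <= x) =
    (y <= 2 * c / N%:R * (ln N%:R + (M%:R / 2 - 1) * ln (ln N%:R) + (x - c0))).
  move=> N0 cp; have nR0 : 0 < N%:R :> R by rewrite ltr0n.
  have -> : 2 * c / N%:R = (N%:R / (2 * c))^-1 by rewrite invf_div.
  rewrite ler_pdivlMl ?divr_gt0 ?mulr_gt0//.
  by set z := _ * y; apply/idP/idP; lra.
split=> [a0|a0 x].
  split=> x.
    have idB (p q : R) : p <= q + `|p - q| by have := ler_norm (p - q); lra.
    have cid : continuous (@id R) by move=> z; exact: cvg_id.
    have := gumbel_engine (th := id) (x := x) a0 cid (fun _ _ => erefl) idB hA hH hU gY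
      (fun s => amax_tail gE gY k0 a0).
    apply: cvg_trans; apply: near_eq_cvg; near=> N.
    have N0 : (0 < N)%N by near: N; exact: nbhs_infty_gt.
    congr (P _); apply/seteqP; split=> t /=; rewrite rescale//; by move/maxI_leP; apply.
  have s0 : 0 < astar a.
    by have [_ [j aj]] := maxI_max (fun j => `|a j|) k0; rewrite -[astar a]aj normr_gt0.
  have absZ (q : R) N : `|q / N%:R| = `|q| / N%:R by rewrite normrM normfV normr_nat.
  have absB (p q : R) : `|p| <= `|q| + `|p - q|.
    by rewrite -[X in `|X| <= _](subrK q) addrC; exact: ler_normD.
  have := gumbel_engine (x := x) s0 (@norm_continuous _ R) absZ absB hA hH hU gY
    (fun s => astar_tail gE gY k0 an0).
  apply: cvg_trans; apply: near_eq_cvg; near=> N.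
  have N0 : (0 < N)%N by near: N; exact: nbhs_infty_gt.
  congr (P _); apply/seteqP; split=> t /=; rewrite rescale//; by move/maxI_leP; apply.
have [le_a _] := maxI_max a k0.
have aneg j : a j < 0 by exact: le_lt_trans (le_a j) a0.
have := weibull_engine (x := x) k0 aneg gY hA hH hU.
apply: cvg_trans; apply: near_eq_cvg; near=> N.
have N0 : (0 < N)%N by near: N; exact: nbhs_infty_gt.
have K0 : 0 < gamma_k k * N%:R `^ (1 + 2 / k%:R) / (\prod_(j < k) `|a j|) `^ k%:R^-1 :> R.
  have nR0 : 0 < N%:R :> R by rewrite ltr0n.
  rewrite divr_gt0 ?mulr_gt0 ?powR_gt0 ?invr_gt0// ?divr_gt0 ?mulr_gt0 ?ltr0n//.
    exact: (GammaR_half_gt0 gE k0).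
  by apply: prodr_gt0 => j _; rewrite normr_gt0.
congr (P _); apply/seteqP; split=> t /=; rewrite -ler_pdivlMl// [_^-1 * x]mulrC; by move/maxI_leP; apply.
Unshelve. all: by end_near.
Qed.
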